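(* Let $0<\alpha<1$ and $\lambda\ge1$. The bilinear estimate $$\|\partial_x(v_1v_2)\|_{Z^s(\mathbb{T}_\lambda\times\mathbb{R})}\lesssim C_1(\lambda)\,\|v_1\|_{Y^s_\alpha(\mathbb{T}_\lambda\times\mathbb{R})}\|v_2\|_{Y^s_\alpha(\mathbb{T}_\lambda\times\mathbb{R})}$$ holds for $s\ge\min(1,\frac12+\frac12\nu_{c_1}+)$, where $$C_1(\lambda)=\begin{cases}\lambda^{\frac12+\frac12\nu_{c_1}+},&0\le\nu_{c_1}<1,\\ \lambda^{0+},&\nu_{c_1}\ge1.\end{cases}$$
   Context: $\mathbb{T}_\lambda=[0,2\pi\lambda)$ (periodic); $\langle\cdot\rangle=1+|\cdot|$. The spatial Fourier variable is $\xi\in\mathbb{Z}/\lambda$, with $\widehat f(\xi)=\int_0^{2\pi\lambda}e^{-ix\xi}f(x)\,dx$; $\widehat{\ }$ also denotes the space-time Fourier transform; norms in $\xi$ use the measure $\frac1{2\pi\lambda}\times$ counting measure on $\mathbb{Z}/\lambda$. $\|v\|_{Y^s_\alpha}=\|\langle\xi\rangle^s\langle\tau-\alpha\xi^3\rangle^{1/2}\widehat v\|_{L^2_{\xi,\tau}}+\|\langle\xi\rangle^s\widehat v\|_{L^2_\xi L^1_\tau}$, $\|u\|_{Z^s}=\|\langle\xi\rangle^s\langle\tau-\xi^3\rangle^{-1/2}\widehat u\|_{L^2_{\xi,\tau}}+\|\langle\xi\rangle^s\langle\tau-\xi^3\rangle^{-1}\widehat u\|_{L^2_\xi L^1_\tau}$.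 $c_1=\frac12+\frac{\sqrt{-3+12\alpha^{-1}}}{6}$. A real number $\rho$ is of type $\nu>0$ if there is $K>0$ such that $|\rho-\frac mn|\ge K|n|^{-2-\nu}$ for all pairs of integers $(m,n)$, $n\ne0$; $\nu_\rho=\infty$ if $\rho\in\mathbb{Q}$, and $\nu_\rho=\inf\{\nu>0:\rho\text{ is of type }\nu\}$ (with $\inf\emptyset=\infty$) if $\rho\notin\mathbb{Q}$. Notation: $s\ge\min(1,a+)$ means $s>a$ if $a<1$ and $s\ge1$ if $a\ge1$. $\lambda^{a+}$ means $\lambda^{a+\varepsilon}$ for arbitrarily small $\varepsilon>0$. $\lesssim$ means up to a constant depending only on $s$, $\alpha$ and $\varepsilon$, not on $\lambda\geq 1$ or on the functions. *)

(* Defs.v *)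
From mathcomp Require Import all_boot all_order all_algebra.
From mathcomp Require Export complex.
From mathcomp Require Import all_classical all_reals all_analysis.
Import Order.TTheory GRing.Theory Num.Theory.
Import numFieldNormedType.Exports.

Set Implicit Arguments.
Unset Strict Implicit.
Unset Printing Implicit Defensive.

Local Open Scope classical_set_scope.
Local Open Scope complex_scope.
Local Open Scope ring_scope.

Section Diophantine.
Variable R : realType.
Implicit Types rho nu alpha : R.

Definition c1 alpha : R := 2^-1 + Num.sqrt (- 3 + 12 * alpha^-1) / 6.

Definition of_type rho nu : Prop :=
  exists2 K : R, 0 < K &
    forall m n : int, n != 0 ->
      K * `|n%:~R| `^ (- 2 - nu) <= `|rho - m%:~R / n%:~R|.

(* [ereal_inf] of the empty set is [+oo] *)
Definition nu_index rho : \bar R :=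
  if `[< rational rho >] then +oo%E
  else ereal_inf [set nu%:E | nu in [set nu | 0 < nu /\ of_type rho nu]].

(* s >= min(1, a+) *)
Definition ge_min1_plus (s : R) (a : \bar R) : Prop :=
  ((a < 1)%E -> (a < s%:E)%E) /\ ((1 <= a)%E -> 1 <= s).

End Diophantine.

Section SpaceTime.
Variable R : realType.
Implicit Types (lambda alpha s : R) (v : R * R -> R[i]).

Local Notation leb := (@lebesgue_measure R).

(* The torus T_lambda is the interval [0, 2 pi lambda[; a function on
   T_lambda x R is given by its values on [strip lambda setT]. *)
Definition strip lambda (I : set R) : set (R * R) :=
  `[0, 2 * pi * lambda[ `*` I.

Definition expi (theta : R) : R[i] := cos theta +i* sin theta.

Definition Cintegral (D : set (R * R)) v : R[i] :=
  (\int[(leb \x leb)%E]_(p in D) complex.Re (v p))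
    +i* (\int[(leb \x leb)%E]_(p in D) complex.Im (v p)).

Definition fourier_on lambda (I : set R) v (xi tau : R) : R[i] :=
  Cintegral (strip lambda I) (fun p => expi (- (p.1 * xi + p.2 * tau)) * v p).

(* Space-time Fourier transform, for v integrable on T_lambda x R *)
Definition fourier lambda := fourier_on lambda setT.

(* The k-th frequency of Z/lambda; a function on (Z/lambda) x R is
   represented by V : int -> R -> _ where V k tau is its value at (k/lambda, tau). *)
Definition freq lambda (k : int) : R := k%:~R / lambda.

(* L^2_xi L^q_tau norm; for q = 2 this is the L^2_{xi,tau} norm. *)
Definition L2Lnorm lambda (q : R) (F : int -> R -> R) : \bar R :=
  (((2 * pi * lambda)^-1)%:E *
     \esum_(k in [set: int]) ('N[leb]_q%:E[EFin \o F k]) ^+ 2)%E `^ 2^-1.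

Definition square_integrable lambda v : Prop :=
  [/\ measurable_fun (strip lambda setT) (fun p => complex.Re (v p)),
      measurable_fun (strip lambda setT) (fun p => complex.Im (v p)) &
      (\int[(leb \x leb)%E]_(p in strip lambda setT)
         ((Normc.normc (v p)) ^+ 2)%:E < +oo)%E].

(* V is the Fourier transform of v in L^2(T_lambda x R), i.e. the L^2 limit of
   the Fourier integrals over the bounded time windows |t| <= n. For s >= 0 the
   weights in the Y^s_alpha norm are >= 1, so every element of Y^s_alpha is such
   a v. *)
Definition is_fourier_L2 lambda v (V : int -> R -> R[i]) : Prop :=
  [/\ square_integrable lambda v,
      (forall k, measurable_fun setT (fun tau => complex.Re (V k tau))),
      (forall k, measurable_fun setT (fun tau => complex.Im (V k tau))) &
      (fun n : nat => L2Lnorm lambda 2 (fun k tau => Normc.normc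
         (fourier_on lambda `[- n%:R, n%:R] v (freq lambda k) tau - V k tau)))
      @ \oo --> 0%E].

Definition bracket (x : R) : R := 1 + `|x|.

Definition weighted lambda (alpha s b : R) (V : int -> R -> R[i])
    (k : int) (tau : R) : R :=
  let xi := freq lambda k in
  bracket xi `^ s * bracket (tau - alpha * xi ^+ 3) `^ b * Normc.normc (V k tau).

(* The Y^s_alpha and Z^s norms of the function with Fourier transform V *)
Definition Ynorm lambda alpha s (V : int -> R -> R[i]) : \bar R :=
  (L2Lnorm lambda 2 (weighted lambda alpha s 2^-1 V) +
   L2Lnorm lambda 1 (weighted lambda alpha s 0 V))%E.

Definition Znorm lambda s (V : int -> R -> R[i]) : \bar R :=
  (L2Lnorm lambda 2 (weighted lambda 1 s (- 2^-1) V) +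
   L2Lnorm lambda 1 (weighted lambda 1 s (- 1) V))%E.

(* Fourier transform of the distributional (periodic) derivative d/dx w, for w
   integrable on T_lambda x R, in particular for a product of two L^2 functions *)
Definition fourier_dx lambda (w : R * R -> R[i]) (k : int) (tau : R) : R[i] :=
  (0 +i* freq lambda k) * fourier lambda w (freq lambda k) tau.

(* C_1(lambda), with eps the arbitrarily small loss in the exponent *)
Definition C1 alpha (eps lambda : R) : R :=
  let nu := nu_index (c1 alpha) in
  if (nu < 1)%E then lambda `^ (2^-1 + 2^-1 * fine nu + eps)
  else lambda `^ eps.

End SpaceTime.

(* Main.v *)
Require Import Defs.
From mathcomp Require Import all_boot all_order all_algebra complex.
From mathcomp Require Import all_classical all_reals all_analysis.
From mathcomp Require Import measurable_realfun.
From mathcomp Require Import ring lra.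
Import Order.TTheory GRing.Theory Num.Theory.
Import numFieldNormedType.Exports.

(** Two facts make the estimate true: the Fourier transform turns the product into a
    convolution, and the resonance of the interaction compensates the derivative
    except near two lines, where the Diophantine type of [c1 alpha] takes over.

    Write [xi1] and [xi2 = xi - xi1] for the input frequencies,
    [s0 = tau - xi^3], [s1 = tau1 - alpha xi1^3], [s2 = tau2 - alpha xi2^3] for the
    modulations, and [H = s0 - s1 - s2] for the resonance, which depends on [xi] and
    [xi1] only. Since [<H>^(1/2)] is at most the sum of the [<sj>^(1/2)], the
    modulation weights in the norms pay for a division of the symbol by
    [<H>^(1/2)] ([symbol_le]). There remains the multiplier
    [m = |xi| <xi>^s <xi1>^-s <xi2>^-s <H>^(-1/2)] ([mult]), and Cauchy-Schwarz in
    [xi1], followed by Young's inequality in the time frequency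
    ([mixed_L2_bound], [mixed_L1_bound]), reduces the estimate to a bound for the
    normalised sum of [m^2] over [xi1], uniform in [xi] ([bilinear_estimate]).

    That sum is estimated in [multiplier_bound]. The resonance factorises as
    [3 alpha xi (xi1 - c1 xi) (xi1 - (1 - c1) xi)] ([resonance_factor]), and the two
    lines are transversal, so that [m^2] is controlled by symbols that are large near
    a single line ([mult_sqr_le]). Away from a line the sum is harmonic and costs an
    arbitrarily small power of [lambda] ([line_sum_le]). At most two lattice
    points lie at distance less than one mesh from a line; there the weights suffice
    if [s >= 1] ([near_bound_ge1]), and otherwise the type of [c1] bounds the distance
    from below, which costs the power of [lambda] in [C1] ([near_bound_diophantine]).

    The convolution formula is needed only as an upper bound for the modulus of the
    transform of a product of two functions given through their [L^2] Fourier
    transforms ([fourier_mul_le]). On a rectangle it is the Parseval inequality, which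
    rests on the orthogonality and the completeness of the characters
    ([parseval_le], [char_dense]). Averaging the lattice of time frequencies over its
    translates replaces the sum over that lattice by an integral and removes the
    dependence on the length of the time window ([parseval_window]); the window then
    grows to the whole line. Completeness is obtained from the sigma-algebra of sets
    whose indicators are mean-square limits of trigonometric polynomials: it
    contains the half-lines by an explicit sequence of polynomials
    ([cvg_threshold]), hence all measurable sets. *)

Set Implicit Arguments.
Unset Strict Implicit.
Unset Printing Implicit Defensive.
Local Open Scope classical_set_scope.
Local Open Scope complex_scope.
Local Open Scope ring_scope.

(** * Sums over countable types *)

Section EsumCountable.
Context {R : realType} {T : countType}.
Local Open Scope ereal_scope.
Implicit Types a b : T -> \bar R.

(** Sums over a countable type are series, so that the theory of series of
    integrals applies to them. *)
Lemma esum_pickle a : (forall i, 0 <= a i) ->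
  \esum_(i in [set: T]) a i = \sum_(n <oo) oapp a 0 (pickle_inv n : option T).
Proof.
move=> a0; rewrite nneseries_esumT; last first.
  by move=> n; case: pickle_inv => //= x.
transitivity (\esum_(n in [set pickle x | x in [set: T]])
    oapp a 0 (pickle_inv n : option T)).
  rewrite esum_image; last by move=> x y _ _; apply: (pcan_inj pickleK).
  by apply: eq_esum => i _; rewrite pickleK_inv.
rewrite esum_mkcond; apply: eq_esum => n _.
case: ifPn => //; rewrite notin_setE => h.
case E: (pickle_inv n) => [x|//]; case: h; exists x => //.
by have := @pickle_invK T n; rewrite E.
Qed.

Lemma le_esum_term a i : (forall j, 0 <= a j) -> a i <= \esum_(j in [set: T]) a j.
Proof.
move=> a0; apply: esum_ge; exists [set i]; first by split.
by rewrite fsbig_set1.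
Qed.

Lemma ge0_esumZl a (c : \bar R) : (forall i, 0 <= a i) -> 0 <= c ->
  \esum_(i in [set: T]) (c * a i) = c * \esum_(i in [set: T]) a i.
Proof.
move=> a0; case: c => [c|_|//].
  move=> c0; rewrite !esum_pickle//; last by move=> i; rewrite mule_ge0.
  rewrite -nneseriesZl//; last by move=> n _; case: pickle_inv => //=.
  by apply: eq_eseriesr => n _; case: pickle_inv => //=; rewrite mule0.
have [[i ai]|/forallNP a_eq0] := pselect (exists i, 0 < a i).
  have ya i' : 0 <= +oo * a i' by rewrite mule_ge0.
  rewrite [RHS]gt0_mulye; last exact: lt_le_trans ai (le_esum_term _ _).
  apply/eqP; rewrite eq_le leey/=.
  by have := le_esum_term i ya; rewrite gt0_mulye.
have {}a_eq0 i : a i = 0.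
  by apply/eqP; rewrite eq_le a0 andbT leNgt; apply/negP.
by rewrite !esum1 ?mule0// => i _; rewrite a_eq0 mule0.
Qed.

Lemma ge0_integral_esum d (X : measurableType d) (mu : {measure set X -> \bar R})
    (D : set X) (f : T -> X -> \bar R) : measurable D ->
  (forall i, measurable_fun D (f i)) -> (forall i x, D x -> 0 <= f i x) ->
  \int[mu]_(x in D) (\esum_(i in [set: T]) f i x) =
  \esum_(i in [set: T]) \int[mu]_(x in D) f i x.
Proof.
move=> mD mf f0; rewrite [RHS]esum_pickle; last first.
  by move=> i; apply: integral_ge0 => x Dx; exact: f0.
transitivity (\int[mu]_(x in D) (\sum_(n <oo) 
    oapp (fun i => f i x) 0 (pickle_inv n : option T))).
  by apply: eq_integral => x /[!inE] Dx; rewrite esum_pickle// => i; exact: f0.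
rewrite integral_nneseries//.
- by apply: eq_eseriesr => n _; case: pickle_inv => //=; rewrite integral0.
- by move=> n; case: pickle_inv => //= t; exact: mf.
- by move=> n x Dx; case: pickle_inv => //= t; exact: f0.
Qed.

Lemma measurable_esum d (X : measurableType d) (D : set X)
    (f : T -> X -> \bar R) : measurable D ->
  (forall i, measurable_fun D (f i)) -> (forall i x, D x -> 0 <= f i x) ->
  measurable_fun D (fun x => \esum_(i in [set: T]) f i x).
Proof.
move=> mD mf f0.
apply: (eq_measurable_fun (fun x => \sum_(n <oo) 
    oapp (fun i => f i x) 0 (pickle_inv n : option T))).
  by move=> x /[!inE] Dx; rewrite esum_pickle// => i; exact: f0.
apply: ge0_emeasurable_sum => //.
- by move=> n x Dx _; case: pickle_inv => //= t; exact: f0.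
- by move=> n _; case: pickle_inv => //= t; exact: mf.
Qed.

End EsumCountable.

Lemma esum_reflect {R : realType} (a : int -> \bar R) (k : int) :
  (\esum_(j in [set: int]) a (k - j)%R = \esum_(j in [set: int]) a j)%E.
Proof.
have bij : set_bij [set: int] [set: int] (fun j => k - j).
  split => // [x y _ _ /addrI/oppr_inj//|x _]; exists (k - x) => //.
  by rewrite opprB addrC subrK.
by rewrite [RHS](reindex_esum _ _ _ _ bij).
Qed.

(** * Cauchy-Schwarz inequalities *)

Section CauchySchwarz.
Context {R : realType}.
Local Open Scope ereal_scope.

(** The optimal parameter [d = sqrt (B / M)] turns the additive form of
    Cauchy-Schwarz into the multiplicative one; the additive form passes through
    sums and integrals whose values may be infinite. *)
Lemma sqre_le_of_young (X B : \bar R) (M : R) : 0 <= X -> 0 <= B -> (0 < M)%R ->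
  (forall d : R, (0 < d)%R -> X + X <= (d * M)%:E + (d^-1)%:E * B) ->
  X ^+ 2 <= M%:E * B.
Proof.
move=> X0 + M0; case: B => [b||//].
- rewrite lee_fin => b0; case: X X0 => [x x0 H||//].
  + rewrite lee_fin in x0.
    have {}H : forall d : R, (0 < d)%R -> (x + x <= d * M + d^-1 * b)%R.
      by move=> d d0; have := H d d0; rewrite -EFinM -!EFinD lee_fin.
    rewrite -EFin_expe -EFinM lee_fin.
    have [b_eq0|bN0] := eqVneq b 0%R.
      rewrite b_eq0 mulr0.
      have [->|xN0] := eqVneq x 0%R; first by rewrite expr0n.
      have xp : (0 < x)%R by rewrite lt_neqAle eq_sym xN0.
      have := H (x / M)%R (divr_gt0 xp M0).
      by rewrite b_eq0 mulr0 addr0 divfK ?gt_eqF//; lra.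
    have bp : (0 < b)%R by rewrite lt_neqAle eq_sym bN0.
    set r := Num.sqrt (b / M).
    have rp : (0 < r)%R by rewrite sqrtr_gt0 divr_gt0.
    have r2 : (r ^+ 2 = b / M)%R by rewrite sqr_sqrtr// ltW// divr_gt0.
    have := H _ rp.
    have -> : (r^-1 * b = r * M)%R.
      apply: (mulfI (lt0r_neq0 rp)); rewrite mulrA mulfV ?gt_eqF// mul1r.
      by rewrite mulrA -expr2 r2 divfK// gt_eqF.
    move=> Hx; have {}Hx : (x <= r * M)%R by lra.
    apply: (@le_trans _ _ ((r * M) ^+ 2)%R).
      by rewrite ler_sqr ?nnegrE// mulr_ge0// ltW.
    rewrite exprMn r2 expr2 mulrA divfK ?gt_eqF//.
    by rewrite mulrC.
  + by move=> _ /(_ 1%R ltr01); rewrite invr1 mul1r mul1e -EFinD.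
- by move=> _ _; rewrite gt0_muley ?lte_fin// leey.
Qed.

Lemma young_ereal (m d : R) (q : \bar R) : (0 <= m)%R -> (0 < d)%R -> 0 <= q ->
  m%:E * q + m%:E * q <= d%:E * (m ^+ 2)%:E + d^-1%:E * q ^+ 2.
Proof.
move=> m0 d0; case: q => [q||//].
- rewrite lee_fin => q0; rewrite -EFin_expe -!EFinM -!EFinD lee_fin.
  rewrite -subr_ge0.
  have -> : (d * m ^+ 2 + d^-1 * q ^+ 2 - (m * q + m * q) =
    d^-1 * (d * m - q) ^+ 2)%R by field; rewrite gt_eqF.
  by rewrite mulr_ge0 ?sqr_ge0// invr_ge0 ltW.
- move=> _; rewrite expe2 mulyy [X in _ <= _ + X]gt0_muley ?lte_fin ?invr_gt0//.
  by rewrite addey ?leey.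
Qed.

Lemma esum_cauchy_schwarz {T : countType} (m : T -> R) (q : T -> \bar R) (M : R) :
  (forall i, 0 <= m i)%R -> (forall i, 0 <= q i) -> (0 < M)%R ->
  \esum_(i in [set: T]) (m i ^+ 2)%:E <= M%:E ->
  (\esum_(i in [set: T]) ((m i)%:E * q i)) ^+ 2 <=
  M%:E * \esum_(i in [set: T]) (q i ^+ 2).
Proof.
move=> m0 q0 M0 mM.
have mq0 i : 0 <= (m i)%:E * q i by rewrite mule_ge0 ?lee_fin.
have q20 i : 0 <= q i ^+ 2 by rewrite expe_ge0.
apply: sqre_le_of_young => //; [exact: esum_ge0|exact: esum_ge0|].
move=> d d0; rewrite -esumD// EFinM.
apply: (@le_trans _ _ (\esum_(i in [set: T])
    (d%:E * (m i ^+ 2)%:E + d^-1%:E * q i ^+ 2))).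
  by apply: le_esum => i _; exact: young_ereal.
rewrite esumD//.
- have [d0' di0] : (0 <= d)%R /\ (0 <= d^-1)%R by rewrite invr_ge0 !ltW.
  rewrite !ge0_esumZl ?lee_fin//; last by move=> i; rewrite lee_fin sqr_ge0.
  by rewrite leeD2r// lee_wpmul2l.
- by move=> i _; rewrite mule_ge0 ?lee_fin ?sqr_ge0// ltW.
- by move=> i _; rewrite mule_ge0// lee_fin invr_ge0 ltW.
Qed.

Lemma integral_cauchy_schwarz d (X : measurableType d)
    (mu : {measure set X -> \bar R}) (f : X -> R) (q : X -> \bar R) (M : R) :
  measurable_fun setT f -> measurable_fun setT q ->
  (forall x, 0 <= f x)%R -> (forall x, 0 <= q x) -> (0 <= M)%R ->
  \int[mu]_x (f x ^+ 2)%:E <= M%:E ->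
  (\int[mu]_x ((f x)%:E * q x)) ^+ 2 <= M%:E * \int[mu]_x (q x ^+ 2).
Proof.
move=> mf mq f0 q0 M0 fM.
have mf2 : measurable_fun setT (fun x => (f x ^+ 2)%:E).
  by apply/measurable_EFinP; exact: measurable_funX.
have mfq : measurable_fun setT (fun x => (f x)%:E * q x).
  by apply: emeasurable_funM => //; exact/measurable_EFinP.
have mq2 : measurable_fun setT (fun x => q x ^+ 2).
  by under eq_fun do rewrite expe2; apply: emeasurable_funM.
have fq0 x : 0 <= (f x)%:E * q x by rewrite mule_ge0 ?lee_fin.
have q20 x : 0 <= q x ^+ 2 by rewrite expe_ge0.
have [M_eq0|MN0] := eqVneq M 0%R.
  rewrite M_eq0 mul0e.
  suff -> : \int[mu]_x ((f x)%:E * q x) = 0 by rewrite expe2 mule0.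
  have /ae_eq_integral_abs : \int[mu]_x `|(f x ^+ 2)%:E| = 0.
    apply/eqP; rewrite eq_le integral_ge0// andbT.
    rewrite M_eq0 in fM; apply: le_trans fM; apply: ge0_le_integral => //.
    - exact: measurableT_comp.
    - by move=> x _; rewrite gee0_abs// lee_fin sqr_ge0.
  move=> /(_ measurableT mf2) ae0.
  rewrite (@ge0_ae_eq_integral _ _ _ mu setT _ (cst 0))//.
    by rewrite integral0.
  apply: filterS ae0 => x /= /(_ I) [] /eqP.
  by rewrite sqrf_eq0 => /eqP -> _; rewrite mul0e.
have Mp : (0 < M)%R by rewrite lt_neqAle eq_sym MN0.
apply: sqre_le_of_young => //; [exact: integral_ge0|exact: integral_ge0|].
move=> e e0; rewrite -ge0_integralD// EFinM.
apply: (@le_trans _ _ (\int[mu]_x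
    (e%:E * (f x ^+ 2)%:E + e^-1%:E * q x ^+ 2))).
  apply: ge0_le_integral => //.
  - by move=> x _; rewrite adde_ge0.
  - exact: emeasurable_funD.
  - by apply: emeasurable_funD; exact: emeasurable_funM.
  - by move=> x _; exact: young_ereal.
have ei : (0 <= e^-1)%R by rewrite invr_ge0 ltW.
rewrite ge0_integralD//.
- have e0' : (0 <= e)%R by rewrite ltW.
  rewrite !ge0_integralZl ?lee_fin//; last by move=> x _; rewrite lee_fin sqr_ge0.
  by rewrite leeD2r// lee_wpmul2l.
- by move=> x _; rewrite mule_ge0 ?lee_fin ?sqr_ge0// ltW.
- exact: emeasurable_funM.
- by move=> x _; rewrite mule_ge0.
- exact: emeasurable_funM.
Qed.

End CauchySchwarz.

(** * Reflection, translation and convolution on the line *)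

Section Line.
Context {R : realType}.
Local Notation leb := (@lebesgue_measure R).
Local Open Scope ereal_scope.

Lemma measurable_subl (c : R) : measurable_fun [set: measurableTypeR R]
  (fun x => c - x : measurableTypeR R)%R.
Proof. exact: measurable_funB. Qed.

Lemma measurable_addr (c : R) : measurable_fun [set: measurableTypeR R]
  (fun x => x + c : measurableTypeR R)%R.
Proof. exact: measurable_funD. Qed.

Lemma ge0_integral_addr (c : R) (D : set R) (f : R -> \bar R) : measurable D ->
  measurable_fun D f -> (forall x, D x -> 0 <= f x) ->
  \int[leb]_(x in (fun x => x + c)%R @^-1` D) f (x + c)%R = \int[leb]_(x in D) f x.
Proof.
move=> mD mf f0.
rewrite -(ge0_integral_pushforward (measurable_addr c))//; last first.
  by move=> x /[!inE]; exact: f0.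
apply: eq_measure_integral ; first exact: measurable_addr.
move=> mp A mA _.
apply/esym/lebesgue_measure_unique => //= _ [[a b]] _ <-.
rewrite /pushforward/=.
rewrite (_ : (fun x => x + c)%R @^-1` _ = `]a - c, b - c]%classic)%R; last first.
  by apply/seteqP; split => x /=; rewrite !in_itv/=; lra.
rewrite !lebesgue_measure_itv/= !lte_fin ltrD2r; case: ifPn => // _.
by rewrite -!EFinD; congr EFin; lra.
Qed.

Lemma ge0_integral_subl (c : R) (f : R -> \bar R) :
  measurable_fun setT f -> (forall x, 0 <= f x) ->
  \int[leb]_x f (c - x)%R = \int[leb]_x f x.
Proof.
move=> mf f0.
rewrite -[LHS](ge0_integral_pushforward (measurable_subl c) _ measurableT mf)//.
apply: eq_measure_integral ; first exact: measurable_subl.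
move=> mp A mA _.
apply/esym/lebesgue_measure_unique => //= _ [[a b]] _ <-.
rewrite /pushforward/=.
rewrite (_ : (fun x => c - x)%R @^-1` _ = `[c - b, c - a[%classic)%R; last first.
  by apply/seteqP; split => x /=; rewrite !in_itv/=; lra.
rewrite !lebesgue_measure_itv/= !lte_fin ltrD2l ltrN2; case: ifPn => // _.
by rewrite -!EFinD; congr EFin; lra.
Qed.

(** Extended-real valued, so that no integrability has to be tracked for
    nonnegative [f] and [g]. *)
Definition convolution (f g : R -> R) (t : R) : \bar R :=
  \int[leb]_x (f x * g (t - x)%R)%:E.

Section Convolution.
Variables f g : R -> R.
Hypotheses (mf : measurable_fun setT f) (mg : measurable_fun setT g).
Hypotheses (f0 : forall x, (0 <= f x)%R) (g0 : forall x, (0 <= g x)%R).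

Lemma conv_ge0 t : 0 <= convolution f g t.
Proof. by apply: integral_ge0 => x _; rewrite lee_fin mulr_ge0. Qed.

Lemma measurable_conv_kernel :
  measurable_fun setT (fun p : R * R => (f p.2 * g (p.1 - p.2))%R).
Proof.
apply: measurable_funM; first exact: measurableT_comp.
by apply: measurableT_comp => //; exact: measurable_funB.
Qed.

Lemma measurable_conv : measurable_fun setT (convolution f g).
Proof.
apply: (measurable_fun_fubini_tonelli_F (m2 := leb)
  (fun p : R * R => (f p.2 * g (p.1 - p.2))%:E)).
  by apply/measurable_EFinP; exact: measurable_conv_kernel.
by move=> p; rewrite lee_fin mulr_ge0.
Qed.

Lemma convolutionC t : convolution f g t = convolution g f t.
Proof.
have mh : measurable_fun setT (fun x => (f x * g (t - x)%R)%:E).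
  apply/measurable_EFinP; apply: measurable_funM => //.
  by apply: measurableT_comp => //; exact: measurable_funB.
rewrite /convolution -(ge0_integral_subl t mh); last first.
  by move=> x; rewrite lee_fin mulr_ge0.
by apply: eq_integral => x _; rewrite mulrC; congr (g _ * _)%:E; lra.
Qed.

Lemma integral_conv : \int[leb]_t convolution f g t =
  (\int[leb]_x (f x)%:E) * (\int[leb]_x (g x)%:E).
Proof.
rewrite /convolution (fubini_tonelli (m1 := leb) (m2 := leb)
  (fun p : R * R => (f p.2 * g (p.1 - p.2))%:E)); last 2 first.
- by apply/measurable_EFinP; exact: measurable_conv_kernel.
- by move=> p; rewrite lee_fin mulr_ge0.
rewrite -ge0_integralZr//; last 3 first.
- by apply/measurable_EFinP.
- by move=> x _; rewrite lee_fin.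
- by apply: integral_ge0 => x _; rewrite lee_fin.
apply: eq_integral => x _ /=.
under eq_integral do rewrite EFinM.
rewrite ge0_integralZl_EFin//; last 2 first.
- by move=> y _; rewrite lee_fin.
- by apply/measurable_EFinP/measurableT_comp => //; exact: measurable_funB.
congr (_ * _).
have mgE : measurable_fun setT (EFin \o g) by exact/measurable_EFinP.
have := @ge0_integral_addr (- x) setT (EFin \o g) measurableT mgE.
by rewrite preimage_setT; apply => y _ /=; rewrite lee_fin.
Qed.

End Convolution.

(** Cauchy-Schwarz for the measure [g (t - x) dx], of mass [N], gives
    [(f * g)^2 <= N (f^2 * g)] pointwise; the integral of the right-hand side
    factorises. *)
Lemma young_L2_L1 (f g : R -> R) (N : R) :
  measurable_fun setT f -> measurable_fun setT g ->
  (forall x, (0 <= f x)%R) -> (forall x, (0 <= g x)%R) ->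
  \int[leb]_x (g x)%:E = N%:E ->
  \int[leb]_t (convolution f g t) ^+ 2 <= (N ^+ 2)%:E * \int[leb]_x (f x ^+ 2)%:E.
Proof.
move=> mf mg f0 g0 gN.
have N0 : (0 <= N)%R by rewrite -lee_fin -gN integral_ge0// => x _; rewrite lee_fin.
have mf2 : measurable_fun setT (fun x => f x ^+ 2)%R by exact: measurable_funX.
have f20 x : (0 <= f x ^+ 2)%R by exact: sqr_ge0.
have mgt (t : R) : measurable_fun setT (fun x : R => g (t - x))%R.
  by apply: measurableT_comp => //; exact: measurable_funB.
have mc := measurable_conv mf mg f0 g0.
apply: (@le_trans _ _ (\int[leb]_t (N%:E * convolution (fun x => f x ^+ 2)%R g t))).
  apply: ge0_le_integral => //.
  - by move=> t _; rewrite expe_ge0// conv_ge0.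
  - by under eq_fun do rewrite expe2; exact: emeasurable_funM.
  - by apply: emeasurable_funM => //; exact: measurable_conv.
  move=> t _.
  have -> : convolution f g t = \int[leb]_x ((Num.sqrt (g (t - x)))%:E *
      (f x * Num.sqrt (g (t - x)))%:E).
    apply: eq_integral => x _; rewrite -EFinM mulrCA; congr (_ * _)%:E.
    by rewrite -expr2 sqr_sqrtr.
  have -> : convolution (fun x => f x ^+ 2)%R g t =
      \int[leb]_x ((f x * Num.sqrt (g (t - x)))%:E ^+ 2).
    by apply: eq_integral => x _; rewrite -EFin_expe exprMn sqr_sqrtr.
  have ms : measurable_fun setT (fun x : R => Num.sqrt (g (t - x)))%R.
    apply: measurableT_comp (mgt t).
    apply: continuous_measurable_fun; exact: sqrt_continuous.
  apply: integral_cauchy_schwarz => //.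
  - by apply/measurable_EFinP; exact: measurable_funM.
  - by move=> x; rewrite lee_fin mulr_ge0.
  - rewrite -gN -(@ge0_integral_subl t (EFin \o g)).
    + by under eq_integral do rewrite sqr_sqrtr//.
    + exact/measurable_EFinP.
    + by move=> x; rewrite lee_fin.
rewrite ge0_integralZl_EFin//; last 2 first.
- by move=> t _; exact: conv_ge0.
- exact: measurable_conv.
rewrite integral_conv// gN muleCA -EFinM.
by rewrite muleC -expr2.
Qed.

End Line.

(** * Tilings of the line and sums of brackets over lattices *)

Section Tiling.
Context {R : realType}.
Local Notation leb := (@lebesgue_measure R).
Local Open Scope ereal_scope.

Lemma esum_single {T : countType} (a : T -> \bar R) (i0 : T) : 0 <= a i0 ->
  (forall i, i != i0 -> a i = 0) -> \esum_(i in [set: T]) a i = a i0.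
Proof.
move=> a0 ai.
transitivity (\esum_(i in [set i0]) a i); last by rewrite esum_set1.
rewrite [RHS]esum_mkcond; apply: eq_esum => i _.
case: ifPn => //; rewrite notin_setE /= => /eqP; exact: ai.
Qed.

(** Only the tile of index [floor (x / w)] contains [x]. *)
Lemma esum_tiling_le (w : R) (f : R -> \bar R) : (0 < w)%R ->
  measurable_fun setT f -> (forall x, 0 <= f x) ->
  \esum_(k in [set: int]) \int[leb]_(x in `[(k%:~R * w)%R, ((k + 1)%:~R * w)%R[) f x
  <= \int[leb]_x f x.
Proof.
move=> w0 mf f0.
under eq_esum do rewrite integral_mkcond.
rewrite -ge0_integral_esum//; last 2 first.
- by move=> k; apply/(measurable_restrictT _ _).1 => //; exact: measurable_funS mf.
- by move=> k x _; rewrite /patch; case: ifPn.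
apply: ge0_le_integral => //.
- by move=> x _; apply: esum_ge0 => k _; rewrite /patch; case: ifPn.
- apply: measurable_esum => //.
  + by move=> k; apply/(measurable_restrictT _ _).1 => //; exact: measurable_funS mf.
  + by move=> k x _; rewrite /patch; case: ifPn.
move=> x _; rewrite (@esum_single _ _ (Num.floor (x / w))).
- by rewrite /patch; case: ifPn => _.
- by rewrite /patch; case: ifPn => _.
move=> k kx; rewrite patchE ifF//; apply/negbTE; rewrite notin_setE /= in_itv/=.
move=> /andP[k1 k2]; move: kx; rewrite eq_sym => /eqP; apply.
by apply: floor_def; rewrite ler_pdivlMr// ltr_pdivrMr// k1.
Qed.

End Tiling.

Section Brackets.
Context {R : realType}.
Local Notation leb := (@lebesgue_measure R).
Implicit Types (x y p : R).

Lemma bracket_ge1 x : 1 <= bracket x.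
Proof. by rewrite lerDl. Qed.

Lemma bracket_gt0 x : 0 < bracket x.
Proof. exact: lt_le_trans (bracket_ge1 x). Qed.

Lemma bracket_ge0 x : 0 <= bracket x.
Proof. exact: ltW (bracket_gt0 x). Qed.

Lemma bracketN x : bracket (- x) = bracket x.
Proof. by rewrite /bracket normrN. Qed.

Lemma bracketD x y : bracket (x + y) <= bracket x + bracket y.
Proof. by rewrite /bracket; have := ler_normD x y; lra. Qed.

Lemma bracketD_mul x y : bracket (x + y) <= bracket x * bracket y.
Proof.
rewrite /bracket; have := ler_normD x y.
have : 0 <= `|x| * `|y| by rewrite mulr_ge0.
lra.
Qed.

Lemma continuous_bracket : continuous (@bracket R).
Proof.
move=> x; rewrite /bracket; apply: continuousD; first exact: cvg_cst.
exact: norm_continuous.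
Qed.

Lemma measurable_bracket : measurable_fun setT (@bracket R).
Proof. exact: continuous_measurable_fun continuous_bracket. Qed.

Lemma measurable_bracket_powR p :
  measurable_fun setT (fun x : R => bracket x `^ p).
Proof. by apply: (measurableT_comp (measurable_powR p)); exact: measurable_bracket. Qed.

Lemma cvg_powR_pinfty q : 0 < q -> (1 + x) `^ (- q) @[x --> +oo] --> (0 : R).
Proof.
move=> q0; apply/cvgrPdist_le => /= e e0; near=> x.
rewrite sub0r normrN ger0_norm ?powR_ge0//.
have ex : e `^ (- q^-1) <= 1 + x.
  apply: (@le_trans _ _ x); last by rewrite lerDr.
  near: x; exact: nbhs_pinfty_ge.
have E : e = (e `^ (- q^-1)) `^ (- q).
  by rewrite -powRrM mulrNN mulVf ?gt_eqF// powRr1// ltW.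
have x1 : 0 < 1 + x by apply: lt_le_trans ex; exact: powR_gt0.
rewrite E ![_ `^ (- q)]powRN lef_pV2 ?posrE ?powR_gt0//.
by apply: (ge0_ler_powR (ltW q0)); rewrite ?nnegrE ?powR_ge0// ltW.
Unshelve. all: by end_near. Qed.

Lemma integral_bracket_half p : 1 < p ->
  (\int[leb]_(x in `[0%R, +oo[) (bracket x `^ (- p))%:E = ((p - 1)^-1)%:E)%E.
Proof.
move=> p1; have q0 : 0 < p - 1 by rewrite subr_gt0.
pose F x := - ((p - 1)^-1 * (1 + x) `^ (- (p - 1))) : R.
pose f x := bracket x `^ (- p) : R.
have dF x : 0 < x -> is_derive x 1 F ((1 + x) `^ (- p)).
  move=> x0; have x1 : 0 < 1 + x by lra.
  have h : is_derive (1 + x) 1 (fun y => y `^ (- (p - 1))) _ :=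
    is_derive1_powR (- (p - 1)) x1.
  have g : is_derive x 1 (fun y : R => 1 + y) 1.
    by have := is_deriveD (is_derive_cst (1 : R) x 1) (is_derive_id x 1);
      rewrite add0r.
  have c := is_derive1_comp h g.
  rewrite /F; apply: is_derive_eq.
  rewrite /GRing.scale/= mulr1 mulNr mulrN opprK mulrA mulVf ?gt_eqF// mul1r.
  by congr powR; lra.
have -> : ((p - 1)^-1)%:E = (0%:E - (F 0)%:E)%E.
  by rewrite -EFinD /F addr0 powR1 mulr1 opprK add0r.
apply: (@ge0_continuous_FTC2y _ f F 0 0).
- by move=> x _; exact: powR_ge0.
- apply: continuous_subspaceT => x.
  have := @continuous_bracket x => cb.
  apply: (@continuous_comp _ _ _ (@bracket R) (fun y => y `^ (- p))) => //.
  apply: differentiable_continuous; apply/derivable1_diffP.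
  by apply: derivable_powR; rewrite in_itv/= bracket_gt0.
- rewrite -oppr0; apply: cvgN.
  rewrite -(mulr0 (p - 1)^-1); apply: cvgM; first exact: cvg_cst.
  exact: cvg_powR_pinfty.
- by move=> x x0; have [] := dF x x0.
- apply: cvg_at_right_filter.
  apply: cvgN; apply: cvgM; first exact: cvg_cst.
  apply: (@continuous_comp _ _ _ (fun y : R => 1 + y) (fun y => y `^ (- (p - 1)))).
    by apply: cvgD; [exact: cvg_cst|exact: cvg_id].
  apply: differentiable_continuous; apply/derivable1_diffP.
  by apply: derivable_powR; rewrite in_itv/= addr0 ltr01.
- move=> x; rewrite in_itv/= andbT => x0.
  by rewrite derive1E; have [_ ->] := dF x x0; rewrite /f /bracket ger0_norm// ltW.
Qed.

Lemma integral_bracket_le p : 1 < p ->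
  (\int[leb]_x (bracket x `^ (- p))%:E <= (2 * (p - 1)^-1)%:E)%E.
Proof.
move=> p1.
have mb : measurable_fun setT (fun x : R => (bracket x `^ (- p))%:E).
  by apply/measurable_EFinP; exact: measurable_bracket_powR.
have b0 x : (0%:E <= (bracket x `^ (- p))%:E)%E by rewrite lee_fin powR_ge0.
have -> : [set: R] = `]-oo, 0] `|` `]0, +oo[.
  by apply/seteqP; split => x //= _; rewrite !in_itv/= andbT; case: leP; [left|right].
rewrite ge0_integral_setU//; last 2 first.
- exact: measurable_funS mb.
- apply/disj_setPS => x [] /=; rewrite !in_itv/= andbT => x0 x1.
  by move: (lt_le_trans x1 x0); rewrite ltxx.
rewrite integral_itv_obnd_cbnd; last exact: measurable_funS mb.
rewrite integral_bracket_half//.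
have -> : (\int[leb]_(x in `]-oo, 0%R]) (bracket x `^ (- p))%:E = ((p - 1)^-1)%:E)%E.
  rewrite -integral_bracket_half// (ge0_integration_by_substitution0 mb b0).
  by apply: eq_integral => x _; rewrite bracketN.
by rewrite -EFinD lee_fin; lra.
Qed.

(** The left-hand side is a Riemann sum of mesh [lam^-1 <= 1] for the integral of
    a bracket power: on one mesh interval brackets vary by a factor at most two,
    whence the uniformity in the mesh and in the centre [c]. *)
Lemma esum_lattice_bracket_le p : 1 < p -> exists2 C : R, 0 < C &
  forall lam c : R, 1 <= lam ->
  (\esum_(k in [set: int])
     (lam^-1 * bracket ((k%:~R - c) / lam) `^ (- p))%:E <= C%:E)%E.
Proof.
move=> p1; have p0 : 0 < p by lra.
have q0 : 0 < p - 1 by rewrite subr_gt0.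
exists (2 `^ p * (2 * (p - 1)^-1)).
  by rewrite mulr_gt0 ?powR_gt0// mulr_gt0// invr_gt0.
move=> lam c lam1; have lam0 : 0 < lam by lra.
pose f (x : R) : \bar R := (2 `^ p * bracket (x - c / lam) `^ (- p))%:E.
have mf : measurable_fun setT f.
  apply/measurable_EFinP; apply: measurable_funM => //.
  apply: (measurableT_comp (measurable_bracket_powR _)).
  exact: measurable_funB.
have f0 x : (0 <= f x)%E by rewrite lee_fin mulr_ge0 ?powR_ge0.
have i0 : 0 < lam^-1 by rewrite invr_gt0.
apply: (@le_trans _ _ (\int[leb]_x f x)%E); last first.
  rewrite /f; under eq_integral do rewrite EFinM.
  rewrite ge0_integralZl_EFin ?powR_ge0//; last 2 first.
  - by move=> x _; rewrite lee_fin powR_ge0.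
  - apply/measurable_EFinP.
    apply: (measurableT_comp (measurable_bracket_powR _)); exact: measurable_funB.
  rewrite [leRHS]EFinM lee_pmul2l ?lte_fin ?powR_gt0//.
  apply: le_trans (integral_bracket_le p1).
  have mb : measurable_fun setT (fun x : R => (bracket x `^ (- p))%:E).
    by apply/measurable_EFinP; exact: measurable_bracket_powR.
  have := @ge0_integral_addr _ (- (c / lam)) setT _ measurableT mb.
  by rewrite preimage_setT => ->// x _; rewrite lee_fin powR_ge0.
apply: le_trans (esum_tiling_le i0 mf f0).
apply: le_esum => k _.
have kE : ((k + 1)%:~R * lam^-1 = k%:~R * lam^-1 + lam^-1 :> R).
  by rewrite intrD mulrDl mul1r.
have -> : (lam^-1 * bracket ((k%:~R - c) / lam) `^ (- p))%:E =
  (\int[leb]_(x in `[(k%:~R * lam^-1)%R, ((k + 1)%:~R * lam^-1)%R[)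
     (bracket ((k%:~R - c) / lam) `^ (- p))%:E)%E.
  rewrite integral_cst//= lebesgue_measure_itv/= lte_fin kE ltrDl i0.
  by rewrite -EFinD -EFinM mulrC; congr (_ * _)%:E; lra.
apply: ge0_le_integral => //.
- by move=> x _; rewrite lee_fin powR_ge0.
- exact: measurable_funS mf.
move=> x /=; rewrite in_itv/= kE => /andP[x1 x2].
rewrite /f lee_fin.
have h : bracket (x - c / lam) <= 2 * bracket ((k%:~R - c) / lam).
  have l1 : lam^-1 <= 1 by rewrite invf_le1.
  have -> : x - c / lam = (k%:~R - c) / lam + (x - k%:~R / lam) by rewrite mulrBl; lra.
  apply: le_trans (bracketD_mul _ _) _; rewrite mulrC ler_wpM2r ?bracket_ge0//.
  by rewrite /bracket ger0_norm; lra.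
rewrite !powRN ler_pdivlMr ?powR_gt0 ?bracket_gt0//.
rewrite mulrC ler_pdivrMr ?powR_gt0 ?bracket_gt0//.
rewrite -powRM ?bracket_ge0//.
by apply: (ge0_ler_powR (ltW p0)); rewrite ?nnegrE ?mulr_ge0 ?bracket_ge0.
Qed.

End Brackets.

(** * The resonance function and the multiplier bound *)

Section Multiplier.
Context {R : realType}.
Implicit Types (alpha s xi c lam : R).

(** The mismatch between the dispersion relation [tau = xi^3] of the output and
    the relation [tau = alpha xi^3] of the two inputs, of frequencies [xi1] and
    [xi - xi1]. *)
Definition resonance alpha xi xi1 : R :=
  alpha * (xi1 ^+ 3 + (xi - xi1) ^+ 3) - xi ^+ 3.

(** The Sobolev-weighted symbol of the derivative of a product, divided by the
    half power of the resonance that the modulation weights will pay for. *)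
Definition mult alpha s xi xi1 : R :=
  `|xi| * bracket xi `^ s / (bracket xi1 `^ s * bracket (xi - xi1) `^ s) *
  bracket (resonance alpha xi xi1) `^ (- 2^-1).

Lemma mult_ge0 alpha s xi xi1 : 0 <= mult alpha s xi xi1.
Proof. by rewrite /mult !(mulr_ge0, invr_ge0, powR_ge0). Qed.

Lemma resonance_sym alpha xi xi1 :
  resonance alpha xi (xi - xi1) = resonance alpha xi xi1.
Proof. by rewrite /resonance; ring. Qed.

Lemma c1_quadratic alpha : 0 < alpha -> alpha < 1 ->
  3 * alpha * (c1 alpha * (c1 alpha - 1)) = 1 - alpha.
Proof.
move=> a0 a1; rewrite /c1; set r := Num.sqrt _.
have r2 : r ^+ 2 = - 3 + 12 * alpha^-1.
  rewrite sqr_sqrtr//; have : 1 <= alpha^-1 by rewrite invf_ge1// ltW.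
  by lra.
have -> : (2^-1 + r / 6) * (2^-1 + r / 6 - 1) = r ^+ 2 / 36 - 4^-1 by field.
by rewrite r2; field; rewrite gt_eqF.
Qed.

Lemma c1_gt1 alpha : 0 < alpha -> alpha < 1 -> 1 < c1 alpha.
Proof.
move=> a0 a1; rewrite /c1.
suff : 3 < Num.sqrt (- 3 + 12 * alpha^-1) by lra.
have ai : 1 < alpha^-1 by rewrite invf_gt1.
have e3 : 3 = Num.sqrt (3 ^+ 2) :> R by rewrite sqrtr_sqr ger0_norm.
by rewrite [ltLHS]e3 ltr_sqrt; lra.
Qed.

(** Both [c1 alpha] and [1 - c1 alpha] are roots of [3 alpha c (c - 1) = 1 - alpha],
    so the resonance vanishes on two lines through the origin: this is where the
    arithmetic of [c1] enters. *)
Lemma resonance_factor alpha xi xi1 : 0 < alpha -> alpha < 1 ->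
  resonance alpha xi xi1 =
  3 * alpha * xi * (xi1 - c1 alpha * xi) * (xi1 - (1 - c1 alpha) * xi).
Proof.
move=> a0 a1; have := c1_quadratic a0 a1; move: (c1 alpha) => c hc.
have -> : 3 * alpha * xi * (xi1 - c * xi) * (xi1 - (1 - c) * xi) =
  3 * alpha * xi * (xi1 ^+ 2 - xi1 * xi) - xi ^+ 3 * (3 * alpha * (c * (c - 1))).
  by ring.
by rewrite hc /resonance; ring.
Qed.

(** The part of the squared multiplier that is large near the resonant line of
    slope [c]. *)
Definition line_symbol (a s c xi xi1 : R) : R :=
  bracket xi1 `^ (- (2 * s)) * (xi ^+ 2 / (1 + a * xi ^+ 2 * `|xi1 - c * xi|)).

Lemma line_symbol_ge0 a s c xi xi1 : 0 <= a -> 0 <= line_symbol a s c xi xi1.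
Proof.
move=> a0; rewrite mulr_ge0 ?powR_ge0// mulr_ge0 ?sqr_ge0// invr_ge0.
by rewrite addr_ge0// mulr_ge0// mulr_ge0// sqr_ge0.
Qed.

(** The two slopes differ by [2 c1 - 1 > 1], so one of the two distances to the
    lines is at least [|xi| / 2], and the resonance controls [xi^2] times the other. *)
Lemma inv_bracket_resonance alpha xi xi1 (a := 3 * alpha / 2) :
  0 < alpha -> alpha < 1 ->
  (bracket (resonance alpha xi xi1))^-1 <=
  (1 + a * xi ^+ 2 * `|xi1 - c1 alpha * xi|)^-1 +
  (1 + a * xi ^+ 2 * `|xi1 - (1 - c1 alpha) * xi|)^-1.
Proof.
move=> a0 a1; have c0 := c1_gt1 a0 a1.
rewrite /bracket resonance_factor// !normrM ger0_norm// (ger0_norm (ltW a0)).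
set c := c1 alpha in c0 *.
set u := `|xi1 - c * xi|; set v := `|xi1 - (1 - c) * xi|.
have u0 : 0 <= u by exact: normr_ge0.
have v0 : 0 <= v by exact: normr_ge0.
have uv : `|xi| <= u + v.
  have : `|(2 * c - 1) * xi| <= u + v.
    have -> : (2 * c - 1) * xi = (xi1 - (1 - c) * xi) - (xi1 - c * xi) by ring.
    by rewrite [u + v]addrC; exact: ler_normB.
  rewrite normrM; apply: le_trans.
  by rewrite ler_peMl// ger0_norm; lra.
have x2 : xi ^+ 2 = `|xi| * `|xi| by rewrite -expr2 real_normK// num_real.
have aa : 0 < a by rewrite /a; lra.
rewrite x2; move: uv; set x := `|xi|; have x0 : 0 <= x by exact: normr_ge0.
move=> uv.
have pos y : 0 <= y -> 0 < 1 + a * (x * x) * y.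
  by move=> y0; rewrite ltr_pwDl// !mulr_ge0// ltW.
have main y z : 0 <= y -> 0 <= z -> x <= 2 * z ->
    (1 + 3 * alpha * x * (y * z))^-1 <= (1 + a * (x * x) * y)^-1.
  move=> y0 z0 xz; rewrite lef_pV2 ?posrE ?pos//; last first.
    by rewrite ltr_pwDl// !mulr_ge0// ltW.
  rewrite lerD2l.
  have -> : a * (x * x) * y = (a * x * y) * x by ring.
  have -> : 3 * alpha * x * (y * z) = (a * x * y) * (2 * z) by rewrite /a; field.
  by rewrite ler_wpM2l// !mulr_ge0// ltW.
have [xu|xu] := leP x (2 * u).
  apply: (@le_trans _ _ (1 + a * (x * x) * v)^-1).
    by rewrite -[X in 1 + X]mulrA [u * v]mulrC; exact: main.
  by rewrite lerDr invr_ge0 ltW// pos.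
apply: (@le_trans _ _ (1 + a * (x * x) * u)^-1).
  by rewrite -[X in 1 + X]mulrA; apply: main => //; lra.
by rewrite lerDl invr_ge0 ltW// pos.
Qed.

(** The larger input bracket is at least half the output bracket and absorbs its
    weight; the weight of the smaller input remains. Either input may be the
    smaller one, hence the second pair of terms, with [xi1] and [xi - xi1]
    exchanged. *)
Lemma mult_sqr_le alpha s xi xi1 (a := 3 * alpha / 2) (c := c1 alpha) :
  0 < alpha -> alpha < 1 -> 0 < s ->
  mult alpha s xi xi1 ^+ 2 <= 2 `^ (2 * s) *
    ((line_symbol a s c xi xi1 + line_symbol a s (1 - c) xi xi1) +
     (line_symbol a s c xi (xi - xi1) + line_symbol a s (1 - c) xi (xi - xi1))).
Proof.
move=> a0 a1 s0.
have hr := inv_bracket_resonance xi xi1 a0 a1.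
have hr' := inv_bracket_resonance xi (xi - xi1) a0 a1.
rewrite resonance_sym in hr'.
rewrite -/a -/c in hr hr' *.
set h := (bracket (resonance alpha xi xi1))^-1 in hr hr' *.
have sq x : bracket x `^ s ^+ 2 = bracket x `^ (2 * s).
  by rewrite -powR_mulrn ?powR_ge0// -powRrM mulrC.
have -> : mult alpha s xi xi1 ^+ 2 = xi ^+ 2 * h * (bracket xi `^ (2 * s) *
    (bracket xi1 `^ (- (2 * s)) * bracket (xi - xi1) `^ (- (2 * s)))).
  rewrite /mult !exprMn exprVn exprMn !sq -normrX ger0_norm ?sqr_ge0//.
  rewrite -(powR_mulrn 2 (powR_ge0 _ _)) -powRrM mulNr mulVf// powR_inv1 ?bracket_ge0//.
  by rewrite !powRN invfM -/h; ring.
set b1 := bracket xi1 `^ (- (2 * s)); set b2 := bracket (xi - xi1) `^ (- (2 * s)).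
have b10 : 0 <= b1 by exact: powR_ge0.
have b20 : 0 <= b2 by exact: powR_ge0.
have xh0 : 0 <= xi ^+ 2 * h by rewrite mulr_ge0 ?sqr_ge0// invr_ge0 bracket_ge0.
have key : bracket xi `^ (2 * s) * (b1 * b2) <= 2 `^ (2 * s) * (b1 + b2).
  have s20 : 0 <= 2 * s by lra.
  have gen y z : bracket z <= bracket y -> bracket xi <= bracket y + bracket z ->
      bracket xi `^ (2 * s) * bracket y `^ (- (2 * s)) <= 2 `^ (2 * s).
    move=> yz xyz; rewrite powRN ler_pdivrMr ?powR_gt0 ?bracket_gt0//.
    rewrite -powRM ?bracket_ge0//.
    by apply: ge0_ler_powR; rewrite ?nnegrE ?mulr_ge0 ?bracket_ge0//; lra.
  have xD : bracket xi <= bracket xi1 + bracket (xi - xi1).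
    by rewrite -[X in bracket X <= _](subrKC xi1); exact: bracketD.
  have [le12|/ltW le21] := leP (bracket (xi - xi1)) (bracket xi1).
    rewrite mulrA; apply: (@le_trans _ _ (2 `^ (2 * s) * b2)).
      by rewrite ler_wpM2r// (gen _ _ le12).
    by rewrite ler_wpM2l ?powR_ge0// lerDr.
  rewrite mulrCA mulrC; apply: (@le_trans _ _ (2 `^ (2 * s) * b1)).
    by rewrite ler_wpM2r// (gen _ _ le21)// addrC.
  by rewrite ler_wpM2l ?powR_ge0// lerDl.
apply: le_trans (ler_wpM2l xh0 key) _.
rewrite mulrCA ler_wpM2l ?powR_ge0// /line_symbol -/b1 -/b2.
have k1 := ler_wpM2l (mulr_ge0 b10 (sqr_ge0 xi)) hr.
have k2 := ler_wpM2l (mulr_ge0 b20 (sqr_ge0 xi)) hr'.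
by lra.
Qed.

(** A bound at single points is enough near a resonant line, because at most two
    lattice points [k1] lie at distance less than one mesh from it. *)
Definition near_bound (a s c E : R) := exists2 C0 : R, 0 < C0 &
  forall lam (k k1 : int), 1 <= lam -> `|k1%:~R - c * k%:~R| < 1 ->
  lam^-1 * line_symbol a s c (freq lam k) (freq lam k1) <= C0 * lam `^ E.

Lemma freqB lam (k j : int) : freq lam k - freq lam j = freq lam (k - j) :> R.
Proof. by rewrite /freq intrB mulrBl. Qed.

Lemma freq_dist c lam (k k1 : int) : 0 < lam ->
  `|freq lam k1 - c * freq lam k| = `|k1%:~R - c * k%:~R| / lam.
Proof.
move=> l0; rewrite /freq -[in RHS](ger0_norm (ltW l0)) -normfV -normrM.
by congr (`| _ |); rewrite mulrBl mulrA.
Qed.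

Lemma le1_powR_exp lam E : 1 <= lam -> 0 <= E -> 1 <= lam `^ E.
Proof. by move=> l1 E0; rewrite -[leLHS](powRr0 lam); exact: ler_powR. Qed.

(** Away from the line the decay in the distance [N] is of order [N^-1], which
    just fails to be summable; a power of [lam] is traded for summability:
    [N^-1 <= lam^-1 + lam^E N^(-1-E)], separating [N >= lam] from [N <= lam]. *)
Lemma line_sum_le a s c E : 0 < a -> 2^-1 < s -> 0 < E -> near_bound a s c E ->
  exists2 C : R, 0 < C & forall lam (k : int), 1 <= lam ->
  (\esum_(k1 in [set: int])
    (lam^-1 * line_symbol a s c (freq lam k) (freq lam k1))%:E
    <= (C * lam `^ E)%:E)%E.
Proof.
move=> a0 s12 E0 [C0 C00 hC0].
have [A A0 hA] : exists2 C : R, 0 < C & forall lam c : R, 1 <= lam ->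
    (\esum_(k in [set: int])
     (lam^-1 * bracket ((k%:~R - c) / lam) `^ (- (2 * s)))%:E <= C%:E)%E.
  by apply: esum_lattice_bracket_le; lra.
have [B B0 hB] : exists2 C : R, 0 < C & forall lam c : R, 1 <= lam ->
    (\esum_(k in [set: int])
     (lam^-1 * bracket ((k%:~R - c) / lam) `^ (- (1 + E)))%:E <= C%:E)%E.
  by apply: esum_lattice_bracket_le; lra.
pose D := (a^-1 + C0) * 2 `^ (1 + E).
have D0 : 0 < D by rewrite mulr_gt0 ?powR_gt0// addr_gt0// invr_gt0.
have D00 : 0 <= D by exact: ltW.
exists (a^-1 * A + D * B) => [|lam k l1].
  by rewrite addr_gt0// mulr_gt0// invr_gt0.
have l0 : 0 < lam by lra.
have lE := le1_powR_exp l1 (ltW E0).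
have lE0 : 0 <= lam `^ E by lra.
have ai0 : 0 <= a^-1 by rewrite invr_ge0 ltW.
pose t1 k1 := lam^-1 * bracket ((k1%:~R - 0) / lam) `^ (- (2 * s)).
pose t2 (k1 : int) := 1^-1 * bracket ((k1%:~R - c * k%:~R) / 1) `^ (- (1 + E)).
have t10 k1 : 0 <= t1 k1 by rewrite mulr_ge0 ?powR_ge0 ?invr_ge0 ?ltW.
have t20 k1 : 0 <= t2 k1 by rewrite mulr_ge0 ?powR_ge0 ?invr_ge0.
apply: (@le_trans _ _ (\esum_(k1 in [set: int])
    ((a^-1)%:E * (t1 k1)%:E + (D * lam `^ E)%:E * (t2 k1)%:E))%E); last first.
  rewrite esumD; last 2 first.
  - by move=> i _; rewrite mule_ge0// lee_fin.
  - by move=> i _; rewrite mule_ge0// lee_fin// mulr_ge0// ltW.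
  rewrite !ge0_esumZl ?lee_fin//; last by rewrite mulr_ge0.
  apply: (@le_trans _ _ ((a^-1)%:E * A%:E + (D * lam `^ E)%:E * B%:E)%E).
    apply: leeD.
      by apply: lee_wpmul2l; rewrite ?lee_fin//; exact: hA.
    apply: lee_wpmul2l; first by rewrite lee_fin mulr_ge0.
    exact: hB.
  rewrite -!EFinM -EFinD lee_fin mulrDl lerD//.
    by rewrite ler_peMr// mulr_ge0// ltW.
  by rewrite -!mulrA [lam `^ E * B]mulrC.
apply: le_esum => k1 _; rewrite -!EFinM -EFinD lee_fin.
set N := `|k1%:~R - c * k%:~R| : R.
have Nge0 : 0 <= N by rewrite /N normr_ge0.
have t2E : 2 `^ (1 + E) * t2 k1 = (2 / (1 + N)) `^ (1 + E).
  have N0 : 0 <= 1 + N by rewrite addr_ge0// /N normr_ge0.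
  rewrite /t2 !invr1 mul1r mulr1 /bracket -/N powRM ?invr_ge0//; congr (_ * _).
  by rewrite -[X in _ = X `^ _]powR_inv1// -powRrM mulN1r.
have De : D * lam `^ E * t2 k1 =
    (a^-1 + C0) * (2 / (1 + N)) `^ (1 + E) * lam `^ E.
  by rewrite -t2E /D; ring.
have [N1|N1] := ltP N 1.
  apply: le_trans (hC0 _ _ _ l1 N1) _.
  apply: (@le_trans _ _ (D * lam `^ E * t2 k1)); last first.
    by rewrite lerDr mulr_ge0.
  rewrite De ler_wpM2r//.
  rewrite -[leLHS]mulr1; apply: ler_pM => //; [exact: ltW|by rewrite lerDr|].
  apply: le1_powR_exp; last by lra.
  by rewrite ler_pdivlMr; lra.
have N0 : 0 < N by lra.
apply: (@le_trans _ _ (a^-1 * (bracket (freq lam k1) `^ (- (2 * s)) * N^-1))).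
  rewrite /line_symbol freq_dist// -/N mulrCA [leRHS]mulrCA ler_wpM2l ?powR_ge0//.
  set x := freq lam k ^+ 2; have x0 : 0 <= x by exact: sqr_ge0.
  have axN : 0 <= a * x * (N / lam).
    by rewrite mulr_ge0 ?divr_ge0 ?(mulr_ge0 (ltW a0))// ltW.
  rewrite -invfM mulrA ler_pdivrMr; last by rewrite ltr_pwDl.
  rewrite [leRHS]mulrC ler_pdivlMr ?mulr_gt0//.
  have -> : lam^-1 * x * (a * N) = a * x * (N / lam) by ring.
  by rewrite lerDr.
have b1 : bracket (freq lam k1) `^ (- (2 * s)) <= 1.
  by rewrite powRN invf_le1 ?powR_gt0 ?bracket_gt0// le1_powR_exp ?bracket_ge1//; lra.
have b0 : 0 <= bracket (freq lam k1) `^ (- (2 * s)) by exact: powR_ge0.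
have D2 : 0 <= D * lam `^ E * t2 k1 by rewrite mulr_ge0// mulr_ge0.
have Ni0 : 0 <= N^-1 by rewrite invr_ge0.
(* for [N >= lam], [N^-1 <= lam^-1] and the weight is summable with mesh
   [lam^-1]; for [N <= lam], the summable power of [N] costs [lam^E] *)
have [Nl|Nl] := leP lam N.
  apply: ler_wpDr => //.
  rewrite ler_wpM2l// /t1 subr0 -/(freq lam k1) [leRHS]mulrC ler_wpM2l//.
  by rewrite lef_pV2.
apply: ler_wpDl; first by rewrite mulr_ge0.
rewrite De; apply: (@le_trans _ _ (a^-1 * (N^-1 `^ (1 + E) * lam `^ E))).
  rewrite ler_wpM2l//; apply: le_trans (ler_wpM2r Ni0 b1) _.
  rewrite mul1r powRD; last by apply/implyP => _; rewrite invr_eq0 gt_eqF.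
  rewrite powRr1// -mulrA ler_peMr// -powRM ?(ltW l0)//.
  apply: le1_powR_exp; last exact: ltW.
  by rewrite mulrC ler_pdivlMr// mul1r ltW.
rewrite mulrA ler_wpM2r//; apply: ler_pM; rewrite ?powR_ge0 ?lerDl ?(ltW C00)//.
have N1p : 0 <= 1 + N by lra.
have E1p : 0 <= 1 + E by lra.
apply: ge0_ler_powR; rewrite ?nnegrE ?divr_ge0//.
rewrite ler_pdivlMr; last by lra.
by rewrite mulrC ler_pdivrMr//; lra.
Qed.

Lemma near_line_bracket c lam (k k1 : int) : 1 <= lam ->
  `|k1%:~R - c * k%:~R| < 1 -> `|c| * `|freq lam k| <= bracket (freq lam k1).
Proof.
move=> l1 N1; have l0 : 0 < lam by lra.
rewrite -normrM; set x := freq lam k; set y := freq lam k1.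
have -> : c * x = y - (y - c * x) by ring.
apply: le_trans (ler_normB _ _) _; rewrite /bracket addrC lerD2r.
by rewrite freq_dist// ler_pdivrMr// mul1r (le_trans (ltW N1)).
Qed.

(** Next to the line both frequencies have comparable size, so that for [s >= 1]
    the weight of the input absorbs [xi^2]. *)
Lemma near_bound_ge1 a s c E : 0 < a -> 1 <= s -> c != 0 -> 0 <= E ->
  near_bound a s c E.
Proof.
move=> a0 s1 cN0 E0; exists ((c ^+ 2)^-1) => [|lam k k1 l1 N1].
  by rewrite invr_gt0 exprn_even_gt0.
have l0 : 0 < lam by lra.
have c2 : 0 < c ^+ 2 by rewrite exprn_even_gt0.
apply: (@le_trans _ _ (c ^+ 2)^-1); last first.
  by rewrite ler_peMr ?le1_powR_exp// invr_ge0 ltW.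
apply: (@le_trans _ _ (line_symbol a s c (freq lam k) (freq lam k1))).
  rewrite ler_piMl ?invf_le1//; exact/line_symbol_ge0/ltW.
rewrite /line_symbol; set x := freq lam k; set y := freq lam k1.
have cx : `|c| * `|x| <= bracket y := near_line_bracket l1 N1.
have x2 : x ^+ 2 <= (c ^+ 2)^-1 * bracket y ^+ 2.
  rewrite ler_pdivlMl//.
  have -> : c ^+ 2 * x ^+ 2 = (`|c| * `|x|) ^+ 2.
    have -> : (`|c| * `|x|) ^+ 2 = (c * x) ^+ 2.
      by rewrite -normrM real_normK// num_real.
    by ring.
  by rewrite ler_sqr ?nnegrE ?bracket_ge0// mulr_ge0.
have x2' : x ^+ 2 / (1 + a * x ^+ 2 * `|y - c * x|) <= x ^+ 2.
  have h : 0 <= a * x ^+ 2 * `|y - c * x| by rewrite mulr_ge0// mulr_ge0 ?sqr_ge0// ltW.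
  rewrite ler_pdivrMr; last by lra.
  by rewrite ler_peMr ?sqr_ge0//; lra.
apply: (@le_trans _ _ (bracket y `^ (- (2 * s)) * ((c ^+ 2)^-1 * bracket y ^+ 2))).
  by rewrite ler_wpM2l ?powR_ge0// (le_trans x2').
rewrite mulrCA ler_piMr ?invr_ge0 ?(ltW c2)// -(powR_mulrn 2 (bracket_ge0 y)).
rewrite -powRD; last by apply/implyP => _; rewrite gt_eqF ?bracket_gt0.
rewrite -[leRHS](powRr0 (bracket y)); apply: ler_powR; first exact: bracket_ge1.
by lra.
Qed.

(** A Diophantine slope keeps lattice points away from the line: with [N] the
    distance in units of the mesh, the normalised symbol without its weight is at
    most [(a N)^-1], hence at most a multiple of [|k|^(1 + nu) = lam^(1 + nu) |xi|^(1 + nu)]; the first factor is the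
    admissible loss, the second one is absorbed by the weight. *)
Lemma near_bound_diophantine a s c E K nu : 0 < a -> c != 0 -> 0 < K -> 0 < nu ->
  1 + nu <= 2 * s -> 1 + nu <= E ->
  (forall k k1 : int, k != 0 ->
     K * `|k%:~R| `^ (- 1 - nu) <= `|k1%:~R - c * k%:~R|) ->
  near_bound a s c E.
Proof.
move=> a0 cN0 K0 nu0 sN EN hK.
have c0 : 0 < `|c| by rewrite normr_gt0.
exists ((a * K * `|c| `^ (1 + nu))^-1) => [|lam k k1 l1 N1].
  by rewrite invr_gt0 !mulr_gt0// powR_gt0.
have l0 : 0 < lam by lra.
have D0 : 0 < a * K * `|c| `^ (1 + nu) by rewrite !mulr_gt0// powR_gt0.
have [->|kN0] := eqVneq k 0.
  rewrite /line_symbol /freq mul0r expr0n/= mul0r !mulr0 mulr_ge0 ?powR_ge0//.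
  by rewrite invr_ge0 ltW.
have := hK k k1 kN0; set N := `|k1%:~R - _ * _| => hN.
have k0 : 0 < `|k%:~R : R| by rewrite normr_gt0 intr_eq0.
have N0 : 0 < N by apply: lt_le_trans hN; rewrite mulr_gt0// powR_gt0.
rewrite /line_symbol freq_dist// -/N.
set x := freq lam k; set y := freq lam k1.
have cx : `|c| * `|x| <= bracket y := near_line_bracket l1 N1.
have kx : `|k%:~R| = lam * `|x|.
  by rewrite /x /freq normrM normfV (ger0_norm (ltW l0)) mulrC divfK// gt_eqF.
have x0 : 0 < `|x| by move: k0; rewrite kx pmulr_rgt0.
have xx : 0 < x ^+ 2 by rewrite exprn_even_gt0//= -normr_gt0.
have Nl : 0 < N / lam by rewrite divr_gt0.
have frac : lam^-1 * (x ^+ 2 / (1 + a * x ^+ 2 * (N / lam))) <= (a * N)^-1.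
  have axN : 0 < a * x ^+ 2 * (N / lam) by rewrite mulr_gt0// mulr_gt0.
  rewrite mulrA ler_pdivrMr; last by lra.
  rewrite [leRHS]mulrC ler_pdivlMr ?mulr_gt0//.
  have -> : lam^-1 * x ^+ 2 * (a * N) = a * x ^+ 2 * (N / lam) by ring.
  by rewrite lerDr.
have Ni : (a * N)^-1 <= (a * K)^-1 * `|k%:~R| `^ (1 + nu).
  rewrite -[_ `^ (1 + nu)]invrK -invfM lef_pV2 ?posrE ?mulr_gt0 ?invr_gt0 ?powR_gt0//.
  rewrite -mulrA ler_pM2l// (le_trans _ hN)// ler_pM2l// -powRN.
  by rewrite (_ : - (1 + nu) = - 1 - nu)//; lra.
have kb : `|k%:~R| `^ (1 + nu) <= lam `^ (1 + nu) *
    (bracket y `^ (1 + nu) / `|c| `^ (1 + nu)).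
  rewrite kx powRM ?normr_ge0 ?(ltW l0)// ler_wpM2l ?powR_ge0// ler_pdivlMr ?powR_gt0//.
  rewrite mulrC -powRM ?normr_ge0//.
  by apply: ge0_ler_powR; rewrite ?nnegrE ?bracket_ge0 ?mulr_ge0//; lra.
have by1 : bracket y `^ (- (2 * s)) * bracket y `^ (1 + nu) <= 1.
  rewrite -powRD; last by apply/implyP => _; rewrite gt_eqF ?bracket_gt0.
  rewrite -[leRHS](powRr0 (bracket y)); apply: ler_powR; first exact: bracket_ge1.
  by lra.
have lE : lam `^ (1 + nu) <= lam `^ E by exact: ler_powR.
set b := bracket y `^ (- (2 * s)) in by1 *.
have b0 : 0 <= b by exact: powR_ge0.
rewrite mulrCA; apply: (@le_trans _ _ (b * ((a * K)^-1 * (lam `^ (1 + nu) *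
    (bracket y `^ (1 + nu) / `|c| `^ (1 + nu)))))).
  rewrite ler_wpM2l// (le_trans frac)// (le_trans Ni)// ler_wpM2l//.
  by rewrite invr_ge0 mulr_ge0// ltW.
have -> : b * ((a * K)^-1 * (lam `^ (1 + nu) *
    (bracket y `^ (1 + nu) / `|c| `^ (1 + nu)))) =
  (a * K * `|c| `^ (1 + nu))^-1 * (lam `^ (1 + nu) * (b * bracket y `^ (1 + nu))).
  by rewrite [in RHS]invfM; ring.
rewrite ler_wpM2l ?invr_ge0 ?(ltW D0)//.
by apply: le_trans lE; rewrite ler_piMr// powR_ge0.
Qed.

(** Twice the exponent of [lam] in [C1]. *)
Definition C1_exponent alpha eps : R :=
  let nu := nu_index (c1 alpha) in
  if (nu < 1)%E then 1 + fine nu + 2 * eps else 2 * eps.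

Lemma C1_sqr alpha eps lam : C1 alpha eps lam ^+ 2 = lam `^ C1_exponent alpha eps.
Proof.
rewrite /C1 /C1_exponent; case: ifPn => _;
  rewrite -(powR_mulrn 2 (powR_ge0 _ _)) -powRrM; congr powR; lra.
Qed.

Lemma nu_index_ge0 (rho : R) : (0 <= nu_index rho)%E.
Proof.
rewrite /nu_index; case: ifPn => // _.
by apply: le_ereal_inf_tmp => _ [nu [nu0 _]] <-; rewrite lee_fin ltW.
Qed.

(** When [nu_index (c1 alpha) < 1] there is a type [nu] of [c1 alpha] so close to the
    index that [1 + nu] exceeds neither [2 s] nor the exponent of the loss. *)
Lemma near_bounds alpha s eps (a := 3 * alpha / 2) : 0 < alpha -> alpha < 1 ->
  0 < eps ->
  ge_min1_plus s ((2^-1)%:E + (2^-1)%:E * nu_index (c1 alpha))%E ->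
  let E := C1_exponent alpha eps in
  [/\ 2^-1 < s, 0 < E, near_bound a s (c1 alpha) E &
      near_bound a s (1 - c1 alpha) E].
Proof.
move=> a0 a1 e0 [hs1 hs2] E.
have c0 := c1_gt1 a0 a1.
have aa : 0 < a by rewrite /a; lra.
have nu0 := nu_index_ge0 (c1 alpha).
have cN0 : c1 alpha != 0 by rewrite gt_eqF//; lra.
have cN1 : 1 - c1 alpha != 0 by rewrite lt_eqF//; lra.
rewrite /E /C1_exponent; case: ifPn => [nu1|]; last first.
  rewrite -leNgt => nu1.
  have s1 : 1 <= s.
    apply: hs2; apply: (@le_trans _ _ ((2^-1)%:E + (2^-1)%:E * 1%:E)%E).
      by rewrite -EFinM -EFinD lee_fin; lra.
    by rewrite leeD2l// lee_wpmul2l// lee_fin.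
  have E0 : 0 <= 2 * eps by lra.
  by split; [lra|lra|exact: near_bound_ge1|exact: near_bound_ge1].
have nufin : nu_index (c1 alpha) \is a fin_num.
  by rewrite ge0_fin_numE// (lt_trans nu1)// ltry.
move: hs1; rewrite -(fineK nufin) -EFinM -EFinD !lte_fin => hs1.
move: (nu1) (nu0); rewrite -(fineK nufin) lte_fin lee_fin => nu1' nu0'.
have sN : 1 + fine (nu_index (c1 alpha)) < 2 * s.
  by have := hs1 _; set n := fine _ in nu1' *; lra.
have [nu [nup nus nuE] [K K0 hK]] : exists2 nu, [/\ 0 < nu, 1 + nu <= 2 * s &
    1 + nu <= 1 + fine (nu_index (c1 alpha)) + 2 * eps] & of_type (c1 alpha) nu.
  set d := Num.min (2 * s - (1 + fine (nu_index (c1 alpha)))) (2 * eps).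
  have d0 : 0 < d by rewrite lt_min; apply/andP; split; lra.
  have : (nu_index (c1 alpha) < (fine (nu_index (c1 alpha)) + d)%:E)%E.
    by rewrite -[ltLHS](fineK nufin) lte_fin ltrDl.
  rewrite {1}/nu_index; case: ifPn => [_|_ /ereal_inf_lt [_ [nu [nup hnu] <-]]].
    by rewrite ltNge leey.
  rewrite lte_fin => nud; exists nu => //.
  have [d1 d2] : d <= 2 * s - (1 + fine (nu_index (c1 alpha))) /\ d <= 2 * eps.
    by split; rewrite ge_min lexx ?orbT.
  by split; [|lra|lra].
have dist (k k1 : int) : k != 0 ->
    K * `|k%:~R| `^ (- 1 - nu) <= `|k1%:~R - c1 alpha * k%:~R|.
  move=> kN0; have kR : (k%:~R : R) != 0 by rewrite intr_eq0.
  have k0 : 0 < `|k%:~R : R| by rewrite normr_gt0.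
  have := hK k1 k kN0; rewrite -(ler_pM2r k0) -normrM mulrBl divfK//.
  rewrite distrC; apply: le_trans.
  have -> : `|k%:~R| `^ (- 1 - nu) = `|k%:~R| `^ (- 2 - nu) * `|k%:~R| :> R.
    rewrite -{3}(powRr1 (normr_ge0 (k%:~R : R))) -powRD; last first.
      by apply/implyP => _; rewrite gt_eqF.
    by congr powR; lra.
  by rewrite mulrA.
split; [lra|lra|exact: near_bound_diophantine dist|].
(* exchanging [k1] and [k - k1] exchanges the two lines *)
apply: (near_bound_diophantine (K := K) (nu := nu)) => // k k1 kN0.
have := dist k (k - k1) kN0; rewrite intrB.
have -> : k%:~R - k1%:~R - c1 alpha * k%:~R =
  - (k1%:~R - (1 - c1 alpha) * k%:~R) :> R by ring.
by rewrite normrN.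
Qed.

(** The arithmetic content of the bilinear estimate, which depends on the
    Diophantine type of [c1 alpha] only through this bound. *)
Lemma multiplier_bound alpha s eps : 0 < alpha -> alpha < 1 -> 0 < eps ->
  ge_min1_plus s ((2^-1)%:E + (2^-1)%:E * nu_index (c1 alpha))%E ->
  exists2 C : R, 0 < C & forall lam (k : int), 1 <= lam ->
  (\esum_(k1 in [set: int])
    (lam^-1 * mult alpha s (freq lam k) (freq lam k1) ^+ 2)%:E
    <= (C * C1 alpha eps lam ^+ 2)%:E)%E.
Proof.
move=> a0 a1 e0 hs; have [s12 E0 near1 near2] := near_bounds a0 a1 e0 hs.
set E := C1_exponent alpha eps in E0 near1 near2.
set a := 3 * alpha / 2 in near1 near2.
have aa : 0 < a by rewrite /a; lra.
have [A A0 hA] := line_sum_le aa s12 E0 near1.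
have [B B0 hB] := line_sum_le aa s12 E0 near2.
exists (2 `^ (2 * s) * ((A + B) + (A + B))) => [|lam k l1].
  by rewrite mulr_gt0 ?powR_gt0// !addr_gt0.
have l0 : 0 < lam by lra.
have li : 0 <= lam^-1 by rewrite invr_ge0 ltW.
pose f c k1 : \bar R :=
  (lam^-1 * line_symbol a s c (freq lam k) (freq lam k1))%:E.
have f0 c k1 : (0%R <= f c k1)%E by rewrite lee_fin mulr_ge0// line_symbol_ge0// ltW.
apply: (@le_trans _ _ (\esum_(k1 in [set: int]) ((2 `^ (2 * s))%R%:E *
    ((f (c1 alpha) k1 + f (1 - c1 alpha)%R k1) +
     (f (c1 alpha) (k - k1)%R + f (1 - c1 alpha)%R (k - k1)%R))))%E).
  apply: le_esum => k1 _; rewrite /f -!EFinD -EFinM lee_fin -freqB.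
  have s0 : 0 < s by lra.
  apply: le_trans (ler_wpM2l li (mult_sqr_le _ _ a0 a1 s0)) _.
  by rewrite le_eqVlt; apply/orP; left; apply/eqP; rewrite -/a; ring.
have fs c := esum_reflect (f c) k.
rewrite ge0_esumZl ?lee_fin ?powR_ge0//; last by move=> k1; rewrite !adde_ge0.
rewrite C1_sqr -/E -mulrA EFinM lee_wpmul2l ?lee_fin ?powR_ge0//.
rewrite !esumD ?fs; try by move=> *; rewrite ?adde_ge0.
rewrite !mulrDl !EFinD.
by apply: leeD; apply: leeD; [exact: hA|exact: hB|exact: hA|exact: hB].
Qed.

End Multiplier.

(** * Integrals of complex-valued functions *)

Section NormC.
Context {R : realType}.
Implicit Types z w : R[i].

Lemma ReImE z w : [/\ complex.Re (z + w) = complex.Re z + complex.Re w,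
  complex.Im (z + w) = complex.Im z + complex.Im w,
  complex.Re (z * w) = complex.Re z * complex.Re w - complex.Im z * complex.Im w &
  complex.Im (z * w) = complex.Re z * complex.Im w + complex.Im z * complex.Re w].
Proof. by case: z => a b; case: w => c d. Qed.

Lemma normc_sqrE z : Normc.normc z ^+ 2 = complex.Re z ^+ 2 + complex.Im z ^+ 2.
Proof. by case: z => a b /=; rewrite sqr_sqrtr// addr_ge0 ?sqr_ge0. Qed.

Lemma normc_ge0 z : 0 <= Normc.normc z.
Proof. by case: z => a b; exact: sqrtr_ge0. Qed.

Lemma normr_Re_le z : `|complex.Re z| <= Normc.normc z.
Proof.
rewrite -ler_sqr ?nnegrE ?normc_ge0// normc_sqrE real_normK ?num_real//.
by rewrite lerDl sqr_ge0.
Qed.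

Lemma normr_Im_le z : `|complex.Im z| <= Normc.normc z.
Proof.
rewrite -ler_sqr ?nnegrE ?normc_ge0// normc_sqrE real_normK ?num_real//.
by rewrite lerDr sqr_ge0.
Qed.

Lemma normc_conj z : Normc.normc z^*%C = Normc.normc z.
Proof. by case: z => a b /=; rewrite sqrrN. Qed.

Lemma normcR (r : R) : Normc.normc r%:C = `|r|.
Proof. by rewrite /= expr0n/= addr0 sqrtr_sqr. Qed.

Lemma normc_le_ReIm z : Normc.normc z <= `|complex.Re z| + `|complex.Im z|.
Proof.
rewrite -ler_sqr ?nnegrE ?normc_ge0 ?addr_ge0// normc_sqrE sqrrD.
rewrite !real_normK ?num_real// lerD2r lerDl.
by rewrite mulrn_wge0// mulr_ge0.
Qed.

End NormC.

Section ComplexIntegral.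
Context d (X : measurableType d) (R : realType).
Variables (mu : {measure set X -> \bar R}) (D : set X).
Hypothesis mD : measurable D.
Implicit Types (f g : X -> R[i]) (z : R[i]).

Definition cint f : R[i] :=
  (\int[mu]_(x in D) complex.Re (f x)) +i* (\int[mu]_(x in D) complex.Im (f x)).

Definition cmeas f := measurable_fun D (fun x => complex.Re (f x)) /\
  measurable_fun D (fun x => complex.Im (f x)).

Definition cintegrable f :=
  mu.-integrable D (fun x => (complex.Re (f x))%:E) /\
  mu.-integrable D (fun x => (complex.Im (f x))%:E).

Lemma cmeasD f g : cmeas f -> cmeas g -> cmeas (fun x => f x + g x).
Proof.
move=> [f1 f2] [g1 g2]; split.
- rewrite (_ : (fun x => _) = (fun x => complex.Re (f x) + complex.Re (g x))).
    exact: measurable_funD.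
  by apply/funext => x; have [-> _ _ _] := ReImE (f x) (g x).
- rewrite (_ : (fun x => _) = (fun x => complex.Im (f x) + complex.Im (g x))).
    exact: measurable_funD.
  by apply/funext => x; have [_ -> _ _] := ReImE (f x) (g x).
Qed.

Lemma cmeasM f g : cmeas f -> cmeas g -> cmeas (fun x => f x * g x).
Proof.
move=> [f1 f2] [g1 g2]; split.
- rewrite (_ : (fun x => _) = (fun x => complex.Re (f x) * complex.Re (g x) -
      complex.Im (f x) * complex.Im (g x))).
    by apply: measurable_funB; exact: measurable_funM.
  by apply/funext => x; have [_ _ -> _] := ReImE (f x) (g x).
- rewrite (_ : (fun x => _) = (fun x => complex.Re (f x) * complex.Im (g x) +
      complex.Im (f x) * complex.Re (g x))).
    by apply: measurable_funD; exact: measurable_funM.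
  by apply/funext => x; have [_ _ _ ->] := ReImE (f x) (g x).
Qed.

Lemma cmeas_cst z : cmeas (fun=> z).
Proof. by split; exact: measurable_cst. Qed.

Lemma cmeas_conj f : cmeas f -> cmeas (fun x => (f x)^*%C).
Proof.
move=> [f1 f2]; split.
  by rewrite (_ : (fun x => _) = (fun x => complex.Re (f x)))//; apply/funext => x; case: (f x).
rewrite (_ : (fun x => _) = (fun x => - complex.Im (f x))).
  exact: measurable_funN.
by apply/funext => x; case: (f x).
Qed.

Lemma cmeas_normc f : cmeas f -> measurable_fun D (fun x => Normc.normc (f x)).
Proof.
move=> [f1 f2].
rewrite (_ : (fun x => _) =
  (fun x => Num.sqrt (complex.Re (f x) ^+ 2 + complex.Im (f x) ^+ 2))).
  apply: (measurableT_comp (f := @Num.sqrt R)).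
    by apply: continuous_measurable_fun; exact: sqrt_continuous.
  by apply: measurable_funD; exact: measurable_funX.
by apply/funext => x; case: (f x).
Qed.

Lemma cmeas_sum I (s : seq I) (F : I -> X -> R[i]) :
  (forall i, cmeas (F i)) -> cmeas (fun x => \sum_(i <- s) F i x).
Proof.
move=> mF; elim: s => [|i s ih].
  by rewrite (_ : (fun x => _) = (fun=> 0)); [exact: cmeas_cst|
    apply/funext => x; rewrite big_nil].
rewrite (_ : (fun x => _) = (fun x => F i x + \sum_(j <- s) F j x)).
  exact: cmeasD.
by apply/funext => x; rewrite big_cons.
Qed.

Lemma cintegrableP f : cmeas f ->
  (\int[mu]_(x in D) (Normc.normc (f x))%:E < +oo)%E -> cintegrable f.
Proof.
move=> mf fi; have mn := cmeas_normc mf.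
have fin : mu.-integrable D (fun x => (Normc.normc (f x))%:E).
  apply/integrableP; split; first exact/measurable_EFinP.
  by under eq_integral do rewrite gee0_abs ?lee_fin ?normc_ge0//.
case: mf => f1 f2; split.
- apply: (le_integrable mD) fin; first exact/measurable_EFinP.
  by move=> x _; rewrite !abse_EFin lee_fin (ger0_norm (normc_ge0 _)); exact: normr_Re_le.
- apply: (le_integrable mD) fin; first exact/measurable_EFinP.
  by move=> x _; rewrite !abse_EFin lee_fin (ger0_norm (normc_ge0 _)); exact: normr_Im_le.
Qed.

Lemma cintegrable_normc f : cintegrable f ->
  mu.-integrable D (fun x => (Normc.normc (f x))%:E).
Proof.
move=> [f1 f2].
have mf : cmeas f.
  by split; apply/measurable_EFinP; [exact: measurable_int f1|exact: measurable_int f2].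
apply: (le_integrable mD) (integrableD mD (integrable_abse f1) (integrable_abse f2)).
  by apply/measurable_EFinP; exact: cmeas_normc.
move=> x _; change ((`|Normc.normc (f x)|)%:E <=
  (`| `|complex.Re (f x)| + `|complex.Im (f x)| |)%:E)%E.
rewrite lee_fin (ger0_norm (normc_ge0 _)) ger0_norm ?addr_ge0//.
exact: normc_le_ReIm.
Qed.

Lemma cintD f g : cintegrable f -> cintegrable g ->
  cint (fun x => f x + g x) = cint f + cint g.
Proof.
move=> [f1 f2] [g1 g2]; rewrite /cint.
rewrite -[RHS]/((_ + _) +i* (_ + _)) -!RintegralD//.
by congr (_ +i* _); apply: eq_Rintegral => x _; have [] := ReImE (f x) (g x).
Qed.

Lemma cintZ z f : cintegrable f -> cint (fun x => z * f x) = z * cint f.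
Proof.
move=> [f1 f2]; case: z => a b; rewrite /cint.
rewrite -[RHS]/((_ - _) +i* (_ + _)) -!RintegralZl//.
have i1 c : mu.-integrable D (fun x => (c * complex.Re (f x))%:E).
  by under eq_fun do rewrite EFinM; exact: integrableZl.
have i2 c : mu.-integrable D (fun x => (c * complex.Im (f x))%:E).
  by under eq_fun do rewrite EFinM; exact: integrableZl.
rewrite -(RintegralB mD (i1 a) (i2 b)) -(RintegralD mD (i2 a) (i1 b)).
by congr (_ +i* _); apply: eq_Rintegral => x _; case: (f x).
Qed.

Lemma cintegrableD f g : cintegrable f -> cintegrable g ->
  cintegrable (fun x => f x + g x).
Proof.
move=> [f1 f2] [g1 g2]; split.
- apply: eq_integrable (integrableD mD f1 g1) => // x _ /=.
  by rewrite -EFinD; have [-> _ _ _] := ReImE (f x) (g x).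
- apply: eq_integrable (integrableD mD f2 g2) => // x _ /=.
  by rewrite -EFinD; have [_ -> _ _] := ReImE (f x) (g x).
Qed.

Lemma cintegrableZ z f : cintegrable f -> cintegrable (fun x => z * f x).
Proof.
move=> [f1 f2]; case: z => a b; split.
- apply: eq_integrable (integrableB mD (integrableZl mD a f1) (integrableZl mD b f2)) => // x _ /=.
  by rewrite -!EFinM -EFinB; case: (f x).
- apply: eq_integrable (integrableD mD (integrableZl mD a f2) (integrableZl mD b f1)) => // x _ /=.
  by rewrite -!EFinM -EFinD; case: (f x).
Qed.

Lemma cintegrable0 : cintegrable (fun=> 0).
Proof. by split; exact: integrable0. Qed.

Lemma cint0 : cint (fun=> 0) = 0.
Proof. by rewrite /cint !Rintegral_cst// mul0r. Qed.

Lemma cintegrable_sum I (s : seq I) (F : I -> X -> R[i]) :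
  (forall i, cintegrable (F i)) -> cintegrable (fun x => \sum_(i <- s) F i x).
Proof.
move=> iF; elim: s => [|i s ih].
  by rewrite (_ : (fun x => _) = (fun=> 0)); [exact: cintegrable0|
    apply/funext => x; rewrite big_nil].
rewrite (_ : (fun x => _) = (fun x => F i x + \sum_(j <- s) F j x)).
  exact: cintegrableD.
by apply/funext => x; rewrite big_cons.
Qed.

Lemma cint_sum I (s : seq I) (F : I -> X -> R[i]) :
  (forall i, cintegrable (F i)) ->
  cint (fun x => \sum_(i <- s) F i x) = \sum_(i <- s) cint (F i).
Proof.
move=> iF; elim: s => [|i s ih].
  transitivity (cint (fun=> 0)); last by rewrite cint0 big_nil.
  by congr cint; apply/funext => x; rewrite big_nil.
rewrite big_cons -ih -cintD//; last exact: cintegrable_sum.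
by congr cint; apply/funext => x; rewrite big_cons.
Qed.

(** Rotating the integral to the positive real axis reduces the triangle
    inequality to the one for real parts. *)
Lemma normc_cint_le f : cintegrable f ->
  ((Normc.normc (cint f))%:E <= \int[mu]_(x in D) (Normc.normc (f x))%:E)%E.
Proof.
move=> fi; have ni := cintegrable_normc fi.
have [I0|I0] := eqVneq (cint f) 0.
  rewrite I0 Normc.normc0; apply: integral_ge0 => x _; rewrite lee_fin; exact: normc_ge0.
have n0 : Normc.normc (cint f) != 0.
  by apply: contra I0 => /eqP/Normc.eq0_normc ->.
pose z := (cint f)^*%C * ((Normc.normc (cint f))^-1)%:C.
have nz : Normc.normc z = 1.
  rewrite Normc.normcM normc_conj normcR.
  rewrite ger0_norm ?invr_ge0 ?normc_ge0// mulfV//.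
have zI : complex.Re (z * cint f) = Normc.normc (cint f).
  rewrite /z mulrAC; set w := cint f in n0 *.
  have -> : (w^*%C * w) = (Normc.normc w ^+ 2)%:C.
    by rewrite normc_sqrE; case: w {n0} => a b; congr (_ +i* _); simpl; ring.
  by rewrite -rmorphM/= expr2 mulfK.
have zfi := cintegrableZ z fi.
rewrite -zI -cintZ// /cint/= /Rintegral fineK; last first.
  exact: integrable_fin_num (proj1 zfi).
apply: le_integral => //; first exact: (proj1 zfi).
move=> x _; rewrite lee_fin (le_trans (ler_norm _))// (le_trans (normr_Re_le _))//.
by rewrite Normc.normcM nz mul1r.
Qed.

End ComplexIntegral.

(** * Square-integrable functions and the Parseval inequality *)

Section CL2.
Context d (X : measurableType d) (R : realType).
Variables (mu : {measure set X -> \bar R}) (D : set X).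
Hypothesis mD : measurable D.
Implicit Types (f g : X -> R[i]) (z : R[i]).
Local Notation nc := (@Normc.normc R).

Definition cL2 f := cmeas D f /\ (\int[mu]_(x in D) (nc (f x) ^+ 2)%:E < +oo)%E.

Lemma measurable_normc_sqr f : cmeas D f ->
  measurable_fun D (fun x => (nc (f x) ^+ 2)%:E).
Proof. by move=> mf; apply/measurable_EFinP/measurable_funX/cmeas_normc. Qed.

Lemma normc_sqr_ge0 z : (0%:E <= (nc z ^+ 2)%:E)%E.
Proof. by rewrite lee_fin sqr_ge0. Qed.

Lemma normcD_sqr_le z w : nc (z + w) ^+ 2 <= 2 * nc z ^+ 2 + 2 * nc w ^+ 2.
Proof.
have := le_normcD z w.
have := normc_ge0 (z + w); have := normc_ge0 z; have := normc_ge0 w.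
move: (nc (z + w)) (nc z) (nc w) => a b c c0 b0 a0 abc.
have : a ^+ 2 <= (b + c) ^+ 2 by rewrite ler_sqr ?nnegrE ?addr_ge0.
by have := sqr_ge0 (b - c); rewrite !expr2; lra.
Qed.

Lemma integral_normcD_sqr_le f g : cmeas D f -> cmeas D g ->
  (\int[mu]_(x in D) (nc (f x + g x)%R ^+ 2)%:E <=
   2%:E * \int[mu]_(x in D) (nc (f x) ^+ 2)%:E +
   2%:E * \int[mu]_(x in D) (nc (g x) ^+ 2)%:E)%E.
Proof.
move=> mf mg.
have mf2 := measurable_normc_sqr mf; have mg2 := measurable_normc_sqr mg.
rewrite -!ge0_integralZl_EFin//; try by move=> x _; exact: normc_sqr_ge0.
rewrite -ge0_integralD//.
- apply: ge0_le_integral => //.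
  + by move=> x _; exact: normc_sqr_ge0.
  + exact/measurable_normc_sqr/cmeasD.
  + by apply: emeasurable_funD; exact: emeasurable_funM.
  + by move=> x _; rewrite -!EFinM -EFinD lee_fin normcD_sqr_le.
- by move=> x _; rewrite mule_ge0// normc_sqr_ge0.
- exact: emeasurable_funM.
- by move=> x _; rewrite mule_ge0// normc_sqr_ge0.
- exact: emeasurable_funM.
Qed.

Lemma cL2D f g : cL2 f -> cL2 g -> cL2 (fun x => f x + g x).
Proof.
move=> [mf f2] [mg g2]; split; first exact: cmeasD.
apply: le_lt_trans (integral_normcD_sqr_le mf mg) _.
by apply: lte_add_pinfty; apply: lte_mul_pinfty => //; exact: integral_ge0.
Qed.

Lemma cL2Z z f : cL2 f -> cL2 (fun x => z * f x).
Proof.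
move=> [mf f2]; split; first exact: cmeasM (cmeas_cst _ _) mf.
under eq_integral do rewrite Normc.normcM exprMn EFinM.
rewrite ge0_integralZl_EFin ?sqr_ge0//.
- by apply: lte_mul_pinfty => //; rewrite ?lee_fin ?sqr_ge0.
- by move=> x _; exact: normc_sqr_ge0.
- exact: measurable_normc_sqr.
Qed.

Lemma cL2_0 : cL2 (fun=> 0).
Proof.
split; first exact: cmeas_cst.
by under eq_integral do rewrite Normc.normc0 expr0n/=; rewrite integral0.
Qed.

Lemma cL2_sum I (s : seq I) (F : I -> X -> R[i]) :
  (forall i, cL2 (F i)) -> cL2 (fun x => \sum_(i <- s) F i x).
Proof.
move=> iF; elim: s => [|i s ih].
  by rewrite (_ : (fun x => _) = (fun=> 0)); [exact: cL2_0|
    apply/funext => x; rewrite big_nil].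
rewrite (_ : (fun x => _) = (fun x => F i x + \sum_(j <- s) F j x)).
  exact: cL2D.
by apply/funext => x; rewrite big_cons.
Qed.

Lemma cL2_conj f : cL2 f -> cL2 (fun x => (f x)^*%C).
Proof.
move=> [mf f2]; split; first exact: cmeas_conj.
by under eq_integral do rewrite normc_conj.
Qed.

Lemma cL2_mul_unimodular f g : cL2 f -> cmeas D g -> (forall x, nc (g x) = 1) ->
  cL2 (fun x => f x * g x).
Proof.
move=> [mf f2] mg g1; split; first exact: cmeasM.
by under eq_integral do rewrite Normc.normcM g1 mulr1.
Qed.

Lemma cL2_bounded f (M : R) : (mu D < +oo)%E -> cmeas D f ->
  (forall x, nc (f x) <= M) -> cL2 f.
Proof.
move=> muD mf fM; split => //.
apply: (@le_lt_trans _ _ (\int[mu]_(x in D) (M ^+ 2)%:E)%E).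
  apply: ge0_le_integral => //.
  - by move=> x _; exact: normc_sqr_ge0.
  - exact: measurable_normc_sqr.
  - move=> x _; rewrite lee_fin ler_sqr ?nnegrE ?normc_ge0//.
    exact: le_trans (normc_ge0 _) (fM x).
by rewrite integral_cst//; apply: lte_mul_pinfty; rewrite ?lee_fin ?sqr_ge0.
Qed.

(** The free parameter [c] makes the right-hand side small as soon as one of the two
    functions is small and the other is merely bounded in mean square. *)
Lemma normc_cintM_le f g (c : R) : 0 < c -> cL2 f -> cL2 g ->
  cintegrable mu D (fun x => f x * g x) /\
  ((Normc.normc (cint mu D (fun x => f x * g x)))%:E <=
   c%:E * \int[mu]_(x in D) (nc (f x) ^+ 2)%:E +
   c^-1%:E * \int[mu]_(x in D) (nc (g x) ^+ 2)%:E)%E.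
Proof.
move=> c0 [mf f2] [mg g2].
have ci0 : 0 < c^-1 by rewrite invr_gt0.
have mfg := cmeasM mf mg.
have mf2 := measurable_normc_sqr mf; have mg2 := measurable_normc_sqr mg.
have main : (\int[mu]_(x in D) (nc (f x * g x)%R)%:E <=
   c%:E * \int[mu]_(x in D) (nc (f x) ^+ 2)%:E +
   c^-1%:E * \int[mu]_(x in D) (nc (g x) ^+ 2)%:E)%E.
  rewrite -!ge0_integralZl_EFin ?(ltW c0) ?(ltW ci0)//;
    try by move=> x _; exact: normc_sqr_ge0.
  rewrite -ge0_integralD//.
  - apply: ge0_le_integral => //.
    + by move=> x _; rewrite lee_fin normc_ge0.
    + by apply/measurable_EFinP; exact: cmeas_normc.
    + by apply: emeasurable_funD; exact: emeasurable_funM.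
    + move=> x _; rewrite Normc.normcM -!EFinM -EFinD lee_fin.
      have := normc_ge0 (f x); have := normc_ge0 (g x).
      move: (nc (f x)) (nc (g x)) => a b b0 a0.
      have : 0 <= c^-1 * (c * a - b) ^+ 2 by rewrite mulr_ge0 ?sqr_ge0// ltW.
      have -> : c^-1 * (c * a - b) ^+ 2 = c * a ^+ 2 + c^-1 * b ^+ 2 - 2 * (a * b).
        by field; rewrite gt_eqF.
      by have := mulr_ge0 a0 b0; lra.
  - by move=> x _; rewrite mule_ge0 ?normc_sqr_ge0// lee_fin ltW.
  - exact: emeasurable_funM.
  - by move=> x _; rewrite mule_ge0 ?normc_sqr_ge0// lee_fin ltW.
  - exact: emeasurable_funM.
have fgi : cintegrable mu D (fun x => f x * g x).
  apply: cintegrableP => //; apply: le_lt_trans main _.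
  by apply: lte_add_pinfty; apply: lte_mul_pinfty; rewrite ?lee_fin ?ltW.
by split => //; apply: le_trans main; exact: normc_cint_le.
Qed.

Lemma cintegrableM f g : cL2 f -> cL2 g -> cintegrable mu D (fun x => f x * g x).
Proof. by move=> f2 g2; exact: (proj1 (normc_cintM_le ltr01 f2 g2)). Qed.

End CL2.

Section Parseval.
Context d (X : measurableType d) (R : realType).
Variables (mu : {measure set X -> \bar R}) (D : set X).
Hypothesis mD : measurable D.
Variables (I : countType) (e : I -> X -> R[i]) (m : R).
Local Notation nc := (@Normc.normc R).
Local Notation cL2 := (cL2 mu D).
Local Notation cI := (cint mu D).
Hypothesis m0 : 0 < m.
Hypothesis eL2 : forall i, cL2 (e i).
Hypothesis e_orth : forall i j,
  cI (fun x => e i x * (e j x)^*%C) = if i == j then m%:C else 0.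
Hypothesis e_dense : forall f, cL2 f -> forall eps : R, 0 < eps ->
  exists s : seq (R[i] * I),
  (\int[mu]_(x in D) (nc (f x - \sum_(c <- s) c.1 * e c.2 x)%R ^+ 2)%:E <= eps%:E)%E.

Lemma sum_le_esum (s : seq I) (a : I -> R) : uniq s -> (forall i, 0 <= a i) ->
  ((\sum_(i <- s) a i)%:E <= \esum_(i in [set: I]) (a i)%:E)%E.
Proof.
move=> us a0; apply: esum_ge; exists [set` s]; first by split => //; exact: finite_seq.
by rewrite -fsbig_seq// -sumEFin.
Qed.

Section Projection.
Variables (h : X -> R[i]) (F : seq I).
Hypotheses (hL2 : cL2 h) (uF : uniq F).

Let P x := \sum_(j <- F) (m^-1%:C * cI (fun y => h y * e j y)) * (e j x)^*%C.
Let h' x := h x - P x.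

Let PL2 : cL2 P.
Proof. by apply: cL2_sum => // j; apply: cL2Z => //; exact: cL2_conj. Qed.

Let h'L2 : cL2 h'.
Proof.
rewrite (_ : h' = fun x => h x + (-1) * P x).
  by apply: cL2D => //; exact: cL2Z.
by apply/funext => x; rewrite /h' mulN1r.
Qed.

Let e_h' i : i \in F -> cI (fun x => e i x * h' x) = 0.
Proof.
move=> iF.
have -> : cI (fun x => e i x * h' x) = cI (fun x => h x * e i x) +
    cI (fun x => \sum_(j <- F) (- (m^-1%:C * cI (fun y => h y * e j y))) *
      (e i x * (e j x)^*%C)).
  rewrite -cintD//; last first.
  - apply: cintegrable_sum => // j; apply: cintegrableZ => //.
    by apply: cintegrableM => //; exact: cL2_conj.
  - exact: cintegrableM.
  congr (cint _ _ _); apply/funext => x.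
  rewrite /h' /P mulrBr [e i x * h x]mulrC; congr (_ + _).
  rewrite -mulrN -sumrN mulr_sumr; apply: eq_bigr => j _.
  by rewrite mulNr mulrN mulrCA.
rewrite cint_sum//; last first.
  move=> j; apply: cintegrableZ => //; apply: cintegrableM => //; exact: cL2_conj.
rewrite (bigD1_seq i)//= big1 ?addr0; last first.
  move=> j ji; rewrite cintZ//; last by apply: cintegrableM => //; exact: cL2_conj.
  by rewrite e_orth eq_sym (negbTE ji) mulr0.
rewrite cintZ//; last by apply: cintegrableM => //; exact: cL2_conj.
rewrite e_orth eqxx mulNr mulrAC -rmorphM/= mulVf ?gt_eqF// mul1r.
exact: subrr.
Qed.

Let e_span_h' (s : seq (R[i] * I)) : {subset map snd s <= F} ->
  cI (fun x => (\sum_(c <- s) c.1 * e c.2 x) * h' x) = 0.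
Proof.
move=> sF.
rewrite (_ : (fun x => _) = (fun x => \sum_(c <- s) c.1 * (e c.2 x * h' x))).
  rewrite cint_sum//; last first.
    by move=> c; apply: cintegrableZ => //; exact: cintegrableM.
  rewrite big_seq big1// => c cs; rewrite cintZ//; last exact: cintegrableM.
  by rewrite e_h' ?mulr0// sF// map_f.
by apply/funext => x; rewrite mulr_suml; apply: eq_bigr => c _; rewrite mulrA.
Qed.

(** Bessel: [h = h' + P] with [P] orthogonal to [h'], and
    [|h|^2 >= |h'|^2 + 2 Re (conj P h')] pointwise. *)
Let bessel : (\int[mu]_(x in D) (nc (h' x) ^+ 2)%:E <=
  \int[mu]_(x in D) (nc (h x) ^+ 2)%:E)%E.
Proof.
pose Q x := (P x)^*%C.
have QL2 : cL2 Q by exact: cL2_conj.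
have Qh' : cI (fun x => Q x * h' x) = 0.
  pose s := [seq (((m^-1%:C * cI (fun y => h y * e j y))^*%C), j) | j <- F].
  rewrite -(e_span_h' (s := s)).
    congr (cint _ _ _); apply/funext => x; congr (_ * _).
    rewrite /Q /P rmorph_sum/= big_map; apply: eq_bigr => j _.
    by rewrite rmorphM/= conjcK.
  by rewrite /s -map_comp (eq_map (g := id)) ?map_id.
have [qi1 qi2] := cintegrableM mD QL2 h'L2.
have i2 : mu.-integrable D (fun x => (nc (h' x) ^+ 2)%:E).
  apply/integrableP; split; first exact/measurable_normc_sqr/(proj1 h'L2).
  under eq_integral do rewrite gee0_abs ?normc_sqr_ge0//.
  exact: (proj2 h'L2).
have Re0 : (\int[mu]_(x in D) (complex.Re (Q x * h' x)%R)%:E = 0)%E.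
  have re0 : complex.Re (cI (fun x => Q x * h' x)) = 0 by rewrite Qh'.
  rewrite -[LHS]fineK; last exact: integrable_fin_num qi1.
  by move: re0; rewrite /cint/= /Rintegral => ->.
have -> : (\int[mu]_(x in D) (nc (h' x) ^+ 2)%:E =
  \int[mu]_(x in D) ((nc (h' x) ^+ 2)%:E + 2%:E * (complex.Re (Q x * h' x)%R)%:E))%E.
  rewrite integralD//; last exact: integrableZl.
  by rewrite integralZl// Re0 mule0 adde0.
apply: le_integral => //.
- by apply: integrableD => //; exact: integrableZl.
- apply/integrableP; split; first exact/measurable_normc_sqr/(proj1 hL2).
  under eq_integral do rewrite gee0_abs ?normc_sqr_ge0//.
  exact: (proj2 hL2).
move=> x _; rewrite -EFinM -EFinD lee_fin !normc_sqrE /Q.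
have -> : h x = h' x + P x by rewrite /h' subrK.
case: (h' x) (P x) => a b [a' b'] /=.
by have := sqr_ge0 a'; have := sqr_ge0 b'; rewrite !expr2; lra.
Qed.

(** With [p] the combination given by [s],
    [f h = (f - p) h' + p h' + f P]: the second term integrates to zero and the
    third one to finitely many terms of the Parseval sum. *)
Lemma cintM_projection_le (f : X -> R[i]) (s : seq (R[i] * I)) (c : R) : 0 < c ->
  cL2 f -> {subset map snd s <= F} ->
  ((nc (cI (fun x => f x * h x)%R))%:E <=
   (c%:E * \int[mu]_(x in D) (nc (f x - \sum_(c <- s) c.1 * e c.2 x)%R ^+ 2)%:E +
    c^-1%:E * \int[mu]_(x in D) (nc (h x) ^+ 2)%:E) +
   (m^-1)%:E * \esum_(i in [set: I])
     (nc (cI (fun x => f x * (e i x)^*%C)) * nc (cI (fun x => h x * e i x)))%:E)%E.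
Proof.
move=> c0 fL2 sF.
have mi0 : 0 <= m^-1 by rewrite invr_ge0 ltW.
pose p x := \sum_(c <- s) c.1 * e c.2 x.
have pL2 : cL2 p by apply: cL2_sum => // i; exact: cL2Z.
have fpL2 : cL2 (fun x => f x - p x).
  rewrite (_ : (fun x => _) = fun x => f x + (-1) * p x).
    by apply: cL2D => //; exact: cL2Z.
  by apply/funext => x; rewrite mulN1r.
have [i1 b1] := normc_cintM_le mD c0 fpL2 h'L2.
have i2 := cintegrableM mD pL2 h'L2.
have i3 := cintegrableM mD fL2 PL2.
have -> : cI (fun x => f x * h x) = (cI (fun x => (f x - p x) * h' x) +
    cI (fun x => p x * h' x)) + cI (fun x => f x * P x).
  rewrite -!cintD//; last exact: cintegrableD.
  by congr (cint _ _ _); apply/funext => x; rewrite /h'; ring.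
rewrite e_span_h'// addr0.
apply: (@le_trans _ _ (nc (cI (fun x => (f x - p x) * h' x)) +
    nc (cI (fun x => f x * P x)))%:E); first by rewrite lee_fin le_normcD.
rewrite EFinD; apply: leeD.
  apply: le_trans b1 _; apply: leeD => //; apply: lee_wpmul2l; last exact: bessel.
  by rewrite lee_fin invr_ge0 ltW.
have -> : cI (fun x => f x * P x) = \sum_(j <- F)
    (m^-1%:C * cI (fun y => h y * e j y)) * cI (fun x => f x * (e j x)^*%C).
  have fe j : cintegrable mu D (fun x => f x * (e j x)^*%C).
    by apply: cintegrableM => //; exact: cL2_conj.
  under [RHS]eq_bigr do rewrite -cintZ//.
  rewrite -cint_sum//; last by move=> j; exact: cintegrableZ.
  congr (cint _ _ _); apply/funext => x; rewrite /P mulr_sumr.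
  by apply: eq_bigr => j _; rewrite mulrCA.
apply: (@le_trans _ _ (m^-1 * \sum_(j <- F)
    (nc (cI (fun x => f x * (e j x)^*%C)) * nc (cI (fun x => h x * e j x))))%:E).
  rewrite lee_fin mulr_sumr; elim: (F) => [|j t ih].
    by rewrite !big_nil Normc.normc0.
  rewrite !big_cons; apply: le_trans (le_normcD _ _) _; rewrite lerD//.
  rewrite !Normc.normcM normcR (ger0_norm mi0) -mulrA.
  by rewrite [X in m^-1 * X <= _]mulrC.
rewrite EFinM lee_wpmul2l ?lee_fin//.
by apply: sum_le_esum => // i; rewrite mulr_ge0 ?normc_ge0.
Qed.

End Projection.

(** Removing from [h] its components along finitely many [e i] does not increase
    its norm and makes it orthogonal to a given approximation of [f]; only the error
    of that approximation is left beside the Parseval sum. *)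
Lemma parseval_le (f h : X -> R[i]) : cL2 f -> cL2 h ->
  ((nc (cI (fun x => f x * h x)%R))%:E <=
   (m^-1)%:E * \esum_(i in [set: I])
     (nc (cI (fun x => f x * (e i x)^*%C)) * nc (cI (fun x => h x * e i x)))%:E)%E.
Proof.
move=> fL2 hL2; apply/lee_addgt0Pr => dl dl0.
set N := (\int[mu]_(x in D) (nc (h x) ^+ 2)%:E)%E.
have N0 : (0 <= N)%E by apply: integral_ge0 => x _; exact: normc_sqr_ge0.
have Nfin : N \is a fin_num by rewrite ge0_fin_numE//; exact: (proj2 hL2).
set H := fine N; have H0 : 0 <= H by rewrite fine_ge0.
(* both terms of the error are then at most [dl / 2] *)
pose c := 2 * (H + 1) / dl; have c0 : 0 < c by rewrite divr_gt0 ?mulr_gt0//; lra.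
have e0 : 0 < dl / (2 * c) by apply: divr_gt0 => //; exact: mulr_gt0.
have [s hs] := e_dense fL2 e0.
have := @cintM_projection_le h (undup (map snd s)) hL2 (undup_uniq _) f s c c0 fL2.
move=> /(_ _)/le_trans; apply; first by move=> i; rewrite mem_undup.
rewrite [leRHS]addeC leeD2r// -/N -(fineK Nfin) -/H.
apply: (@le_trans _ _ (c%:E * (dl / (2 * c))%:E + c^-1%:E * H%:E)%E).
  by rewrite leeD2r// lee_wpmul2l// lee_fin ltW.
rewrite -!EFinM -EFinD lee_fin.
have -> : c * (dl / (2 * c)) = dl / 2 by field; rewrite gt_eqF.
have H1 : 0 < H + 1 by lra.
have -> : c^-1 * H = dl / 2 * (H / (H + 1)).
  by rewrite /c; field; rewrite !gt_eqF.
have h1 : H / (H + 1) <= 1 by rewrite ler_pdivrMr//; lra.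
have d2 : 0 <= dl / 2 by lra.
by have := ler_wpM2l d2 h1; lra.
Qed.

End Parseval.

(** * Density of an algebra of functions *)

Section PowerLimits.
Context {R : realType}.
Implicit Types (r x y z : R).

Lemma bernoulli_le x n : 0 <= x -> 1 + n%:R * x <= (1 + x) ^+ n.
Proof.
move=> x0; elim: n => [|n ih]; first by rewrite mul0r addr0 expr0.
rewrite exprSr; apply: (@le_trans _ _ ((1 + n%:R * x) * (1 + x))); last first.
  by rewrite ler_wpM2r// addr_ge0.
have : 0 <= n%:R * x * x by rewrite !mulr_ge0.
by rewrite -natr1; lra.
Qed.

Lemma one_sub_pow_ge z m : 0 <= z -> z <= 1 -> 1 - m%:R * z <= (1 - z) ^+ m.
Proof.
move=> z0 z1; elim: m => [|m ih]; first by rewrite mul0r subr0 expr0.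
rewrite exprSr; apply: (@le_trans _ _ ((1 - m%:R * z) * (1 - z))); last first.
  by rewrite ler_wpM2r// subr_ge0.
have : 0 <= m%:R * z * z by rewrite !mulr_ge0.
by rewrite -natr1; lra.
Qed.

Lemma one_sub_pow_le z m : 0 <= z -> z <= 1 -> (1 - z) ^+ m <= (1 + m%:R * z)^-1.
Proof.
move=> z0 z1; have p : 0 < 1 + m%:R * z by rewrite ltr_pwDl// mulr_ge0.
rewrite -[leRHS]mul1r ler_pdivlMr//.
apply: (@le_trans _ _ ((1 - z) ^+ m * (1 + z) ^+ m)).
  by rewrite ler_wpM2l ?bernoulli_le// exprn_ge0// subr_ge0.
rewrite -exprMn exprn_ile1//; first by have := mulr_ge0 z0 z0; nra.
by have := mulr_ge0 z0 z0; nra.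
Qed.

Lemma cvg_natr_mul_expr r : 0 <= r -> r < 1 -> (n%:R * r ^+ n) @[n --> \oo] --> (0 : R).
Proof.
move=> r0 r1.
have [->|rN0] := eqVneq r 0.
  rewrite (_ : (fun n => _) = fun n => 0); first exact: cvg_cst.
  by apply/funext => -[|n]; rewrite ?mul0r// expr0n mulr0.
have rp : 0 < r by rewrite lt_neqAle eq_sym rN0.
set q := Num.sqrt r.
have qp : 0 < q by rewrite sqrtr_gt0.
have qq : r = q * q by rewrite -expr2 sqr_sqrtr.
have q1 : q < 1 by rewrite -sqrtr1 ltr_sqrt.
pose h := q^-1 - 1; have hp : 0 < h by rewrite subr_gt0 invf_gt1.
have nq n : n%:R * q ^+ n <= h^-1.
  rewrite -[h^-1]mul1r ler_pdivlMr//.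
  have := bernoulli_le n (ltW hp); have -> : 1 + h = q^-1 by rewrite /h; lra.
  rewrite exprVn -[X in _ <= X]mul1r ler_pdivlMr ?exprn_gt0// => hn.
  by apply: le_trans hn; have := exprn_gt0 n qp; lra.
apply: (@squeeze_cvgr _ _ _ _ (fun=> 0) (fun n => h^-1 * q ^+ n)).
- near=> n; rewrite mulr_ge0 ?exprn_ge0//=.
  by rewrite qq exprMn mulrA ler_wpM2r ?exprn_ge0 ?(ltW qp).
- exact: cvg_cst.
- rewrite -(mulr0 h^-1); apply: cvgM; first exact: cvg_cst.
  by apply: cvg_expr; rewrite ger0_norm// ltW.
Unshelve. all: by end_near. Qed.

(** The product of the exponent and of the base defect is [n (2 y)^n], which tends
    to zero for [y < 1/2] and to infinity for [y >= 1/2], the point [1/2] included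
    thanks to the factor [n]: no exceptional set has to be discarded. *)
Lemma cvg_threshold y : 0 <= y -> y <= 1 ->
  (1 - y ^+ n) ^+ (n * 2 ^ n)%N @[n --> \oo] --> ((y < 2^-1)%R%:R : R).
Proof.
move=> y0 y1.
have yn n : 0 <= y ^+ n /\ y ^+ n <= 1 by rewrite exprn_ge0// exprn_ile1.
have E n : (n * 2 ^ n)%:R * y ^+ n = n%:R * (2 * y) ^+ n :> R.
  by rewrite natrM natrX exprMn mulrA.
have [yl|yl] := ltP y 2^-1.
  apply: (@squeeze_cvgr _ _ _ _ (fun n => 1 - n%:R * (2 * y) ^+ n) (fun=> 1)).
  - near=> n; have [a b] := yn n; rewrite -E one_sub_pow_ge//=.
    by rewrite exprn_ile1//; lra.
  - rewrite -[X in _ --> X]subr0; apply: cvgB; first exact: cvg_cst.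
    by apply: cvg_natr_mul_expr; lra.
  - exact: cvg_cst.
apply: (@squeeze_cvgr _ _ _ _ (fun=> 0) (fun n => (n.+1%:R)^-1)).
- near=> n; have [a b] := yn n; apply/andP; split.
    by rewrite exprn_ge0// subr_ge0.
  apply: le_trans (one_sub_pow_le _ a b) _.
  rewrite lef_pV2 ?posrE//; last by rewrite ltr_pwDl// mulr_ge0.
  rewrite E -natr1 addrC lerD2l ler_peMr//.
  by rewrite exprn_ege1//; lra.
- exact: cvg_cst.
- exact: cvg_harmonic.
Unshelve. all: by end_near. Qed.

End PowerLimits.

Section Density.
Context d (X : measurableType d) (R : realType).
Variables (mu : {measure set X -> \bar R}) (D : set X).
Hypothesis mD : measurable D.
Hypothesis muD : (mu D < +oo)%E.
Variable A : set (X -> R).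
Hypothesis A_cst : forall c, A (fun=> c).
Hypothesis A_D : forall p q, A p -> A q -> A (fun x => p x + q x).
Hypothesis A_M : forall p q, A p -> A q -> A (fun x => p x * q x).
Hypothesis A_meas : forall p, A p -> measurable_fun D p.
Hypothesis A_bdd : forall p, A p -> exists M : R, forall x, `|p x| <= M.
Implicit Types (f g p q : X -> R).

Definition sqdist f g : \bar R := (\int[mu]_(x in D) ((f x - g x)%R ^+ 2)%:E)%E.

(** The mean-square closure of the algebra [A]. *)
Definition ms_approx f := measurable_fun D f /\
  forall e, 0 < e -> exists2 p, A p & (sqdist f p <= e%:E)%E.

Lemma sqdist_le_lin (f g f1 g1 f2 g2 : X -> R) (a b : R) : 0 <= a -> 0 <= b ->
  measurable_fun D f -> measurable_fun D g ->
  measurable_fun D f1 -> measurable_fun D g1 ->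
  measurable_fun D f2 -> measurable_fun D g2 ->
  (forall x, D x -> (f x - g x) ^+ 2 <= a * (f1 x - g1 x) ^+ 2 + b * (f2 x - g2 x) ^+ 2) ->
  (sqdist f g <= a%:E * sqdist f1 g1 + b%:E * sqdist f2 g2)%E.
Proof.
move=> a0 b0 mf mg mf1 mg1 mf2 mg2 H; rewrite /sqdist.
have m (u v : X -> R) : measurable_fun D u -> measurable_fun D v ->
    measurable_fun D (fun x => ((u x - v x)%R ^+ 2)%:E).
  by move=> mu' mv; apply/measurable_EFinP/measurable_funX/measurable_funB.
have m1 := m _ _ mf1 mg1; have m2 := m _ _ mf2 mg2; have m0 := m _ _ mf mg.
rewrite -!ge0_integralZl_EFin//; try by move=> x _; rewrite lee_fin sqr_ge0.
rewrite -ge0_integralD//.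
- apply: ge0_le_integral => //.
  + by move=> x _; rewrite lee_fin sqr_ge0.
  + by apply: emeasurable_funD; exact: emeasurable_funM.
- by move=> x _; rewrite mule_ge0 ?lee_fin ?sqr_ge0.
- exact: emeasurable_funM.
- by move=> x _; rewrite mule_ge0 ?lee_fin ?sqr_ge0.
- exact: emeasurable_funM.
Qed.

Lemma sqdist_refl f : sqdist f f = 0%E.
Proof. by rewrite /sqdist; under eq_integral do rewrite subrr expr0n/=; rewrite integral0. Qed.

Lemma approx_mem p : A p -> ms_approx p.
Proof.
move=> Ap; split; first exact: A_meas.
by move=> e e0; exists p => //; rewrite sqdist_refl lee_fin ltW.
Qed.

Lemma approx_trans f : measurable_fun D f ->
  (forall e, 0 < e -> exists2 g, ms_approx g & (sqdist f g <= e%:E)%E) -> ms_approx f.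
Proof.
move=> mf H; split => // e e0.
have e4 : 0 < e / 4 by rewrite divr_gt0.
have [g [mg ag] fg] := H _ e4; have [p Ap gp] := ag _ e4.
exists p => //; have mp := A_meas Ap.
apply: (@le_trans _ _ (2%:E * sqdist f g + 2%:E * sqdist g p)%E).
  apply: sqdist_le_lin => // x _.
  have := sqr_ge0 ((f x - g x) - (g x - p x)); rewrite !expr2; lra.
apply: (@le_trans _ _ (2%:E * (e / 4)%:E + 2%:E * (e / 4)%:E)%E).
  by apply: leeD; apply: lee_wpmul2l.
by rewrite -!EFinM -EFinD lee_fin; lra.
Qed.

Lemma approxM f g (M : R) : ms_approx f -> ms_approx g -> (forall x, D x -> `|g x| <= M) ->
  ms_approx (fun x => f x * g x).
Proof.
move=> [mf af] [mg ag] gM; split; first exact: measurable_funM.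
move=> e e0.
pose a := 2 * (M ^+ 2 + 1); have a0 : 0 < a by rewrite mulr_gt0// ltr_wpDl// sqr_ge0.
(* [p] comes first: its bound [N] fixes the precision required of [q] *)
have [p Ap fp] : exists2 p, A p & (sqdist f p <= (e / 2 / a)%:E)%E.
  by apply: af; rewrite !divr_gt0.
have [N pN] := A_bdd Ap; have mp := A_meas Ap.
pose b := 2 * (N ^+ 2 + 1); have b0 : 0 < b by rewrite mulr_gt0// ltr_wpDl// sqr_ge0.
have [q Aq gq] : exists2 q, A q & (sqdist g q <= (e / 2 / b)%:E)%E.
  by apply: ag; rewrite !divr_gt0.
have mq := A_meas Aq.
exists (fun x => p x * q x); first exact: A_M.
apply: (@le_trans _ _ (a%:E * sqdist f p + b%:E * sqdist g q)%E).
  apply: sqdist_le_lin; rewrite ?(ltW a0) ?(ltW b0)//; try exact: measurable_funM.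
  move=> x Dx.
  have sq (y K : R) : `|y| <= K -> y ^+ 2 <= K ^+ 2 + 1.
    move=> yK; rewrite -[y ^+ 2]ger0_norm ?sqr_ge0// normrX.
    apply: (@le_trans _ _ (K ^+ 2)); last by rewrite lerDl.
    by rewrite ler_sqr ?nnegrE// (le_trans _ yK).
  have g2 := sq _ _ (gM x Dx); have p2 := sq _ _ (pN x).
  apply: (@le_trans _ _ (2 * (g x ^+ 2 * (f x - p x) ^+ 2) +
      2 * (p x ^+ 2 * (g x - q x) ^+ 2))).
    have := sqr_ge0 (g x * (f x - p x) - p x * (g x - q x)).
    by rewrite !expr2; lra.
  by rewrite /a /b; apply: lerD; rewrite -[leRHS]mulrA ler_wpM2l// ler_wpM2r ?sqr_ge0.
apply: (@le_trans _ _ (a%:E * (e / 2 / a)%:E + b%:E * (e / 2 / b)%:E)%E).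
  by apply: leeD; apply: lee_wpmul2l => //; rewrite lee_fin ltW.
rewrite -!EFinM -EFinD lee_fin.
have -> : a * (e / 2 / a) + b * (e / 2 / b) = e by field; rewrite !gt_eqF.
exact: lexx.
Qed.

Lemma approxD f g : ms_approx f -> ms_approx g -> ms_approx (fun x => f x + g x).
Proof.
move=> [mf af] [mg ag]; split; first exact: measurable_funD.
move=> e e0; have e4 : 0 < e / 4 by rewrite divr_gt0.
have [p Ap fp] := af _ e4; have [q Aq gq] := ag _ e4.
have mp := A_meas Ap; have mq := A_meas Aq.
exists (fun x => p x + q x); first exact: A_D.
apply: (@le_trans _ _ (2%:E * sqdist f p + 2%:E * sqdist g q)%E).
  apply: sqdist_le_lin => //; try exact: measurable_funD.
  move=> x _; have := sqr_ge0 ((f x - p x) - (g x - q x)); rewrite !expr2; lra.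
apply: (@le_trans _ _ (2%:E * (e / 4)%:E + 2%:E * (e / 4)%:E)%E).
  by apply: leeD; apply: lee_wpmul2l.
by rewrite -!EFinM -EFinD lee_fin; lra.
Qed.

Lemma approx_cst c : ms_approx (fun=> c).
Proof. exact/approx_mem/A_cst. Qed.

Lemma approxZ c f : ms_approx f -> ms_approx (fun x => c * f x).
Proof.
move=> af; rewrite (_ : (fun x => _) = (fun x => f x * c)); last first.
  by apply/funext => x; rewrite mulrC.
by apply: (@approxM f (fun=> c) `|c|) => //; exact: approx_cst.
Qed.

Lemma approx_cvg (f_ : (X -> R)^nat) f (g : X -> R) :
  (forall n, ms_approx (f_ n)) -> measurable_fun D f ->
  (forall x, D x -> f_ n x @[n --> \oo] --> f x) ->
  mu.-integrable D (EFin \o g) ->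
  (forall n x, D x -> (f x - f_ n x) ^+ 2 <= g x) -> ms_approx f.
Proof.
move=> af mf cf gi fg; apply: approx_trans => // e e0.
pose h_ n x : \bar R := ((f x - f_ n x)%R ^+ 2)%:E.
have mh n : measurable_fun D (h_ n).
  by apply/measurable_EFinP/measurable_funX/measurable_funB => //; exact: (proj1 (af n)).
have cv : {ae mu, forall x, D x -> h_ n x @[n --> \oo] --> (cst 0%E x : \bar R)}.
  apply/nearW => x Dx; apply: cvg_EFin; first by near=> n.
  rewrite -[X in _ --> X](expr0n _ 2) -(subrr (f x)).
  apply: (@continuous_cvg _ _ _ _ _ _ (fun y : R => y ^+ 2)); first exact: exprn_continuous.
  by apply: cvgB; [exact: cvg_cst|exact: cf].
have dom : {ae mu, forall x n, D x -> (`|h_ n x| <= (EFin \o g) x)%E}.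
  apply/nearW => x n Dx; rewrite gee0_abs ?lee_fin ?sqr_ge0//; exact: fg.
have [_ + _] := @dominated_convergence _ _ _ mu D mD h_ (cst 0%E) (EFin \o g) mh
  (measurable_cst _) cv gi dom.
move=> /fine_cvgP[fin /cvgrPdist_lt/(_ e e0) cl].
near \oo => n; exists (f_ n) => //.
have -> : sqdist f (f_ n) = (\int[mu]_(x in D) `|h_ n x - cst 0%E x|)%E.
  by apply: eq_integral => x _; rewrite sube0 gee0_abs// lee_fin sqr_ge0.
have finn : (\int[mu]_(x in D) `|h_ n x - cst 0%E x|)%E \is a fin_num by near: n.
rewrite -(fineK finn) lee_fin.
have : `|0 - fine (\int[mu]_(x in D) `|h_ n x - cst 0%E x|)%E| < e by near: n.
by rewrite sub0r normrN => /ltW; apply: le_trans; exact: ler_norm.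
Unshelve. all: by end_near. Qed.

Lemma bounded_integrable (M : R) : mu.-integrable D (EFin \o (fun=> M)).
Proof.
apply/integrableP; split; first exact: measurable_cst.
by rewrite integral_cst//; apply: lte_mul_pinfty.
Qed.

Lemma approx_cvg_bounded (f_ : (X -> R)^nat) f (M : R) :
  (forall n, ms_approx (f_ n)) -> (forall n x, D x -> `|f_ n x| <= M) ->
  (forall x, D x -> f_ n x @[n --> \oo] --> f x) -> ms_approx f.
Proof.
move=> af fM cf.
have mf : measurable_fun D f.
  by apply: (measurable_fun_cvg (fun n => proj1 (af n))) => x Dx; exact: cf.
apply: (approx_cvg af mf cf (bounded_integrable ((2 * M) ^+ 2))) => n x Dx.
have fx : `|f x| <= M.
  have /cvg_norm c := cf x Dx.
  rewrite -(cvg_lim _ c)//; apply: limr_le; first by apply/cvg_ex; exists `|f x|.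
  by apply/nearW => m; exact: fM.
rewrite -[leLHS]ger0_norm ?sqr_ge0// normrX.
have M0 : 0 <= M by exact: le_trans fx.
rewrite ler_sqr ?nnegrE ?mulr_ge0// (le_trans (ler_normB _ _))//.
by have := fM n x Dx; lra.
Qed.

(** The sets whose indicators are approximable form a sigma-algebra: products
    give intersections, bounded limits give countable unions. *)
Definition approx_set (B : set X) := measurable B /\ ms_approx \1_B.

Lemma approx_setC B : approx_set B -> approx_set (~` B).
Proof.
move=> [mB aB]; split; first exact: measurableC.
rewrite (_ : \1_(~` B) = (fun x => 1 + (-1) * \1_B x)).
  by apply: approxD; [exact: approx_cst|exact: approxZ].
by apply/funext => x; rewrite !indicE in_setC; case: (_ \in _) => /=; lra.
Qed.

Lemma approx_set_bigcup (B : (set X)^nat) : (forall n, approx_set (B n)) ->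
  approx_set (\bigcup_n B n).
Proof.
move=> aB; split; first by apply: bigcupT_measurable => n; exact: (proj1 (aB n)).
pose P n x : R := \prod_(i < n) (1 + (-1) * \1_(B i) x).
have t01 i x : (1 + (-1) * \1_(B i) x : R) = (x \notin B i)%:R.
  by rewrite indicE; case: (_ \in _) => /=; lra.
have P01 n x : `|P n x| <= 1.
  rewrite normr_prod; apply: prodr_ile1 => i _; rewrite normr_ge0 t01.
  by case: (_ \notin _); rewrite ?normr1 ?normr0 ?lexx ?ler01.
have aP n : ms_approx (P n).
  rewrite /P; elim: n => [|n ih].
    rewrite (_ : (fun x => _) = fun=> 1); first exact: approx_cst.
    by apply/funext => x; rewrite big_ord0.
  rewrite (_ : (fun x => _) = fun x => P n x * (1 + (-1) * \1_(B n) x)).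
    apply: (@approxM _ _ 1) => //.
      by apply: approxD; [exact: approx_cst|exact/approxZ/(proj2 (aB n))].
    by move=> x _; rewrite t01; case: (_ \notin _); rewrite ?normr1 ?normr0 ?lexx ?ler01.
  by apply/funext => x; rewrite /P big_ord_recr.
apply: (@approx_cvg_bounded (fun n x => 1 + (-1) * P n x) _ 2).
- by move=> n; apply: approxD; [exact: approx_cst|exact: approxZ].
- move=> n x _; have := P01 n x; rewrite !ler_norml; lra.
move=> x _; rewrite indicE; have [xB|xB] := boolP (x \in \bigcup_n B n).
  move: xB; rewrite inE => -[i _ Bi].
  apply: cvg_near_cst; exists i.+1 => // n /= ni.
  rewrite /P (bigD1 (Ordinal ni))//= t01.
  by rewrite mem_set//= mul0r mulr0 addr0.
apply: cvg_near_cst; apply/nearW => n.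
have -> : P n x = 1.
  rewrite /P big1// => i _; rewrite t01 (_ : x \notin B i)//.
  by apply: contra xB; rewrite !inE => Bi; exists i.
by rewrite mulN1r subrr.
Qed.

Lemma approx_set_sigma : sigma_algebra setT approx_set.
Proof.
split.
- split => //; rewrite (_ : \1_set0 = fun=> 0); first exact: approx_cst.
  by apply/funext => x; rewrite indicE in_set0.
- by move=> B aB; rewrite setTD; exact: approx_setC.
- exact: approx_set_bigcup.
Qed.

(** The polynomials of [cvg_threshold] in [q] belong to [A]. *)
Lemma approx_set_threshold q (B : set X) : A q -> measurable B ->
  (forall x, D x -> 0 <= q x <= 1) -> (forall x, D x -> B x <-> q x < 2^-1) ->
  approx_set B.
Proof.
move=> Aq mB q01 Bq; split => //.
have AX p n : A p -> A (fun x => p x ^+ n).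
  move=> Ap; elim: n => [|n ih].
    by rewrite (_ : (fun x => _) = fun=> 1); [exact: A_cst|
      apply/funext => x; rewrite expr0].
  rewrite (_ : (fun x => _) = fun x => p x * p x ^+ n); first exact: A_M.
  by apply/funext => x; rewrite exprS.
apply: (@approx_cvg_bounded (fun n x => (1 + (-1) * q x ^+ n) ^+ (n * 2 ^ n)%N) _ 1).
- move=> n; apply: approx_mem; apply: (AX _ _); apply: A_D; first exact: A_cst.
  by apply: A_M; [exact: A_cst|exact: AX].
- move=> n x Dx; have /andP[q0 q1] := q01 x Dx.
  have a : 0 <= q x ^+ n by exact: exprn_ge0.
  have b : q x ^+ n <= 1 by exact: exprn_ile1.
  by rewrite ger0_norm ?exprn_ge0 ?exprn_ile1//; lra.
move=> x Dx; have /andP[q0 q1] := q01 x Dx.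
rewrite indicE (_ : (x \in B) = (q x < 2^-1)); last first.
  by apply/idP/idP; rewrite inE => /(Bq x Dx).
under eq_fun do rewrite mulN1r.
exact: cvg_threshold.
Qed.

(** Once all measurable sets are approximable, simple functions are, hence all
    square-integrable functions. *)
Hypothesis all_sets : forall B, measurable B -> approx_set B.

Import HBNNSimple.

Lemma approx_ge0 f : measurable_fun setT f -> (forall x, 0 <= f x) ->
  (\int[mu]_(x in D) ((f x) ^+ 2)%:E < +oo)%E -> ms_approx f.
Proof.
move=> mfT f0 f2.
have mf : measurable_fun D f by exact: measurable_funS mfT.
have mfE : measurable_fun setT (EFin \o f) by exact/measurable_EFinP.
pose g_ := nnsfun_approx measurableT mfE.
have cg x : g_ n x @[n --> \oo] --> f x.
  have := @cvg_nnsfun_approx _ _ _ _ measurableT _ mfE (fun y _ => f0 y) x I.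
  by move=> /fine_cvgP[_].
have gf n x : g_ n x <= f x.
  have nd m k : (m <= k)%N -> g_ m x <= g_ k x.
    by move=> mk; exact/(lefP _ _ (nd_nnsfun_approx measurableT mfE mk)).
  rewrite -(cvg_lim _ (cg x))//; apply: limr_ge; first by apply/cvg_ex; exists (f x).
  by exists n => // k /= nk; exact: nd.
apply: (@approx_cvg (fun n => g_ n) f (fun x => f x ^+ 2)) => //.
- move=> n; have [t gE] : exists t : seq R, forall x,
      g_ n x = \sum_(y <- t) y * \1_(g_ n @^-1` [set y]) x.
    by eexists => x; rewrite {1}(fimfunE (g_ n)) fsbig_finite//.
  rewrite (_ : (g_ n : X -> R) =
    fun x => \sum_(y <- t) y * \1_(g_ n @^-1` [set y]) x); last exact/funext.
  elim: t {gE} => [|y t ih].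
    by rewrite (_ : (fun x => _) = fun=> 0); [exact: approx_cst|
      apply/funext => x; rewrite big_nil].
  rewrite (_ : (fun x => _) = fun x => y * \1_(g_ n @^-1` [set y]) x +
    \sum_(y <- t) y * \1_(g_ n @^-1` [set y]) x).
    by apply: approxD => //; apply: approxZ; exact: (proj2 (all_sets _)).
  by apply/funext => x; rewrite big_cons.
- apply/integrableP; split.
    by apply/measurable_EFinP/measurable_funX.
  by under eq_integral do rewrite gee0_abs ?lee_fin ?sqr_ge0//.
- move=> n x Dx; rewrite ler_sqr ?nnegrE ?subr_ge0//.
  by rewrite gerBl; exact: fun_ge0.
Qed.

Lemma approx_L2 f : measurable_fun setT f ->
  (\int[mu]_(x in D) ((f x) ^+ 2)%:E < +oo)%E -> ms_approx f.
Proof.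
move=> mf f2.
have mfD : measurable_fun D f by exact: measurable_funS mf.
have m2 (g : X -> R) : measurable_fun setT g ->
    measurable_fun D (fun x => (g x ^+ 2)%:E).
  by move=> mg; apply/measurable_EFinP/measurable_funX; exact: measurable_funS mg.
have lt (g : X -> R) : measurable_fun setT g -> (forall x, g x ^+ 2 <= f x ^+ 2) ->
    (\int[mu]_(x in D) ((g x) ^+ 2)%:E < +oo)%E.
  move=> mg gf; apply: le_lt_trans f2; apply: ge0_le_integral => //.
  - by move=> x _; rewrite lee_fin sqr_ge0.
  - exact: m2.
  - exact: m2.
  - by move=> x _; rewrite lee_fin.
have mp := measurable_funrpos mf; have mn := measurable_funrneg mf.
rewrite (_ : f = fun x => f^\+%R x + (-1) * f^\-%R x); last first.
  by apply/funext => x; rewrite -[in LHS](funrposBneg f) mulN1r.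
apply: approxD; last apply: approxZ.
- apply: approx_ge0 => //; apply: lt => // x.
  by rewrite /funrpos /Order.max/=; case: ifP => _; rewrite ?expr0n ?sqr_ge0.
- apply: approx_ge0 => //; apply: lt => // x.
  by rewrite /funrneg /Order.max/=; case: ifP => _; rewrite ?sqrrN ?expr0n ?sqr_ge0.
Qed.

End Density.

(** * Characters of a rectangle *)

Section Expi.
Context {R : realType}.
Local Notation nc := (@Normc.normc R).
Local Notation leb := (@lebesgue_measure R).

Lemma expiD (x y : R) : expi (x + y) = expi x * expi y.
Proof. by rewrite /expi cosD sinD; congr (_ +i* _); rewrite addrC. Qed.

Lemma expi0 : expi (0 : R) = 1.
Proof. by rewrite /expi cos0 sin0. Qed.

Lemma expiN (x : R) : expi (- x) = (expi x)^*%C.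
Proof. by rewrite /expi cosN sinN. Qed.

Lemma normc_expi (x : R) : nc (expi x) = 1.
Proof. by rewrite /= cos2Dsin2 sqrtr1. Qed.

Lemma cmeas_expi d (X : measurableType d) (D : set X) (g : X -> R) :
  measurable D -> measurable_fun D g -> cmeas D (fun x => expi (g x)).
Proof.
move=> mD mg; split => /=.
- apply: (measurableT_comp (f := @cos R)) => //.
  by apply: continuous_measurable_fun; exact: continuous_cos.
- apply: (measurableT_comp (f := @sin R)) => //.
  by apply: continuous_measurable_fun; exact: continuous_sin.
Qed.

Lemma expi_2pi_int (j : int) : expi (j%:~R * (2 * pi)) = 1 :> R[i].
Proof.
have H n : expi (n%:R * (2 * pi)) = 1 :> R[i].
  elim: n => [|n ih]; first by rewrite mul0r expi0.
  rewrite -natr1 mulrDl mul1r expiD ih mul1r /expi mulrC mulr_natr.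
  by rewrite cos2pi sin2pi.
case: j => n; first exact: H.
by rewrite NegzE mulrNz mulNr expiN H rmorph1.
Qed.

Lemma integral_cos_period (c w u T : R) (j : int) : 0 < T -> w != 0 ->
  w * T = j%:~R * (2 * pi) ->
  (\int[leb]_(x in `[u, (u + T)%R[) (cos (c + w * x)%R)%:E = 0)%E.
Proof.
move=> T0 w0 wT.
pose F x := w^-1 * sin (c + w * x).
have dF (x : R) : is_derive x 1 F (cos (c + w * x)).
  have g : is_derive x 1 (fun x : R => c + w * x) w.
    have h := is_deriveD (is_derive_cst (c : R) x 1)
      (is_deriveZ w (is_derive_id x (1 : R))).
    by apply: is_derive_eq h _; rewrite add0r /GRing.scale/= mulr1.
  have h := @is_derive1_comp R (@sin R) (fun x => c + w * x) x _ _
    (is_derive_sin (c + w * x)) g.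
  have k := is_deriveZ w^-1 h.
  by apply: is_derive_eq k _; rewrite /GRing.scale/= mulrC mulfK.
have cF : continuous F.
  move=> x; apply: differentiable_continuous; apply/derivable1_diffP.
  by have [] := dF x.
have cc : continuous (fun x : R => cos (c + w * x)).
  move=> x; apply: (@continuous_comp _ _ _ (fun x : R => c + w * x) (@cos R)).
    apply: cvgD; first exact: cvg_cst.
    by apply: cvgM; [exact: cvg_cst|exact: cvg_id].
  exact: continuous_cos.
have uT : u < u + T by rewrite ltrDl.
rewrite integral_itv_bndo_bndc; last first.
  apply/measurable_EFinP; apply: measurable_funS measurableT _ _ => //.
  exact: continuous_measurable_fun.
rewrite (@continuous_FTC2 _ _ F)//.
- rewrite -EFinB /F -mulrBr [w * (u + T)]mulrDr wT addrA.
  have -> : sin (c + w * u + j%:~R * (2 * pi)) = sin (c + w * u).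
    have := expiD (c + w * u) (j%:~R * (2 * pi)).
    by rewrite expi_2pi_int mulr1 => -[].
  by rewrite subrr mulr0.
- exact: continuous_subspaceT.
- split; first by move=> x _; have [] := dF x.
  + by apply: cvg_at_right_filter; exact: cF.
  + by apply: cvg_at_left_filter; exact: cF.
- by move=> x _; rewrite derive1E; have [_ ->] := dF x.
Qed.

(** Inside a period, the half-line is the interval centred at its midpoint [x0], on
    which the cosine of period [T] centred at [x0] exceeds its value at the ends. *)
Lemma cos_halfline (u T a x : R) (w := 2 * pi / T) (x0 := (a + u + T) / 2)
    (dl := (u + T - a) / 2) : 0 < T -> u <= a -> a < u + T -> u <= x -> x < u + T ->
  (a < x) = (cos (w * dl) < cos (w * (x - x0))).
Proof.
move=> T0 ua aT ux xT.
have p0 := @pi_gt0 R.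
have w0 : 0 < w by rewrite /w !mulr_gt0// invr_gt0.
have wT : w * T = 2 * pi by rewrite /w divfK// gt_eqF.
have wd0 : 0 <= w * dl by rewrite mulr_ge0 ?(ltW w0)// /dl; lra.
have wdpi : w * dl <= pi.
  have -> : pi = w * (T / 2) by rewrite mulrA wT; lra.
  by rewrite ler_pM2l// /dl; lra.
have inpi (y : R) : 0 <= y -> y <= pi -> y \in `[0, pi] by move=> h1 h2; rewrite in_itv/= h1 h2.
have cabs (y : R) : cos `|y| = cos y.
  by have [_|_] := ger0P y; rewrite ?cosN.
have [ax|xa] := ltP a x.
  rewrite -[cos (w * (x - x0))]cabs.
  have lt : `|w * (x - x0)| < w * dl.
    rewrite normrM (gtr0_norm w0) ltr_pM2l// ltr_norml /x0 /dl; apply/andP; split; lra.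
  have i2 : `|w * (x - x0)| \in `[0, pi].
    by apply: inpi; [exact: normr_ge0|exact: ltW (lt_le_trans lt wdpi)].
  by rewrite (ltr_cos i2 (inpi _ wd0 wdpi)) lt.
apply/esym/negbTE; rewrite -leNgt.
have le1 : w * dl <= w * (x0 - x) by rewrite ler_pM2l// /x0 /dl; lra.
have le2 : w * (x0 - x) <= 2 * pi - w * dl.
  by rewrite -wT -mulrBr ler_pM2l// /x0 /dl; lra.
rewrite -cosN -mulrN opprB.
have leC (y : R) : w * dl <= y -> y <= pi -> cos y <= cos (w * dl).
  move=> h1 h2; have y0 : 0 <= y by lra.
  by rewrite leNgt (ltr_cos (inpi _ y0 h2) (inpi _ wd0 wdpi)) -leNgt.
have [h|h] := leP (w * (x0 - x)) pi; first exact: leC.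
have -> : cos (w * (x0 - x)) = cos (2 * pi - w * (x0 - x)).
  rewrite -[in LHS]cosN.
  have := expiD (- (w * (x0 - x))) (1%:~R * (2 * pi)).
  by rewrite expi_2pi_int mulr1 mul1r [_ + 2 * pi]addrC => -[->].
by apply: leC; lra.
Qed.

End Expi.

Section Box.
Context {R : realType}.
Local Notation nc := (@Normc.normc R).
Local Notation leb := (@lebesgue_measure R).
Local Notation RR := (measurableTypeR R * measurableTypeR R)%type.
Variables (u1 u2 T1 T2 : R).
Hypotheses (T1_gt0 : 0 < T1) (T2_gt0 : 0 < T2).

Let I1 : set (measurableTypeR R) := `[u1, u1 + T1[.
Let I2 : set (measurableTypeR R) := `[u2, u2 + T2[.
Definition box : set RR := I1 `*` I2.
Local Notation mu := (leb \x leb)%E.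

Let mI1 : measurable I1. Proof. exact: measurable_itv. Qed.
Let mI2 : measurable I2. Proof. exact: measurable_itv. Qed.

Lemma measurable_box : measurable box.
Proof. exact: measurableX. Qed.
Local Notation mB := measurable_box.

Lemma measure_box : mu box = (T1 * T2)%:E.
Proof.
rewrite product_measure1E//= !lebesgue_measure_itv/= !lte_fin.
by rewrite !ltrDl T1_gt0 T2_gt0 -!EFinD -EFinM; congr (_ * _)%:E; lra.
Qed.

Lemma measure_box_fin : (mu box < +oo)%E.
Proof. by rewrite measure_box ltry. Qed.

(** Fubini, in the order suited to the direction of the vanishing integrals. *)
Lemma integral_box_eq0 (g : RR -> R) (M : R) :
  measurable_fun setT g -> (forall p, `|g p| <= M) ->
  (forall x, (\int[leb]_(t in I2) (g (x, t))%:E = 0)%E) \/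
  (forall t, (\int[leb]_(x in I1) (g (x, t))%:E = 0)%E) ->
  (\int[mu]_(p in box) (g p)%:E = 0)%E.
Proof.
move=> mg gM H.
have gi : mu.-integrable box (EFin \o g).
  apply: measurable_bounded_integrable; [exact: mB|exact: measure_box_fin| |].
  - exact: measurable_funS mg.
  - exists M; split; first exact: num_real.
    by move=> y My p _; exact: le_trans (gM p) (ltW My).
have gi' : mu.-integrable setT ((EFin \o g) \_ box).
  by apply/(integrable_restrict _ mB measurableT); rewrite setTI.
have patch1 x t : ((EFin \o g) \_ box) (x, t) =
    if x \in I1 then ((fun t => (g (x, t))%:E) \_ I2) t else 0%E.
  rewrite !patchE /box; case: ifPn => xt.
    by move: xt; rewrite inE => -[/= a b]; rewrite !mem_set.
  case: ifPn => // a; rewrite ifN//; apply: contra xt.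
  by rewrite !inE in a * => b; split.
have patch2 x t : ((EFin \o g) \_ box) (x, t) =
    if t \in I2 then ((fun x => (g (x, t))%:E) \_ I1) x else 0%E.
  rewrite !patchE /box; case: ifPn => xt.
    by move: xt; rewrite inE => -[/= a b]; rewrite !mem_set.
  case: ifPn => // a; rewrite ifN//; apply: contra xt.
  by rewrite !inE in a * => b; split.
rewrite integral_mkcond; case: H => H.
- rewrite -(integral12_prod_meas1 gi') /fubini_F.
  transitivity (\int[leb]_x (0 : \bar R))%E; last by rewrite integral0.
  apply: eq_integral => x _; under eq_integral do rewrite patch1.
  by have [_|_] := boolP (x \in I1); rewrite ?integral0// -integral_mkcond H.
- rewrite -(integral21_prod_meas1 gi') /fubini_G.
  transitivity (\int[leb]_x (0 : \bar R))%E; last by rewrite integral0.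
  apply: eq_integral => t _; under eq_integral do rewrite patch2.
  by have [_|_] := boolP (t \in I2); rewrite ?integral0// -integral_mkcond H.
Qed.

Definition char_arg (k : int * int) (p : RR) : R :=
  (p.1 : R) * (k.1%:~R * (2 * pi / T1)) + (p.2 : R) * (k.2%:~R * (2 * pi / T2)).

Definition char (k : int * int) (p : RR) : R[i] := expi (char_arg k p).

Lemma measurable_char_arg k : measurable_fun setT (char_arg k).
Proof. by apply: measurable_funD; exact: measurable_funM. Qed.

Lemma cmeas_char D k : measurable D -> cmeas D (char k).
Proof.
move=> mD; apply: cmeas_expi => //; apply: measurable_funS (measurable_char_arg k) => //.
Qed.

Lemma charD k l p : char (k + l) p = char k p * char l p.
Proof.
by rewrite /char -expiD /char_arg; congr expi; rewrite /= !intrD; ring.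
Qed.

Lemma char0 p : char 0 p = 1.
Proof. by rewrite /char /char_arg /= !mul0r !mulr0 addr0 expi0. Qed.

Lemma charN k p : char (- k) p = (char k p)^*%C.
Proof. by rewrite /char -expiN /char_arg; congr expi; rewrite /= !intrN; ring. Qed.

Lemma cL2_char k : cL2 mu box (char k).
Proof.
apply: (@cL2_bounded _ _ _ _ _ mB _ 1); first exact: measure_box_fin.
- exact: cmeas_char mB.
- by move=> p; rewrite normc_expi.
Qed.

Lemma integral_cos_char (c : R) k : k != 0 ->
  (\int[mu]_(p in box) (cos (c + char_arg k p)%R)%:E = 0)%E.
Proof.
move=> k0; have p0 : (2 * pi : R) != 0 by rewrite gt_eqF// mulr_gt0// pi_gt0.
apply: (@integral_box_eq0 _ 1).
- apply: (measurableT_comp (f := @cos R)).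
    by apply: continuous_measurable_fun; exact: continuous_cos.
  by apply: measurable_funD => //; exact: measurable_char_arg.
- by move=> p; rewrite ler_norml cos_geN1 cos_le1.
have [k2|k2] := eqVneq k.2 0; last first.
  left => x; rewrite /char_arg/=.
  rewrite -(@integral_cos_period _ (c + x * (k.1%:~R * (2 * pi / T1)))
    (k.2%:~R * (2 * pi / T2)) u2 T2 k.2)//.
  - by apply: eq_integral => t _; congr (cos _)%:E; ring.
  - by rewrite !mulf_neq0 ?intr_eq0// ?invr_eq0 ?gt_eqF// pi_gt0.
  - by rewrite -[LHS]mulrA divfK// gt_eqF.
have k1 : k.1 != 0.
  by apply: contra k0 => /eqP h; case: k k2 h => a b /= -> ->.
right => t; rewrite /char_arg/=.
rewrite -(@integral_cos_period _ (c + t * (k.2%:~R * (2 * pi / T2)))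
  (k.1%:~R * (2 * pi / T1)) u1 T1 k.1)//.
- by apply: eq_integral => x _; congr (cos _)%:E; ring.
- by rewrite !mulf_neq0 ?intr_eq0// ?invr_eq0 ?gt_eqF// pi_gt0.
- by rewrite -[LHS]mulrA divfK// gt_eqF.
Qed.

Lemma char_orthogonal k l :
  cint mu box (fun p => char k p * (char l p)^*%C) =
  if k == l then (T1 * T2)%:C else 0.
Proof.
have -> : (fun p => char k p * (char l p)^*%C) = char (k - l).
  by apply/funext => p; rewrite -charN -charD.
case: eqVneq => [->|kl].
  rewrite subrr (_ : char 0 = fun=> 1); last by apply/funext => p; exact: char0.
  rewrite /cint /= !Rintegral_cst ?mul0r ?mul1r; try exact: mB.
  by rewrite [X in fine X](_ : _ = (T1 * T2)%:E)//; exact: measure_box.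
have kl0 : k - l != 0 by rewrite subr_eq0.
rewrite /cint /Rintegral/=.
have := integral_cos_char 0 kl0; under eq_integral do rewrite add0r.
move=> ->; have := integral_cos_char (- (pi / 2)) kl0.
by under eq_integral do rewrite addrC cosBpihalf; move=> ->.
Qed.

(** Real-valued, because density is proved for real functions; the real
    and imaginary parts of a complex function are approximated separately. *)
Definition real_trig : set (RR -> R) :=
  [set q | exists s : seq (R[i] * (int * int)),
    forall p, (q p)%:C = \sum_(c <- s) c.1 * char c.2 p].

Lemma real_trig_cst c : real_trig (fun=> c).
Proof. by exists [:: (c%:C, 0)] => p; rewrite big_seq1 char0 mulr1. Qed.

Lemma real_trigD q r : real_trig q -> real_trig r ->
  real_trig (fun p => q p + r p).
Proof.
move=> [s hs] [t ht]; exists (s ++ t) => p.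
by rewrite big_cat/= -hs -ht rmorphD.
Qed.

Lemma real_trigM q r : real_trig q -> real_trig r ->
  real_trig (fun p => q p * r p).
Proof.
move=> [s hs] [t ht].
exists [seq (c.1 * d.1, c.2 + d.2) | c <- s, d <- t] => p.
rewrite rmorphM/= hs ht big_distrlr/= big_allpairs_dep/=.
by apply: eq_bigr => c _; apply: eq_bigr => d _; rewrite charD; ring.
Qed.

Lemma real_trig_cos (c : R) k : real_trig (fun p => cos (char_arg k p - c)).
Proof.
exists [:: (2^-1%:C * expi (- c), k); (2^-1%:C * expi c, - k)] => p.
rewrite big_cons big_seq1 /= charN /char -!mulrA -expiN -!expiD.
have -> : c + - char_arg k p = - (char_arg k p - c) by ring.
rewrite [- c + _]addrC expiN -mulrDr; set x := char_arg k p - c.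
by rewrite /expi; congr (_ +i* _); rewrite /=; lra.
Qed.

Lemma real_trig_measurable q : real_trig q -> measurable_fun setT q.
Proof.
move=> [s hs].
have [+ _] : cmeas setT (fun p => \sum_(c <- s) c.1 * char c.2 p).
  apply: cmeas_sum => c; apply: cmeasM; first exact: cmeas_cst.
  exact: cmeas_char.
by apply: eq_measurable_fun => p _; rewrite -hs.
Qed.

Lemma real_trig_bounded q : real_trig q -> exists M : R, forall p, `|q p| <= M.
Proof.
move=> [s hs]; exists (\sum_(c <- s) nc c.1) => p.
rewrite -normcR hs; elim: s {hs} => [|c s ih].
  by rewrite !big_nil Normc.normc0.
rewrite !big_cons; apply: le_trans (le_normcD _ _) _; rewrite lerD//.
by rewrite Normc.normcM normc_expi mulr1.
Qed.

Let approx_set_box := approx_set mu box real_trig.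
Let sigmaB : sigma_algebra setT approx_set_box.
Proof.
apply: (approx_set_sigma measurable_box measure_box_fin).
- exact: real_trig_cst.
- exact: real_trigD.
- exact: real_trigM.
- by move=> q /real_trig_measurable; exact: measurable_funS.
- exact: real_trig_bounded.
Qed.

Let threshold q (B : set RR) :
  real_trig q -> measurable B ->
  (forall x, box x -> 0 <= q x <= 1) -> (forall x, box x -> B x <-> q x < 2^-1) ->
  approx_set_box B.
Proof.
apply: (approx_set_threshold measurable_box measure_box_fin).
- exact: real_trig_cst.
- exact: real_trigD.
- exact: real_trigM.
- by move=> r /real_trig_measurable; exact: measurable_funS.
Qed.

(** The coordinate [pr] has period [T] in the character of index [k], and a half-line
    in it is cut out by a threshold on a single cosine. *)
Let halfline (pr : RR -> R) (u T : R) k a :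
  measurable_fun setT pr -> 0 < T ->
  (forall p, char_arg k p = 2 * pi / T * pr p) ->
  (forall p, box p -> u <= pr p /\ pr p < u + T) ->
  approx_set_box (pr @^-1` `]a, +oo[).
Proof.
move=> mpr T0 ark inb.
have mP : measurable (pr @^-1` `]a, +oo[).
  by rewrite -[X in measurable X]setTI; apply: mpr => //; exact: measurable_itv.
have [au|ua] := ltP a u.
  apply: (@threshold (fun=> 0)) => //; first exact: real_trig_cst.
  - by move=> p _; rewrite lexx ler01.
  - move=> p /inb[h _]; rewrite /= in_itv/= andbT invr_gt0 ltr0n.
    by split=> // _; exact: lt_le_trans h.
have [aT|Ta] := ltP a (u + T); last first.
  apply: (@threshold (fun=> 1)) => //; first exact: real_trig_cst.
  - by move=> p _; rewrite lexx ler01.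
  - move=> p /inb[_ h]; rewrite /= in_itv/= andbT; split; last by lra.
    by lra.
set w := 2 * pi / T; set x0 := (a + u + T) / 2; set dl := (u + T - a) / 2.
(* affine in the cosine, with values in [0, 1] and threshold [cos (w dl)] at 1/2 *)
apply: (@threshold (fun p => (2^-1 + cos (w * dl) / 4) +
    (- 4^-1) * cos (char_arg k p - w * x0))) => //.
- apply: real_trigD; first exact: real_trig_cst.
  by apply: real_trigM; [exact: real_trig_cst|exact: real_trig_cos].
- move=> p _; have := cos_geN1 (w * dl); have := cos_le1 (w * dl).
  have := cos_geN1 (char_arg k p - w * x0); have := cos_le1 (char_arg k p - w * x0).
  by move=> *; apply/andP; split; lra.
- move=> p /inb[h1 h2]; rewrite /= in_itv/= andbT (cos_halfline T0 ua aT h1 h2).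
  by rewrite ark -/w -mulrBr -/x0 -/dl; split; lra.
Qed.

Let coordinate (pr : RR -> measurableTypeR R) u T k :
  measurable_fun setT pr -> 0 < T ->
  (forall p, char_arg k p = 2 * pi / T * (pr p : R)) ->
  (forall p, box p -> u <= (pr p : R) /\ (pr p : R) < u + T) ->
  forall C : set (measurableTypeR R), measurable C -> approx_set_box (pr @^-1` C).
Proof.
move=> mpr T0 ark inb C mC.
have [S0 SC SU] := sigmaB.
have {mC} : (@RGenOInfty.G R).-sigma.-measurable C.
  by rewrite -RGenOInfty.measurableE.
apply: (smallest_sub (C := sigma_algebra setT)
  (X := [set C | approx_set_box (pr @^-1` C)])).
- split => /=.
  + by rewrite preimage_set0.
  + by move=> B hB; rewrite setTD preimage_setC -setTD; exact: SC.
  + by move=> B hB; rewrite preimage_bigcup; exact: SU.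
- by move=> _ [a ->]; exact: (halfline _ mpr T0 ark inb).
Qed.

Lemma approx_set_all B : measurable B -> approx_set_box B.
Proof.
rewrite measurable_prod_measurableType; apply: smallest_sub; first exact: sigmaB.
move=> _ [C mC [E mE <-]].
have -> : C `*` E = (fst @^-1` C) `&` (snd @^-1` E) by [].
have h1 : approx_set_box (fst @^-1` C).
  apply: (@coordinate fst u1 T1 (1, 0)) => //.
  - by move=> p; rewrite /char_arg /= mul0r mulr0 addr0 mul1r mulrC.
  - by move=> [x t] [h _]; have : (x : R) \in `[u1, u1 + T1[ := h; rewrite in_itv => /andP[].
have h2 : approx_set_box (snd @^-1` E).
  apply: (@coordinate snd u2 T2 (0, 1)) => //.
  - by move=> p; rewrite /char_arg /= mul0r mulr0 add0r mul1r mulrC.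
  - by move=> [x t] [_ h]; have : (t : R) \in `[u2, u2 + T2[ := h; rewrite in_itv => /andP[].
have [S0 SC SU] := sigmaB.
rewrite -[X in approx_set_box X]setCK setCI.
rewrite -setTD; apply: (SC _); rewrite -bigcup2E.
by apply: SU => -[|[|n]]; rewrite /bigcup2 /= ?S0// -setTD; exact: SC.
Qed.

(** The coefficients of the approximation of the imaginary part are multiplied by
    ['i] and appended. *)
Lemma char_dense f : cL2 mu box f -> forall e : R, 0 < e ->
  exists s : seq (R[i] * (int * int)),
  (\int[mu]_(p in box) (nc (f p - \sum_(c <- s) c.1 * char c.2 p)%R ^+ 2)%:E <= e%:E)%E.
Proof.
move=> [[mf1 mf2] fL2] e e0.
have key (g : RR -> R) :
    measurable_fun box g -> (forall p, g p ^+ 2 <= nc (f p) ^+ 2) ->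
    exists2 q, real_trig q & (\int[mu]_(p in box) ((g p - q p)%R ^+ 2)%:E <= (e / 2)%:E)%E.
  move=> mg gf.
  have mgr : measurable_fun setT (g \_ box).
    by apply/(measurable_restrictT _ _).1 => //; exact: measurable_box.
  have gr p : box p -> (g \_ box) p = g p by move=> bp; rewrite patchE mem_set.
  have g2 : (\int[mu]_(p in box) ((g \_ box) p ^+ 2)%:E < +oo)%E.
    apply: le_lt_trans fL2; apply: ge0_le_integral => //.
    - exact: measurable_box.
    - by move=> p _; rewrite lee_fin sqr_ge0.
    - by apply/measurable_EFinP/measurable_funX; exact: measurable_funS mgr.
    - by apply: measurable_normc_sqr; split.
    - by move=> p bp; rewrite lee_fin gr.
  have [_ +] := approx_L2 measurable_box real_trig_cst real_trigD real_trigM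
    (fun q hq => measurable_funS measurableT (@subsetT _ _) (real_trig_measurable hq))
    real_trig_bounded approx_set_all mgr g2.
  move=> /(_ (e / 2))[|q hq le]; first by rewrite divr_gt0.
  exists q => //; apply: le_trans le; rewrite /sqdist le_eqVlt; apply/orP; left.
  by apply/eqP; apply: eq_integral => p /[!inE] bp; rewrite gr.
have [q1 [s1 hs1] le1] : exists2 q, real_trig q &
    (\int[mu]_(p in box) ((complex.Re (f p) - q p)%R ^+ 2)%:E <= (e / 2)%:E)%E.
  by apply: key => // p; rewrite normc_sqrE lerDl sqr_ge0.
have [q2 [s2 hs2] le2] : exists2 q, real_trig q &
    (\int[mu]_(p in box) ((complex.Im (f p) - q p)%R ^+ 2)%:E <= (e / 2)%:E)%E.
  by apply: key => // p; rewrite normc_sqrE lerDr sqr_ge0.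
exists (s1 ++ [seq ('i * c.1, c.2) | c <- s2]).
have E p : nc (f p - \sum_(c <- s1 ++ [seq ('i * c.1, c.2) | c <- s2]) c.1 * char c.2 p) ^+ 2 =
    (complex.Re (f p) - q1 p) ^+ 2 + (complex.Im (f p) - q2 p) ^+ 2.
  rewrite big_cat big_map/= -hs1.
  under eq_bigr do rewrite -mulrA.
  rewrite -mulr_sumr -hs2 normc_sqrE.
  by case: (f p) => a b /=; congr (_ ^+ 2 + _ ^+ 2); ring.
under eq_integral do rewrite E EFinD.
have mq1 : measurable_fun box q1.
  by apply: measurable_funS (real_trig_measurable _) => //; exists s1.
have mq2 : measurable_fun box q2.
  by apply: measurable_funS (real_trig_measurable _) => //; exists s2.
rewrite ge0_integralD//.
- have -> : e = e / 2 + e / 2 by lra.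
  by rewrite EFinD; apply: leeD.
- exact: measurable_box.
- by move=> p _; rewrite lee_fin sqr_ge0.
- by apply/measurable_EFinP/measurable_funX/measurable_funB.
- by move=> p _; rewrite lee_fin sqr_ge0.
- by apply/measurable_EFinP/measurable_funX/measurable_funB.
Qed.

Lemma parseval_box f h : cL2 mu box f -> cL2 mu box h ->
  ((nc (cint mu box (fun p => f p * h p)%R))%:E <=
   ((T1 * T2)^-1)%:E * \esum_(k in [set: int * int])
     (nc (cint mu box (fun p => f p * (char k p)^*%C)) *
      nc (cint mu box (fun p => h p * char k p)))%:E)%E.
Proof.
apply: (parseval_le measurable_box).
- by rewrite mulr_gt0.
- exact: cL2_char.
- exact: char_orthogonal.
- exact: char_dense.
Qed.

End Box.

(** * The Fourier transform of a product *)

Section FourierTransform.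
Context {R : realType}.
Local Notation nc := (@Normc.normc R).
Local Notation leb := (@lebesgue_measure R).
Local Notation mu := (leb \x leb)%E.
Local Notation RR := (measurableTypeR R * measurableTypeR R)%type.
Implicit Types (D : set RR) (f g h : RR -> R[i]).

Definition phase (xi tau : R) (p : RR) : R := (p.1 : R) * xi + (p.2 : R) * tau.

Lemma measurable_phase xi tau : measurable_fun setT (phase xi tau).
Proof. by apply: measurable_funD; exact: measurable_funM. Qed.

Lemma cmeas_phase D xi tau : measurable D ->
  cmeas D (fun p => expi (- phase xi tau p)).
Proof.
move=> mD; apply: cmeas_expi => //; apply: measurable_funN.
exact: measurable_funS (measurable_phase xi tau).
Qed.

(** The space-time Fourier transform of the restriction of [f] to [D]. *)
Definition FT D f (xi tau : R) : R[i] :=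
  cint mu D (fun p => expi (- phase xi tau p) * f p).

Lemma cintegrable_phase D f xi tau : measurable D -> cintegrable mu D f ->
  cintegrable mu D (fun p => expi (- phase xi tau p) * f p).
Proof.
move=> mD fi; have /integrableP[_ nfi] := cintegrable_normc mD fi.
have mf : cmeas D f.
  by case: fi => f1 f2; split; apply/measurable_EFinP;
    [exact: measurable_int f1|exact: measurable_int f2].
apply: cintegrableP => //; first exact: cmeasM (cmeas_phase _ _ mD) mf.
under eq_integral do rewrite Normc.normcM normc_expi mul1r.
by move: nfi; under eq_integral do rewrite gee0_abs ?lee_fin ?normc_ge0//.
Qed.

(** Continuity under the integral sign, from which measurability in [tau] follows. *)
Lemma continuous_FT D f xi : measurable D -> cintegrable mu D f ->
  continuous (fun tau => complex.Re (FT D f xi tau)) /\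
  continuous (fun tau => complex.Im (FT D f xi tau)).
Proof.
move=> mD fi; have nfi := cintegrable_normc mD fi.
have bound (z w : R[i]) : nc w = 1 ->
    `|complex.Re (w * z)| <= nc z /\ `|complex.Im (w * z)| <= nc z.
  move=> w1; have e : nc (w * z) = nc z by rewrite Normc.normcM w1 mul1r.
  by rewrite -e normr_Re_le normr_Im_le.
have cphase (g : R -> R) p : continuous g ->
    continuous (fun tau : R => g (- phase xi tau p)).
  move=> cg x.
  apply: (@continuous_comp _ _ _ (fun tau : R => - phase xi tau p) g); last exact: cg.
  apply: cvgN; apply: cvgD; first exact: cvg_cst.
  by apply: cvgM; [exact: cvg_cst|exact: cvg_id].
have cc p := cphase (@cos R) p (@continuous_cos R).
have cs p := cphase (@sin R) p (@continuous_sin R).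
split=> x.
- have xin : x \in (`]x - 1, x + 1[%classic : set R) by rewrite inE/= in_itv/=; lra.
  apply: (@continuity_under_integral _ _ _ mu
    (fun tau p => complex.Re (expi (- phase xi tau p) * f p)) D mD (x - 1) (x + 1)
    _ _ (fun p => nc (f p)) nfi _ x xin).
  + by move=> y _; exact: (proj1 (cintegrable_phase _ _ mD fi)).
  + apply/nearW => p _ y _; have E t : complex.Re (expi (- phase xi t p) * f p) =
        cos (- phase xi t p) * complex.Re (f p) - sin (- phase xi t p) * complex.Im (f p).
      by have [_ _ -> _] := ReImE (expi (- phase xi t p)) (f p).
    rewrite (_ : (fun t => _) = fun t => cos (- phase xi t p) * complex.Re (f p) -
      sin (- phase xi t p) * complex.Im (f p)); last exact/funext.
    by apply: cvgB; apply: cvgM; [exact: cc|exact: cvg_cst|exact: cs|exact: cvg_cst].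
  + move=> y _; apply/nearW => p _.
    exact: (proj1 (bound _ _ (normc_expi _))).
- have xin : x \in (`]x - 1, x + 1[%classic : set R) by rewrite inE/= in_itv/=; lra.
  apply: (@continuity_under_integral _ _ _ mu
    (fun tau p => complex.Im (expi (- phase xi tau p) * f p)) D mD (x - 1) (x + 1)
    _ _ (fun p => nc (f p)) nfi _ x xin).
  + by move=> y _; exact: (proj2 (cintegrable_phase _ _ mD fi)).
  + apply/nearW => p _ y _; have E t : complex.Im (expi (- phase xi t p) * f p) =
        cos (- phase xi t p) * complex.Im (f p) + sin (- phase xi t p) * complex.Re (f p).
      by have [_ _ _ ->] := ReImE (expi (- phase xi t p)) (f p).
    rewrite (_ : (fun t => _) = fun t => cos (- phase xi t p) * complex.Im (f p) +
      sin (- phase xi t p) * complex.Re (f p)); last exact/funext.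
    by apply: cvgD; apply: cvgM; [exact: cc|exact: cvg_cst|exact: cs|exact: cvg_cst].
  + move=> y _; apply/nearW => p _.
    exact: (proj2 (bound _ _ (normc_expi _))).
Qed.

Lemma cmeas_FT D f xi : measurable D -> cintegrable mu D f -> cmeas setT (FT D f xi).
Proof.
by move=> mD fi; have [c1 c2] := continuous_FT xi mD fi;
  split; exact: continuous_measurable_fun.
Qed.

Lemma cL2_integrable D f : measurable D -> (mu D < +oo)%E -> cL2 mu D f ->
  cintegrable mu D f.
Proof.
move=> mD muD f2; rewrite (_ : f = fun p => f p * 1); last first.
  by apply/funext => p; rewrite mulr1.
apply: cintegrableM => //; apply: (@cL2_bounded _ _ _ _ _ mD _ 1) => //; try exact: cmeas_cst.
by move=> p; rewrite Normc.normc1.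
Qed.

(** The Parseval inequality on the strip of width [L], for functions supported in
    a bounded time window: averaging over all translates of the frequency lattice in
    time turns the sum over that lattice into an integral. *)
Lemma parseval_window (L P : R) (f h : RR -> R[i]) (D := box 0 (- P) L (P + P)) :
  0 < L -> 0 < P -> cL2 mu D f -> cL2 mu D h ->
  ((nc (cint mu D (fun p => f p * h p)%R))%:E <=
   ((2 * pi * L)^-1)%:E * \esum_(k in [set: int]) \int[leb]_tau
     (nc (FT D f (k%:~R * (2 * pi / L)) tau) *
      nc (FT D h (- (k%:~R * (2 * pi / L))) (- tau)))%:E)%E.
Proof.
move=> L0 P0 f2 h2; have T0 : 0 < P + P by lra.
have mD : measurable D by exact: measurable_box.
have muD : (mu D < +oo)%E by exact: measure_box_fin.
have p0 : 0 < 2 * pi :> R by rewrite mulr_gt0// pi_gt0.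
set w := 2 * pi / (P + P); have w0 : 0 < w by rewrite divr_gt0.
have fi := cL2_integrable mD muD f2; have hi := cL2_integrable mD muD h2.
pose G k tau : R := nc (FT D f (k%:~R * (2 * pi / L)) tau) *
      nc (FT D h (- (k%:~R * (2 * pi / L))) (- tau)).
have G0 k tau : 0 <= G k tau by rewrite mulr_ge0 ?normc_ge0.
have mG k : measurable_fun setT (G k).
  apply: measurable_funM; first exact: cmeas_normc (cmeas_FT _ mD fi).
  apply: (measurableT_comp (f := fun t => nc (FT D h (- (k%:~R * (2 * pi / L))) t))).
    exact: cmeas_normc (cmeas_FT _ mD hi).
  exact: measurable_funN.
set X := (nc (cint mu D (fun p => f p * h p)%R))%:E.
(* modulating the factors by opposite phases keeps their product and translates the
   lattice of time frequencies by [th] *)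
have step (th : R) : (X <= ((L * (P + P))^-1)%:E *
    \esum_(k in [set: int]) \esum_(j in [set: int]) (G k (th + j%:~R * w))%:E)%E.
  pose f' p := f p * expi (- phase 0 th p).
  pose h' p := h p * expi (phase 0 th p).
  have f'2 : cL2 mu D f'.
    apply: cL2_mul_unimodular => //; first exact: cmeas_phase.
    by move=> p; rewrite normc_expi.
  have h'2 : cL2 mu D h'.
    apply: cL2_mul_unimodular => //; last by move=> p; rewrite normc_expi.
    by apply: cmeas_expi => //; exact: measurable_funS (measurable_phase _ _).
  have := parseval_box (u1 := 0) (u2 := - P) L0 T0 f'2 h'2; rewrite -/D.
  have -> : cint mu D (fun p => f' p * h' p) = cint mu D (fun p => f p * h p).
    congr (cint _ _ _); apply/funext => p; rewrite /f' /h' mulrACA -expiD.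
    by rewrite addNr expi0 mulr1.
  move=> /le_trans; apply; rewrite lee_wpmul2l//.
    by rewrite lee_fin invr_ge0 mulr_ge0// ltW.
  rewrite esum_esum; last by move=> k j _ _; rewrite lee_fin.
  rewrite [leRHS](_ : _ = \esum_(k in [set: int * int]) (G k.1 (th + k.2%:~R * w))%:E)%E.
    apply: le_esum => -[k j] _; rewrite lee_fin /G /FT le_eqVlt; apply/orP; left.
    apply/eqP; congr (nc _ * nc _); congr (cint _ _ _); apply/funext => p.
    - rewrite /f' /char -expiN [RHS]mulrC -mulrA -expiD; congr (_ * expi _).
      by rewrite /char_arg /phase /=; rewrite -/w; ring.
    - rewrite /h' /char [RHS]mulrC -mulrA -expiD; congr (_ * expi _).
      by rewrite /char_arg /phase /=; rewrite -/w; ring.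
  by congr (esum _ _); apply/seteqP; split => // -[].
have mGs k j : measurable_fun setT (fun th : R => (G k (th + j%:~R * w))%:E).
  apply/measurable_EFinP; apply: measurableT_comp => //; exact: measurable_funD.
have S0 th : (0 <= \esum_(k in [set: int]) \esum_(j in [set: int]) (G k (th + j%:~R * w)%R)%:E)%E.
  by apply: esum_ge0 => k _; apply: esum_ge0 => j _; rewrite lee_fin.
have mSk k : measurable_fun setT (fun th : R =>
    \esum_(j in [set: int]) (G k (th + j%:~R * w))%:E)%E.
  by apply: measurable_esum => // j x _; rewrite lee_fin.
have mS : measurable_fun setT (fun th : R =>
    \esum_(k in [set: int]) \esum_(j in [set: int]) (G k (th + j%:~R * w))%:E)%E.
  apply: measurable_esum => //.
  by move=> k x _; apply: esum_ge0 => j _; rewrite lee_fin.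
have mI : measurable (`[0%R, w[ : set (measurableTypeR R)) by exact: measurable_itv.
have X0 : (0 <= X)%E by rewrite lee_fin normc_ge0.
have i0 : 0 <= (L * (P + P))^-1 by rewrite invr_ge0 mulr_ge0// ltW.
have avg : (\int[leb]_(th in `[0%R, w[) cst X th <=
    \int[leb]_(th in `[0%R, w[) (((L * (P + P))^-1)%:E *
    \esum_(k in [set: int]) \esum_(j in [set: int]) (G k (th + j%:~R * w)%R)%:E))%E.
  apply: ge0_le_integral => //.
  by apply: measurable_funeM; exact: measurable_funS mS.
rewrite integral_cst//= lebesgue_measure_itv/= lte_fin w0 -EFinD subr0 in avg.
rewrite ge0_integralZl_EFin// in avg; last exact: measurable_funS mS.
have tile : (\int[leb]_(th in `[0%R, w[) (\esum_(k in [set: int])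
      \esum_(j in [set: int]) (G k (th + j%:~R * w)%R)%:E) <=
    \esum_(k in [set: int]) \int[leb]_tau (G k tau)%:E)%E.
  rewrite ge0_integral_esum//; last 2 first.
  - by move=> k; exact: measurable_funS (mSk k).
  - by move=> k x _; apply: esum_ge0 => j _; rewrite lee_fin.
  apply: le_esum => k _.
  rewrite ge0_integral_esum//; last 2 first.
  - by move=> j; exact: measurable_funS (mGs k j).
  - by move=> j x _; rewrite lee_fin.
  apply: (@le_trans _ _ _ _ _ _ (esum_tiling_le w0 (f := fun x => (G k x)%:E) _ _)).
  - apply: le_esum => j _.
    rewrite -(@ge0_integral_addr _ (j%:~R * w) _ (fun x => (G k x)%:E)); last 3 first.
    + exact: measurable_itv.
    + by apply: measurable_funS measurableT _ _ => //; exact/measurable_EFinP.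
    + by move=> x _; rewrite lee_fin.
    rewrite (_ : _ @^-1` _ = `[0%R, w[%classic)//.
    apply/seteqP; split => x /=; rewrite !in_itv/= intrD; lra.
  - exact/measurable_EFinP.
  - by move=> x; rewrite lee_fin.
have i0E : (0%:E <= ((L * (P + P))^-1)%:E)%E by rewrite lee_fin.
have {tile}avg := le_trans avg (lee_wpmul2l i0E tile).
have wi0 : (0%:E <= (w^-1)%:E)%E by rewrite lee_fin invr_ge0 ltW.
have := lee_wpmul2l wi0 avg.
have wiw : ((w^-1)%:E * w%:E = 1)%E by rewrite -EFinM mulVf// gt_eqF.
have wX : ((w^-1)%:E * (X * w%:E) = X)%E.
  by rewrite [(X * _)%E]muleC muleA wiw mul1e.
rewrite wX muleA -EFinM.
have -> // : w^-1 / (L * (P + P)) = (2 * pi * L)^-1.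
have pn : (pi : R) != 0 by rewrite gt_eqF// pi_gt0.
have Ln : L != 0 by rewrite gt_eqF.
have PPn : P + P != 0 by rewrite gt_eqF.
by rewrite /w; move: (@pi R) pn => q qn; field; rewrite Ln qn PPn.
Qed.

End FourierTransform.

(** * Mixed norms *)

Section MixedNorm.
Context {R : realType}.
Local Notation leb := (@lebesgue_measure R).
Local Open Scope ereal_scope.

Lemma sqr_poweR_half (x : \bar R) : 0 <= x -> (x `^ 2^-1) ^+ 2 = x.
Proof.
case: x => [x||//] x0.
  by rewrite poweR_EFin powR12_sqrt// -EFin_expe sqr_sqrtr.
by rewrite poweRyr ?invr_eq0// expe2 mulyy.
Qed.

Lemma Lnorm2_sqr (F : R -> R) :
  ('N[leb]_2%:E[EFin \o F]) ^+ 2 = \int[leb]_t (F t ^+ 2)%:E.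
Proof.
rewrite unlock sqr_poweR_half; last by apply: integral_ge0 => t _; exact: poweR_ge0.
apply: eq_integral => t _ /=.
by rewrite (powR_mulrn 2)// real_normK ?num_real.
Qed.

(** The squared [L^2_{xi,tau}] mass, without the normalisation in [xi]. *)
Definition sqmass (F : int -> R -> R) : \bar R :=
  \esum_(k in [set: int]) \int[leb]_t (F k t ^+ 2)%:E.

Lemma sqmass_ge0 F : 0 <= sqmass F.
Proof.
by apply: esum_ge0 => k _; apply: integral_ge0 => t _; rewrite lee_fin sqr_ge0.
Qed.

Lemma L2Lnorm_sqr (lambda q : R) (F : int -> R -> R) : (0 < lambda)%R ->
  (L2Lnorm lambda q F) ^+ 2 = ((2 * pi * lambda)^-1)%:E *
    \esum_(k in [set: int]) ('N[leb]_q%:E[EFin \o F k]) ^+ 2.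
Proof.
move=> l0; rewrite /L2Lnorm sqr_poweR_half// mule_ge0//.
  by rewrite lee_fin invr_ge0 !mulr_ge0 ?pi_ge0// ltW.
by apply: esum_ge0 => k _; apply: expe_ge0; exact: Lnorm_ge0.
Qed.

Lemma L2Lnorm2_sqr (lambda : R) (F : int -> R -> R) : (0 < lambda)%R ->
  (L2Lnorm lambda 2 F) ^+ 2 = ((2 * pi * lambda)^-1)%:E * sqmass F.
Proof.
move=> l0; rewrite L2Lnorm_sqr//; congr (_ * _); apply: eq_esum => k _.
exact: Lnorm2_sqr.
Qed.

Lemma L2Lnorm_ge0 (lambda q : R) (F : int -> R -> R) : 0 <= L2Lnorm lambda q F.
Proof. exact: poweR_ge0. Qed.

Lemma sqmass_cvg0 (lambda : R) (F : nat -> int -> R -> R) : (0 < lambda)%R ->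
  L2Lnorm lambda 2 (F n) @[n --> \oo] --> 0 ->
  forall e : R, (0 < e)%R -> \forall n \near \oo, sqmass (F n) <= e%:E.
Proof.
move=> l0 /fine_cvgP[fin /cvgrPdist_lt cv] e e0.
have p0 : (0 < 2 * pi * lambda)%R by rewrite !mulr_gt0// pi_gt0.
pose d := Num.sqrt (e / (2 * pi * lambda)).
have d0 : (0 < d)%R by rewrite sqrtr_gt0 divr_gt0.
have {}cv := cv d d0; near=> n.
have finn : L2Lnorm lambda 2 (F n) \is a fin_num by near: n.
have : (`|0 - fine (L2Lnorm lambda 2 (F n))| < d)%R by near: n.
rewrite sub0r normrN ger0_norm ?fine_ge0 ?L2Lnorm_ge0// => lt.
have := L2Lnorm2_sqr (F n) l0; rewrite -(fineK finn) -EFin_expe => eq.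
have -> : sqmass (F n) = (2 * pi * lambda * fine (L2Lnorm lambda 2 (F n)) ^+ 2)%:E.
  by rewrite [RHS]EFinM eq muleA -EFinM mulfV ?gt_eqF// mul1e.
rewrite lee_fin -ler_pdivlMl// mulrC.
have <- : (d ^+ 2 = e / (2 * pi * lambda))%R.
  by rewrite sqr_sqrtr// ltW// divr_gt0.
by rewrite ler_sqr ?nnegrE ?fine_ge0 ?L2Lnorm_ge0 ?(ltW d0)// ltW.
Unshelve. all: by end_near. Qed.

(** In the product of [a + d1] and [b + d2] the cross terms are estimated by Young's
    inequality, with a small factor [c] on the square of the unperturbed function:
    mean-square closeness of the factors controls the sum of convolutions at every
    single [tau]. *)
Lemma esum_conv_perturb (a b A B d1 d2 : int -> R -> R) (c : R) (k : int) (tau : R) :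
  (0 < c)%R ->
  (forall k, measurable_fun setT (a k)) -> (forall k, measurable_fun setT (b k)) ->
  (forall k, measurable_fun setT (A k)) -> (forall k, measurable_fun setT (B k)) ->
  (forall k, measurable_fun setT (d1 k)) -> (forall k, measurable_fun setT (d2 k)) ->
  (forall k t, 0 <= a k t)%R -> (forall k t, 0 <= b k t)%R ->
  (forall k t, 0 <= A k t)%R -> (forall k t, 0 <= B k t)%R ->
  (forall k t, A k t <= a k t + d1 k t)%R -> (forall k t, B k t <= b k t + d2 k t)%R ->
  \esum_(k1 in [set: int]) convolution (A k1) (B (k - k1)%R) tau <=
  \esum_(k1 in [set: int]) convolution (a k1) (b (k - k1)%R) tau +
  (c%:E * (sqmass a + sqmass b) + (c^-1 + 1)%:E * (sqmass d1 + sqmass d2)).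
Proof.
move=> c0 ma mb mA mB md1 md2 a0 b0 A0 B0 Aad Bbd.
have ci0 : (0 < c^-1)%R by rewrite invr_gt0.
have c1 : (0 <= c^-1 + 1)%R by rewrite addr_ge0// ltW.
have ptw (x y u v x' y' : R) : (0 <= x -> 0 <= y -> 0 <= x' -> 0 <= y' ->
    x' <= x + u -> y' <= y + v -> x' * y' <= x * y +
    (c * (x ^+ 2 + y ^+ 2) + (c^-1 + 1) * (u ^+ 2 + v ^+ 2)))%R.
  move=> x0 y0 x'0 y'0 xu yv.
  apply: (@le_trans _ _ ((x + u) * (y + v)))%R; first exact: ler_pM.
  have s1 : (0 <= c^-1 * (c * y - u) ^+ 2)%R by rewrite mulr_ge0 ?sqr_ge0// ltW.
  have s2 : (0 <= c^-1 * (c * x - v) ^+ 2)%R by rewrite mulr_ge0 ?sqr_ge0// ltW.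
  have s3 := sqr_ge0 (u - v).
  have E (z t : R) : (c^-1 * (c * z - t) ^+ 2 = c * z ^+ 2 - 2 * (z * t) + c^-1 * t ^+ 2)%R.
    by field; rewrite gt_eqF.
  have e1 : (0 <= c * x ^+ 2)%R by rewrite mulr_ge0 ?sqr_ge0// ltW.
  have e2 : (0 <= c * y ^+ 2)%R by rewrite mulr_ge0 ?sqr_ge0// ltW.
  have e3 : (0 <= c^-1 * u ^+ 2)%R by rewrite mulr_ge0 ?sqr_ge0// ltW.
  have e4 : (0 <= c^-1 * v ^+ 2)%R by rewrite mulr_ge0 ?sqr_ge0// ltW.
  rewrite !E in s1 s2; rewrite !expr2 in s3 s1 s2 e1 e2 e3 e4 *.
  have := sqr_ge0 u; have := sqr_ge0 v; rewrite !expr2; lra.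
have m2 (f : R -> R) : measurable_fun setT f ->
    measurable_fun setT (fun t => (f t ^+ 2)%:E).
  by move=> mf; apply/measurable_EFinP; exact: measurable_funX.
have msub (f : R -> R) : measurable_fun setT f ->
    measurable_fun setT (fun t : R => f (tau - t)%R).
  by move=> mf; apply: measurableT_comp => //; exact: measurable_funB.
pose I (f : R -> R) : \bar R := \int[leb]_t (f t ^+ 2)%:E.
have I0 (f : R -> R) : 0 <= I f by apply: integral_ge0 => t _; rewrite lee_fin sqr_ge0.
have Isub (f : R -> R) : measurable_fun setT f -> \int[leb]_t (f (tau - t)%R ^+ 2)%:E = I f.
  move=> mf; apply: (@ge0_integral_subl _ tau (fun t : R => (f t ^+ 2)%:E) (m2 _ mf)).
  by move=> t; rewrite lee_fin sqr_ge0.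
have m2s (g : R -> R) : measurable_fun setT g ->
    measurable_fun setT (fun t : R => (g (tau - t)%R ^+ 2)%:E).
  by move=> mg; apply/measurable_EFinP; apply: measurable_funX; exact: msub.
have sq0 (f : R -> R) t : 0 <= (f t ^+ 2)%:E by rewrite lee_fin sqr_ge0.
have convk k1 : convolution (A k1) (B (k - k1)%R) tau <=
    convolution (a k1) (b (k - k1)%R) tau +
    (c%:E * (I (a k1) + I (b (k - k1)%R)) +
     (c^-1 + 1)%:E * (I (d1 k1) + I (d2 (k - k1)%R))).
  have mprod (f g : R -> R) : measurable_fun setT f -> measurable_fun setT g ->
      measurable_fun setT (fun t : R => (f t * g (tau - t)%R)%:E).
    by move=> mf mg; apply/measurable_EFinP; apply: measurable_funM => //; exact: msub.
  have msum (f g : R -> R) : measurable_fun setT f -> measurable_fun setT g ->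
      measurable_fun setT (fun t : R => (f t ^+ 2)%:E + (g (tau - t)%R ^+ 2)%:E).
    by move=> mf mg; apply: emeasurable_funD; [exact: m2|exact: m2s].
  have sum0 (f g : R -> R) t : 0 <= (f t ^+ 2)%:E + (g (tau - t)%R ^+ 2)%:E.
    by rewrite adde_ge0// lee_fin sqr_ge0.
  have Isum (f g : R -> R) (e : R) : measurable_fun setT f -> measurable_fun setT g ->
      (0 <= e)%R ->
      \int[leb]_t (e%:E * ((f t ^+ 2)%:E + (g (tau - t)%R ^+ 2)%:E)) =
      e%:E * (I f + I g).
    move=> mf mg e0; rewrite ge0_integralZl_EFin//; last exact: msum.
    rewrite ge0_integralD//; last 2 first.
    - exact: m2.
    - exact: m2s.
    by rewrite (Isub g).
  rewrite -(Isum _ _ c)// ?(ltW c0)// -(Isum _ _ (c^-1 + 1)%R)//.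
  rewrite -ge0_integralD//; last 4 first.
  - by move=> t _; rewrite mule_ge0// lee_fin ltW.
  - by apply: emeasurable_funM => //; exact: msum.
  - by move=> t _; rewrite mule_ge0// lee_fin.
  - by apply: emeasurable_funM => //; exact: msum.
  rewrite /convolution -ge0_integralD//; last 4 first.
  - by move=> t _; rewrite lee_fin mulr_ge0.
  - exact: mprod.
  - by move=> t _; rewrite adde_ge0// mule_ge0// lee_fin ltW.
  - by apply: emeasurable_funD; apply: emeasurable_funM => //; exact: msum.
  apply: ge0_le_integral => //.
  - by move=> t _; rewrite lee_fin mulr_ge0.
  - exact: mprod.
  - apply: emeasurable_funD; first exact: mprod.
    by apply: emeasurable_funD; apply: emeasurable_funM => //; exact: msum.
  - move=> t _.
    have := ptw _ _ _ _ _ _ (a0 k1 t) (b0 (k - k1)%R (tau - t)%R) (A0 k1 t)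
      (B0 (k - k1)%R (tau - t)%R) (Aad k1 t) (Bbd (k - k1)%R (tau - t)%R).
    by rewrite -lee_fin.
apply: le_trans (le_esum (fun k1 _ => convk k1)) _.
have reind (f : int -> R -> R) : \esum_(k1 in [set: int]) I (f (k - k1)%R) = sqmass f.
  exact: (esum_reflect (fun j => I (f j)) k).
have c0E : 0 <= c%:E by rewrite lee_fin ltW.
have c1E : 0 <= (c^-1 + 1)%:E by rewrite lee_fin.
have II0 (f g : R -> R) : 0 <= I f + I g by rewrite adde_ge0.
rewrite esumD; last 2 first.
- by move=> k1 _; exact: conv_ge0.
- by move=> k1 _; rewrite adde_ge0// mule_ge0.
rewrite leeD2l// esumD; last 2 first.
- by move=> k1 _; rewrite mule_ge0.
- by move=> k1 _; rewrite mule_ge0.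
rewrite !ge0_esumZl//.
have sumI (f g : int -> R -> R) : \esum_(k1 in [set: int]) (I (f k1) + I (g (k - k1)%R)) =
    sqmass f + sqmass g.
  rewrite esumD; last 2 first.
  - by move=> k1 _; exact: I0.
  - by move=> k1 _; exact: I0.
  by rewrite (reind g).
by rewrite !sumI.
Qed.

End MixedNorm.

(** * From time windows to the whole strip *)

Section Restriction.
Context d (X : measurableType d) (R : realType).
Variables (mu : {measure set X -> \bar R}).
Implicit Types (S D : set X) (f g : X -> R[i]).
Local Notation nc := (@Normc.normc R).

(** Extension by zero outside [S]. *)
Definition crestrict S f (x : X) : R[i] := if x \in S then f x else 0.

Lemma cint_crestrict S D g f : S `<=` D -> (forall x, g x = crestrict S f x) ->
  cint mu D g = cint mu S f.
Proof.
move=> SD gf.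
have E (h : R[i] -> R) : h 0 = 0 ->
    (\int[mu]_(x in D) (h (g x))%:E = \int[mu]_(x in S) (h (f x))%:E)%E.
  move=> h0; rewrite -[S in RHS](setIidr SD) integral_mkcondr.
  apply: eq_integral => x _; rewrite patchE gf /crestrict.
  by case: ifP => // _; rewrite h0.
by rewrite /cint /Rintegral (E (@complex.Re R))// (E (@complex.Im R)).
Qed.

Lemma cmeas_crestrict S f : measurable S -> cmeas S f -> cmeas setT (crestrict S f).
Proof.
move=> mS [f1 f2].
have E (h : R[i] -> R) : h 0 = 0 -> measurable_fun S (fun x => h (f x)) ->
    measurable_fun setT (fun x => h (crestrict S f x)).
  move=> h0 mh; rewrite (_ : (fun x => _) = (fun x => h (f x)) \_ S).
    by apply/(measurable_restrict _ mS measurableT); rewrite setTI.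
  by apply/funext => x; rewrite patchE /crestrict; case: ifP.
by split; apply: E.
Qed.

Lemma cL2_crestrict S D f : measurable S -> measurable D -> S `<=` D -> cL2 mu S f ->
  cL2 mu D (crestrict S f).
Proof.
move=> mS mD SD [mf f2]; split.
  have [m1 m2] := cmeas_crestrict mS mf.
  by split; [exact: measurable_funS m1|exact: measurable_funS m2].
apply: le_lt_trans f2; rewrite -[S in leRHS](setIidr SD) integral_mkcondr.
rewrite le_eqVlt; apply/orP; left; apply/eqP; apply: eq_integral => x _.
by rewrite patchE /crestrict; case: ifP => //; rewrite Normc.normc0 expr0n.
Qed.

Lemma cL2_subset S D f : measurable S -> measurable D -> S `<=` D -> cL2 mu D f ->
  cL2 mu S f.
Proof.
move=> mS mD SD [[f1 f2] fi].
have mf : cmeas S f by split; [exact: measurable_funS f1|exact: measurable_funS f2].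
split => //; apply: le_lt_trans fi; apply: ge0_subset_integral => //.
  exact: measurable_normc_sqr.
by move=> x _; exact: normc_sqr_ge0.
Qed.

(** Dominated convergence of [f] cut off to [S n]. *)
Lemma cint_exhaust (S : nat -> set X) D f (e : R) : measurable D ->
  (forall n, measurable (S n)) -> (forall n, S n `<=` D) ->
  (forall x, D x -> \forall n \near \oo, S n x) ->
  cintegrable mu D f -> 0 < e ->
  \forall n \near \oo, nc (cint mu D f - cint mu (S n) f) <= e.
Proof.
move=> mD mS SD SS [f1 f2] e0.
have e20 : 0 < e / 2 by rewrite divr_gt0.
have lim (g : X -> R) : mu.-integrable D (fun x => (g x)%:E) ->
    \forall n \near \oo, `|\int[mu]_(x in D) g x - \int[mu]_(x in S n) g x| < e / 2.
  move=> gi; suff cv : (\int[mu]_(x in S n) g x @[n --> \oo] --> \int[mu]_(x in D) g x).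
    by move/cvgrPdist_lt: cv; exact.
  apply: fine_cvg; rewrite fineK; last exact: integrable_fin_num.
  rewrite (_ : (fun n => _) = (fun n => \int[mu]_(x in D) ((fun x => (g x)%:E) \_ (S n)) x)%E); last first.
    by apply/funext => n; rewrite -integral_mkcondr setIidr.
  have /integrableP[mg _] := gi.
  apply: (@dominated_cvg _ _ _ mu D mD _ _ (fun x => `|(g x)%:E|%E)) => //.
  - by move=> n; apply/measurable_restrict => //; exact: measurable_funS mg.
  - move=> x Dx; apply: cvg_near_cst; near=> n.
    by rewrite patchE mem_set//; near: n; exact: SS.
  - exact: integrable_abse.
  - by move=> n x Dx; rewrite patchE; case: ifP => //; rewrite abse0.
near=> n; apply: le_trans (normc_le_ReIm _) _.
rewrite [e]splitr ltW// ltrD//; near: n; exact: lim.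
Unshelve. all: by end_near. Qed.

End Restriction.

Section Window.
Context {R : realType}.
Local Notation nc := (@Normc.normc R).
Local Notation leb := (@lebesgue_measure R).
Local Notation mu := (leb \x leb)%E.
Local Notation RR := (measurableTypeR R * measurableTypeR R)%type.

Lemma measurable_strip (lambda : R) (I : set R) : measurable I ->
  measurable (strip lambda I : set RR).
Proof. by move=> mI; apply: measurableX => //; exact: measurable_itv. Qed.

Lemma fourier_onE (lambda : R) (I : set R) v (xi tau : R) :
  fourier_on lambda I v xi tau = FT (strip lambda I) v xi tau.
Proof. by []. Qed.

Lemma square_integrable_cL2 (lambda : R) v : square_integrable lambda v ->
  cL2 mu (strip lambda setT) v.
Proof. by case. Qed.

(** The Parseval inequality for [v1] and [v2] times the character of frequency
    [(xi, tau)]: modulation shifts the transform of [v2], which turns the pairing of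
    transforms into a convolution. The window is open on one side in [box], so both
    functions are extended by zero to a larger one. *)
Lemma fourier_on_mul_le (lambda : R) v1 v2 (n : nat) (k : int) (tau : R)
    (V := fun v (k : int) t => nc (fourier_on lambda `[- n%:R, n%:R] v (freq lambda k) t)) :
  0 < lambda -> square_integrable lambda v1 -> square_integrable lambda v2 ->
  ((V (fun p => v1 p * v2 p)%R k tau)%:E <=
   ((2 * pi * (2 * pi * lambda))^-1)%:E *
    \esum_(k1 in [set: int]) convolution (V v1 k1) (V v2 (k - k1)%R) tau)%E.
Proof.
move=> l0 /square_integrable_cL2 v1L /square_integrable_cL2 v2L.
set S : set RR := strip lambda `[- n%:R, n%:R].
have mS : measurable S by exact: measurable_strip.
have mT : measurable (strip lambda setT : set RR) by exact: measurable_strip.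
have ST : S `<=` (strip lambda setT : set RR) by move=> x [].
have {}v1L := cL2_subset mS mT ST v1L; have {}v2L := cL2_subset mS mT ST v2L.
have p0 := @pi_gt0 R.
pose L : R := 2 * pi * lambda; pose P : R := n%:R + 1.
have L0 : 0 < L by rewrite !mulr_gt0.
have P0 : 0 < P by rewrite ltr_wpDl.
pose D : set RR := box 0 (- P) L (P + P).
have mD : measurable D by exact: measurable_box.
have SD : S `<=` D.
  move=> [x t] [/= ]; rewrite !in_itv/= => xL tn.
  by split; rewrite /= in_itv/= ?add0r//; rewrite /P; lra.
pose h2 p := v2 p * expi (- phase (freq lambda k) tau p).
have h2L : cL2 mu S h2.
  apply: cL2_mul_unimodular => //; first exact: cmeas_phase.
  by move=> p; rewrite normc_expi.
have fL := cL2_crestrict mS mD SD v1L; have hL := cL2_crestrict mS mD SD h2L.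
have fr (j : int) : j%:~R * (2 * pi / L) = freq lambda j.
  have pn : (pi : R) != 0 by rewrite gt_eqF.
  have ln : lambda != 0 by rewrite gt_eqF.
  by rewrite /freq /L; move: (@pi R) pn => q qn; field; rewrite ln qn.
have := parseval_window L0 P0 fL hL; rewrite -/D.
have -> : cint mu D (fun p => crestrict S v1 p * crestrict S h2 p) =
    FT S (fun p => v1 p * v2 p) (freq lambda k) tau.
  apply: (cint_crestrict _ SD) => p; rewrite /crestrict.
  by case: ifP => _; [rewrite /h2; ring|rewrite mulr0].
move=> H; apply: (le_trans H) => {H}; apply: lee_wpmul2l.
  by rewrite lee_fin invr_ge0 !mulr_ge0// ltW.
apply: le_esum => j _; rewrite /convolution le_eqVlt; apply/orP; left; apply/eqP.
apply: eq_integral => t _; rewrite fr /V !fourier_onE -freqB.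
congr (nc _ * nc _)%:E; apply: (cint_crestrict _ SD) => p; rewrite /crestrict.
  by case: ifP => _; rewrite ?mulr0.
case: ifP => _; rewrite ?mulr0// /h2 mulrCA [RHS]mulrC -expiD; congr (_ * expi _).
by rewrite /phase; lra.
Qed.

Lemma window_lty (lambda : R) (n : nat) : (mu (strip lambda `[(- n%:R)%R, n%:R%R] : set RR) < +oo)%E.
Proof.
rewrite /strip product_measure1E//=; try exact: measurable_itv.
by rewrite !lebesgue_measure_itv/=; do 2!case: ifP => _;
  rewrite ?mule0 ?mul0e// -?EFinD -?EFinM ltry.
Qed.

Lemma cmeas_fourier_on (lambda : R) (n : nat) v xi : square_integrable lambda v ->
  cmeas setT (fourier_on lambda `[- n%:R, n%:R] v xi).
Proof.
move=> /square_integrable_cL2 vL.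
have mS : measurable (strip lambda `[- n%:R, n%:R] : set RR) by exact: measurable_strip.
apply: (cmeas_FT xi mS); apply: cL2_integrable => //; first exact: window_lty.
by apply: cL2_subset vL => //; [exact: measurable_strip|move=> x []].
Qed.

Lemma cintegrable_mul (lambda : R) v1 v2 :
  square_integrable lambda v1 -> square_integrable lambda v2 ->
  cintegrable mu (strip lambda setT) (fun p => v1 p * v2 p).
Proof.
move=> /square_integrable_cL2 v1L /square_integrable_cL2 v2L.
by apply: cintegrableM => //; exact: measurable_strip.
Qed.

Lemma is_fourier_L2_cmeas (lambda : R) v V (k : int) : is_fourier_L2 lambda v V ->
  cmeas setT (V k).
Proof. by case=> _ mR mI _; split; [exact: mR|exact: mI]. Qed.

(** The limit of [fourier_on_mul_le] over growing windows. The left-hand side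
    converges because [v1 v2] is integrable; on the right only mean-square convergence
    is known, which [esum_conv_perturb] converts into a bound at each [tau]. *)
Lemma fourier_mul_le (lambda : R) v1 v2 (V1 V2 : int -> R -> R[i]) (k : int) (tau : R)
    (A := fun (V : int -> R -> R[i]) k t => nc (V k t)) :
  0 < lambda -> is_fourier_L2 lambda v1 V1 -> is_fourier_L2 lambda v2 V2 ->
  (sqmass (A V1) < +oo)%E -> (sqmass (A V2) < +oo)%E ->
  ((nc (fourier lambda (fun p => v1 p * v2 p)%R (freq lambda k) tau))%:E <=
   ((2 * pi * (2 * pi * lambda))^-1)%:E *
    \esum_(k1 in [set: int]) convolution (A V1 k1) (A V2 (k - k1)%R) tau)%E.
Proof.
move=> l0 V1F V2F V1y V2y.
have mV1 j := is_fourier_L2_cmeas j V1F; have mV2 j := is_fourier_L2_cmeas j V2F.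
have [sq1 _ _ cv1] := V1F; have [sq2 _ _ cv2] := V2F.
set c0 : R := (2 * pi * (2 * pi * lambda))^-1.
have c0_gt0 : 0 < c0 by rewrite invr_gt0 !mulr_gt0 ?pi_gt0.
have [m mE] : exists m : R, (sqmass (A V1) + sqmass (A V2) = m%:E)%E.
  exists (fine (sqmass (A V1) + sqmass (A V2))%E); rewrite fineK//.
  by rewrite ge0_fin_numE ?adde_ge0 ?sqmass_ge0// lte_add_pinfty.
have m0 : 0 <= m by rewrite -lee_fin -mE adde_ge0 ?sqmass_ge0.
apply/lee_addgt0Pr => e e0.
(* [c] is the loss in Young's inequality, [d] the perturbation then admissible *)
pose c := e / 3 / (c0 * m + 1).
have cm0 : 0 < c0 * m + 1 by rewrite ltr_wpDl// mulr_ge0// ltW.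
have c_gt0 : 0 < c by rewrite !divr_gt0.
pose d := e / 3 / (c0 * (c^-1 + 1) * 2).
have ci0 : 0 < c^-1 by rewrite invr_gt0.
have d_gt0 : 0 < d by rewrite !divr_gt0// !mulr_gt0// addr_gt0.
pose S (n : nat) : set RR := strip lambda `[- n%:R, n%:R].
have mT : measurable (strip lambda setT : set RR) by exact: measurable_strip.
have gi : cintegrable mu (strip lambda setT)
    (fun p => expi (- phase (freq lambda k) tau p) * (v1 p * v2 p)).
  by apply: cintegrable_phase => //; exact: cintegrable_mul.
have e30 : 0 < e / 3 by rewrite divr_gt0.
have tail : \forall n \near \oo, nc (fourier lambda (fun p => v1 p * v2 p) (freq lambda k) tau -
    fourier_on lambda `[- n%:R, n%:R] (fun p => v1 p * v2 p) (freq lambda k) tau) <= e / 3.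
  apply: (@cint_exhaust _ _ _ mu S _ _ _ mT _ _ _ gi e30).
  - by move=> n; exact: measurable_strip.
  - by move=> n x [].
  - move=> [x t] [/= xL _]; have := nbhs_infty_ger `|t|; apply: filterS => n tn.
    by split => //=; rewrite in_itv/= -ler_norml.
have n1 := sqmass_cvg0 l0 cv1 d_gt0; have n2 := sqmass_cvg0 l0 cv2 d_gt0.
have [n _ /(_ n (leqnn n))[{}tail [dl1 dl2]]] := filterI tail (filterI n1 n2).
pose B (v : R * R -> R[i]) (k : int) t :=
  nc (fourier_on lambda `[- n%:R, n%:R] v (freq lambda k) t).
pose dl (v : R * R -> R[i]) (V : int -> R -> R[i]) (k : int) t :=
  nc (fourier_on lambda `[- n%:R, n%:R] v (freq lambda k) t - V k t).
have mB v j : square_integrable lambda v -> measurable_fun setT (B v j).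
  by move=> vL; apply: cmeas_normc; exact: cmeas_fourier_on.
have mdl v V j : square_integrable lambda v -> (forall j, cmeas setT (V j)) ->
    measurable_fun setT (dl v V j).
  move=> vL mV; apply: cmeas_normc.
  rewrite (_ : (fun t => _) = (fun t : R =>
    fourier_on lambda `[- n%:R, n%:R] v (freq lambda j) t + (- 1) * V j t)); last first.
    by apply/funext => t; rewrite mulN1r.
  apply: cmeasD; first exact: cmeas_fourier_on.
  by apply: cmeasM => //; exact: cmeas_cst.
have BA v V j t : B v j t <= A V j t + dl v V j t.
  rewrite /B /A /dl -[X in nc X <= _](subrK (V j t)) addrC [leRHS]addrC addrC.
  exact: le_normcD.
have main := fourier_on_mul_le n k tau l0 sq1 sq2.
have pert := @esum_conv_perturb R (A V1) (A V2) (B v1) (B v2) (dl v1 V1) (dl v2 V2)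
  c k tau c_gt0 (fun j => cmeas_normc (mV1 j)) (fun j => cmeas_normc (mV2 j)) (fun j => mB v1 j sq1) (fun j => mB v2 j sq2)
  (fun j => mdl v1 V1 j sq1 mV1) (fun j => mdl v2 V2 j sq2 mV2)
  (fun j t => normc_ge0 _) (fun j t => normc_ge0 _) (fun j t => normc_ge0 _)
  (fun j t => normc_ge0 _) (BA v1 V1) (BA v2 V2).
set Sig := (\esum_(k1 in _) convolution (A V1 k1) _ _)%E in pert *.
have Sig0 : (0 <= Sig)%E.
  by apply: esum_ge0 => j _; apply: conv_ge0 => t; exact: normc_ge0.
have {}main : ((nc (fourier_on lambda `[- n%:R, n%:R] (fun p => v1 p * v2 p)
    (freq lambda k) tau))%:E <= c0%:E * Sig + (e / 3 + e / 3)%:E)%E.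
  apply: (le_trans main); apply: (@le_trans _ _ (c0%:E * (Sig +
     (c%:E * m%:E + (c^-1 + 1)%:E * (d + d)%:E)))%E).
    apply: lee_wpmul2l; first by rewrite lee_fin ltW.
    apply: (le_trans pert); rewrite mE leeD2l// leeD2l//.
    by apply: lee_wpmul2l; [rewrite lee_fin addr_ge0// ltW|rewrite EFinD leeD].
  rewrite -!EFinM -EFinD ge0_muleDr//; last first.
    by rewrite lee_fin addr_ge0// mulr_ge0// ?addr_ge0// ltW.
  rewrite leeD2l// -EFinM lee_fin mulrDr lerD//.
    have -> : c0 * (c * m) = e / 3 * (c0 * m / (c0 * m + 1)) by rewrite /c; ring.
    by rewrite ler_piMr// ?(ltW e30)// ler_pdivrMr// mul1r lerDl.
  have -> : c0 * ((c^-1 + 1) * (d + d)) = c0 * (c^-1 + 1) * 2 * d by ring.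
  by rewrite /d mulrC divfK// gt_eqF// !mulr_gt0// addr_gt0.
have := le_normcD (fourier lambda (fun p => v1 p * v2 p) (freq lambda k) tau -
    fourier_on lambda `[- n%:R, n%:R] (fun p => v1 p * v2 p) (freq lambda k) tau)
  (fourier_on lambda `[- n%:R, n%:R] (fun p => v1 p * v2 p) (freq lambda k) tau).
rewrite subrK => tri.
apply: (@le_trans _ _ ((e / 3)%:E + (c0%:E * Sig + (e / 3 + e / 3)%:E))%E).
  apply: (@le_trans _ _ ((e / 3)%:E + (nc (fourier_on lambda `[- n%:R, n%:R]
    (fun p => v1 p * v2 p) (freq lambda k) tau))%:E)%E); last exact: leeD2l.
  by rewrite -EFinD lee_fin (le_trans tri)// lerD2r.
rewrite addeCA -EFinD leeD2l// lee_fin; lra.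
Qed.

End Window.

(** * The bilinear estimate on the Fourier side *)

Section Weights.
Context {R : realType}.
Implicit Types (alpha s xi x y z : R).

Lemma sqrt_le_add3 (h x y z : R) : 0 <= h -> 0 <= x -> 0 <= y -> 0 <= z -> h <= x + y + z ->
  h `^ 2^-1 <= x `^ 2^-1 + y `^ 2^-1 + z `^ 2^-1.
Proof.
move=> h0 x0 y0 z0 hxyz; rewrite !powR12_sqrt//.
rewrite -ler_sqr ?nnegrE ?addr_ge0 ?sqrtr_ge0// sqr_sqrtr//.
have := sqr_sqrtr x0; have := sqr_sqrtr y0; have := sqr_sqrtr z0.
have := sqrtr_ge0 x; have := sqrtr_ge0 y; have := sqrtr_ge0 z.
move: (Num.sqrt x) (Num.sqrt y) (Num.sqrt z) => a b c c0 b0 a0 ea eb ec.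
have := mulr_ge0 a0 b0; have := mulr_ge0 a0 c0; have := mulr_ge0 b0 c0.
rewrite !expr2 in ea eb ec *; lra.
Qed.

(** The resonance is the modulation of the output minus those of the inputs. *)
Lemma bracket_resonance_le alpha xi xi1 tau t :
  bracket (resonance alpha xi xi1) `^ 2^-1 <=
  bracket (tau - 1 * xi ^+ 3) `^ 2^-1 + bracket (t - alpha * xi1 ^+ 3) `^ 2^-1 +
  bracket (tau - t - alpha * (xi - xi1) ^+ 3) `^ 2^-1.
Proof.
apply: sqrt_le_add3; rewrite ?bracket_ge0//.
have -> : resonance alpha xi xi1 = (tau - 1 * xi ^+ 3) + (- (t - alpha * xi1 ^+ 3) +
    - (tau - t - alpha * (xi - xi1) ^+ 3)) by rewrite /resonance; ring.
apply: le_trans (bracketD _ _) _; rewrite -[leRHS]addrA lerD2l.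
by apply: le_trans (bracketD _ _) _; rewrite !bracketN.
Qed.

(** The half power of the resonance taken out in [mult] is returned by one of the
    three modulations: in each term of the right-hand side exactly one of the
    output and the two inputs carries its modulation weight. *)
Lemma symbol_le alpha s xi xi1 tau t (n1 n2 : R)
    (p := bracket (tau - 1 * xi ^+ 3)) (q := bracket (t - alpha * xi1 ^+ 3))
    (r := bracket (tau - t - alpha * (xi - xi1) ^+ 3))
    (v1 := bracket xi1 `^ s * n1) (v2 := bracket (xi - xi1) `^ s * n2) :
  0 <= n1 -> 0 <= n2 ->
  `|xi| * bracket xi `^ s * (n1 * n2) <= mult alpha s xi xi1 *
   (p `^ 2^-1 * (v1 * v2) + (q `^ 2^-1 * v1) * v2 + v1 * (r `^ 2^-1 * v2)).
Proof.
move=> n10 n20.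
have h0 : 0 < bracket (resonance alpha xi xi1) := bracket_gt0 _.
have b1 : 0 < bracket xi1 `^ s by rewrite powR_gt0 ?bracket_gt0.
have b2 : 0 < bracket (xi - xi1) `^ s by rewrite powR_gt0 ?bracket_gt0.
have hh : bracket (resonance alpha xi xi1) `^ (- 2^-1) *
   bracket (resonance alpha xi xi1) `^ 2^-1 = 1.
  by rewrite powRN mulVf// gt_eqF ?powR_gt0.
have v10 : 0 <= v1 by rewrite mulr_ge0// ltW.
have v20 : 0 <= v2 by rewrite mulr_ge0// ltW.
have -> : `|xi| * bracket xi `^ s * (n1 * n2) = mult alpha s xi xi1 *
    (bracket (resonance alpha xi xi1) `^ 2^-1 * (v1 * v2)).
  rewrite /mult /v1 /v2; move: (_ `^ (- 2^-1)) (_ `^ 2^-1) hh => g h gh.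
  move: (bracket xi1 `^ s) (bracket (xi - xi1) `^ s) b1 b2 => x y x0 y0.
  transitivity (g * h * (`|xi| * bracket xi `^ s * (n1 * n2))); first by rewrite gh mul1r.
  by field; rewrite !gt_eqF.
rewrite ler_wpM2l ?mult_ge0//.
have -> : p `^ 2^-1 * (v1 * v2) + q `^ 2^-1 * v1 * v2 + v1 * (r `^ 2^-1 * v2) =
  (p `^ 2^-1 + q `^ 2^-1 + r `^ 2^-1) * (v1 * v2) by ring.
by apply: ler_wpM2r; [exact: mulr_ge0|exact: bracket_resonance_le].
Qed.

End Weights.

Section Bilinear.
Context {R : realType}.
Local Notation leb := (@lebesgue_measure R).
Local Open Scope ereal_scope.

Lemma sqreD_le (x y : \bar R) : 0 <= x -> 0 <= y ->
  (x + y) ^+ 2 <= 2%:E * (x ^+ 2 + y ^+ 2).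
Proof.
have y2 : +oo ^+ 2 = +oo :> \bar R by rewrite expe2 mulyy.
case: x => [x| |]// x0; case: y => [y| |]// y0; last 3 first.
- by rewrite y2 addey// gt0_muley// leey.
- by rewrite y2 addye// gt0_muley// leey.
- by rewrite [leRHS](_ : _ = +oo) ?leey// y2 addye// gt0_muley.
rewrite -EFinD -!EFin_expe -EFinD -EFinM lee_fin.
by have := sqr_ge0 (x - y); rewrite !expr2; lra.
Qed.

Lemma esum_esum_conv (a b : int -> R) (A B : R) :
  (forall k, 0 <= a k)%R -> (forall k, 0 <= b k)%R ->
  \esum_(k in [set: int]) (a k)%:E <= A%:E -> \esum_(k in [set: int]) (b k)%:E <= B%:E ->
  \esum_(k in [set: int]) \esum_(k1 in [set: int]) (a k1 * b (k - k1))%:E <= (A * B)%:E.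
Proof.
move=> a0 b0 aA bB.
have ab0 (k k1 : int) : 0 <= (a k1 * b (k - k1)%R)%:E by rewrite lee_fin mulr_ge0.
rewrite esum_esum//.
have bij : set_bij [set: int * int] ([set: int] `*`` (fun=> [set: int]))
    (fun p => (p.1 + p.2, p.1)%R).
  split => //= [[x1 x2] [y1 y2] _ _ /= [e1 e2]|[x y] _].
    by move: e1; rewrite e2 => /addrI ->.
  by exists (y, x - y)%R => //=; rewrite addrC subrK.
rewrite (reindex_esum _ _ _ _ bij)/=.
have -> : \esum_(p in [set: int * int]) (a p.1 * b (p.1 + p.2 - p.1)%R)%:E =
    \esum_(k in [set: int]) \esum_(j in [set: int]) (a k * b j)%:E.
  rewrite esum_esum; last by move=> i j _ _; rewrite lee_fin mulr_ge0.
  rewrite (_ : [set: int] `*`` (fun=> [set: int]) = [set: int * int]); last first.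
    by apply/seteqP; split => // -[].
  by apply: eq_esum => p _; rewrite addrAC subrr add0r.
have B0 : 0 <= \esum_(j in [set: int]) (b j)%:E.
  by apply: esum_ge0 => j _; rewrite lee_fin.
have -> : \esum_(k in [set: int]) \esum_(j in [set: int]) (a k * b j)%:E =
    (\esum_(j in [set: int]) (b j)%:E) * \esum_(k in [set: int]) (a k)%:E.
  rewrite -ge0_esumZl//; apply: eq_esum => k _.
  by rewrite muleC -ge0_esumZl// ?lee_fin.
rewrite muleC EFinM; apply: lee_pmul => //.
by apply: esum_ge0 => j _; rewrite lee_fin.
Qed.

Lemma conv_le_comb (x c1 c2 c3 : R) (n1 n2 f1 f2 v1 v2 : R -> R) (tau : R) :
  (0 <= x)%R -> (0 <= c1)%R -> (0 <= c2)%R -> (0 <= c3)%R ->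
  measurable_fun setT n1 -> measurable_fun setT n2 -> measurable_fun setT f1 ->
  measurable_fun setT f2 -> measurable_fun setT v1 -> measurable_fun setT v2 ->
  (forall t, 0 <= n1 t)%R -> (forall t, 0 <= n2 t)%R -> (forall t, 0 <= f1 t)%R ->
  (forall t, 0 <= f2 t)%R -> (forall t, 0 <= v1 t)%R -> (forall t, 0 <= v2 t)%R ->
  (forall t, x * (n1 t * n2 (tau - t)) <= c1 * (f1 t * v2 (tau - t)) +
    c2 * (v1 t * f2 (tau - t)) + c3 * (v1 t * v2 (tau - t)))%R ->
  x%:E * convolution n1 n2 tau <= c1%:E * convolution f1 v2 tau +
    c2%:E * convolution v1 f2 tau + c3%:E * convolution v1 v2 tau.
Proof.
move=> x0 c10 c20 c30 mn1 mn2 mf1 mf2 mv1 mv2 n10 n20 f10 f20 v10 v20 H.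
have msub (f : R -> R) : measurable_fun setT f ->
    measurable_fun setT (fun t : R => f (tau - t)%R).
  by move=> mf; apply: measurableT_comp => //; exact: measurable_funB.
have mprod (f g : R -> R) : measurable_fun setT f -> measurable_fun setT g ->
    measurable_fun setT (fun t : R => (f t * g (tau - t)%R)%:E).
  by move=> mf mg; apply/measurable_EFinP; apply: measurable_funM => //; exact: msub.
have p0 (f g : R -> R) t : (forall t, 0 <= f t)%R -> (forall t, 0 <= g t)%R ->
    0 <= (f t * g (tau - t)%R)%:E by move=> f0 g0; rewrite lee_fin mulr_ge0.
have Z (c : R) (f g : R -> R) : (0 <= c)%R -> measurable_fun setT f ->
    measurable_fun setT g -> (forall t, 0 <= f t)%R -> (forall t, 0 <= g t)%R ->
    c%:E * convolution f g tau = \int[leb]_t (c%:E * (f t * g (tau - t)%R)%:E).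
  move=> c0 mf mg f0 g0; rewrite ge0_integralZl_EFin//.
  - by move=> t _; exact: p0.
  - exact: mprod.
rewrite !Z//.
have mZ (c : R) (f g : R -> R) : measurable_fun setT f -> measurable_fun setT g ->
    measurable_fun setT (fun t : R => c%:E * (f t * g (tau - t)%R)%:E).
  by move=> mf mg; apply: emeasurable_funM => //; exact: mprod.
have Z0 (c : R) (f g : R -> R) t : (0 <= c)%R -> (forall t, 0 <= f t)%R ->
    (forall t, 0 <= g t)%R -> 0 <= c%:E * (f t * g (tau - t)%R)%:E.
  by move=> c0 f0 g0; rewrite mule_ge0 ?p0.
rewrite -ge0_integralD//; last 4 first.
- by move=> t _; exact: Z0.
- exact: mZ.
- by move=> t _; exact: Z0.
- exact: mZ.
rewrite -ge0_integralD//; last 4 first.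
- by move=> t _; rewrite adde_ge0// Z0.
- by apply: emeasurable_funD; exact: mZ.
- by move=> t _; exact: Z0.
- exact: mZ.
apply: ge0_le_integral => //.
- by move=> t _; exact: Z0.
- exact: mZ.
- by apply: emeasurable_funD; [apply: emeasurable_funD|]; exact: mZ.
- by move=> t _; have := H t; rewrite -lee_fin.
Qed.

Lemma lee_sqre (x y : \bar R) : 0 <= x -> x <= y -> x ^+ 2 <= y ^+ 2.
Proof. by move=> x0 xy; rewrite !expe2 lee_pmul. Qed.

Lemma sqreM (x y : \bar R) : (x * y) ^+ 2 = x ^+ 2 * y ^+ 2.
Proof. by rewrite !expe2 muleACA. Qed.

(** In this section [v1] and [v2] stand for the inputs with their Sobolev weight, and
    [f1] and [f2] for the same with the modulation weight as well; the [f] are measured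
    in [L^2], with squared norms [a], and the [v] in [L^1], with norms [b]. *)
Section MixedConvolution.
Variables (f1 f2 v1 v2 : int -> R -> R) (a1 a2 b1 b2 : int -> R).
Variables (m : int -> int -> R) (M c0 S1 S2 : R).
Hypotheses (mf1 : forall k, measurable_fun setT (f1 k))
  (mf2 : forall k, measurable_fun setT (f2 k))
  (mv1 : forall k, measurable_fun setT (v1 k))
  (mv2 : forall k, measurable_fun setT (v2 k)).
Hypotheses (f10 : forall k t, (0 <= f1 k t)%R) (f20 : forall k t, (0 <= f2 k t)%R)
  (v10 : forall k t, (0 <= v1 k t)%R) (v20 : forall k t, (0 <= v2 k t)%R).
Hypotheses (f1a : forall k, \int[leb]_t (f1 k t ^+ 2)%:E = (a1 k)%:E)
  (f2a : forall k, \int[leb]_t (f2 k t ^+ 2)%:E = (a2 k)%:E)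
  (v1b : forall k, \int[leb]_t (v1 k t)%:E = (b1 k)%:E)
  (v2b : forall k, \int[leb]_t (v2 k t)%:E = (b2 k)%:E).
Hypotheses (aS1 : \esum_(k in [set: int]) (a1 k)%:E <= S1%:E)
  (aS2 : \esum_(k in [set: int]) (a2 k)%:E <= S2%:E)
  (bS1 : \esum_(k in [set: int]) (b1 k ^+ 2)%:E <= S1%:E)
  (bS2 : \esum_(k in [set: int]) (b2 k ^+ 2)%:E <= S2%:E).
Hypotheses (m0 : forall k k1, (0 <= m k k1)%R) (M0 : (0 < M)%R) (c0_ge0 : (0 <= c0)%R)
  (mM : forall k, \esum_(k1 in [set: int]) (m k k1 ^+ 2)%:E <= M%:E).

Let a10 k : (0 <= a1 k)%R.
Proof. by rewrite -lee_fin -f1a integral_ge0// => t _; rewrite lee_fin sqr_ge0. Qed.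

Let a20 k : (0 <= a2 k)%R.
Proof. by rewrite -lee_fin -f2a integral_ge0// => t _; rewrite lee_fin sqr_ge0. Qed.

Let G k k1 : R := (a1 k1 * b2 (k - k1) ^+ 2 + b1 k1 ^+ 2 * a2 (k - k1) +
  b1 k1 ^+ 2 * b2 (k - k1) ^+ 2)%R.

Let esumG : \esum_(k in [set: int]) \esum_(k1 in [set: int]) (G k k1)%:E <=
  (3 * (S1 * S2))%:E.
Proof.
have esumD3 (x y z : int -> \bar R) : (forall k, 0 <= x k) -> (forall k, 0 <= y k) ->
    (forall k, 0 <= z k) -> \esum_(k in [set: int]) (x k + y k + z k) =
    \esum_(k in [set: int]) x k + \esum_(k in [set: int]) y k + \esum_(k in [set: int]) z k.
  by move=> x0 y0 z0; rewrite esumD ?esumD// => k _; rewrite adde_ge0.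
pose b12 k : R := (b1 k ^+ 2)%R; pose b22 k : R := (b2 k ^+ 2)%R.
have b120 k : (0 <= b12 k)%R by exact: sqr_ge0.
have b220 k : (0 <= b22 k)%R by exact: sqr_ge0.
have e0 (a b : int -> R) k : (forall k, 0 <= a k)%R -> (forall k, 0 <= b k)%R ->
    0 <= \esum_(k1 in [set: int]) (a k1 * b (k - k1)%R)%:E.
  by move=> a0 b0; apply: esum_ge0 => k1 _; rewrite lee_fin mulr_ge0.
have -> : \esum_(k in [set: int]) \esum_(k1 in [set: int]) (G k k1)%:E =
    \esum_(k in [set: int]) \esum_(k1 in [set: int]) (a1 k1 * b22 (k - k1))%:E +
    \esum_(k in [set: int]) \esum_(k1 in [set: int]) (b12 k1 * a2 (k - k1))%:E +
    \esum_(k in [set: int]) \esum_(k1 in [set: int]) (b12 k1 * b22 (k - k1))%:E.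
  rewrite -esumD3; [|by move=> k; exact: e0..].
  apply: eq_esum => k _; rewrite -esumD3//; by move=> k1; rewrite lee_fin mulr_ge0.
rewrite [leRHS](_ : _ = (S1 * S2)%:E + (S1 * S2)%:E + (S1 * S2)%:E); last first.
  by rewrite -!EFinD; congr _%:E; lra.
by apply: leeD; [apply: leeD|]; exact: esum_esum_conv.
Qed.

Let cMe (x : \bar R) : (c0 ^+ 2 * M)%:E * x = c0%:E ^+ 2 * (M%:E * x).
Proof. by rewrite EFinM EFin_expe muleA. Qed.

(* [8 G] covers the squares of sums of two or three convolutions below, and
   [24 = 8 * 3] accounts for the three terms of [G] *)
Let sum_bound (X : int -> \bar R) (Q2 : int -> int -> \bar R) :
  (forall k, X k <= (c0 ^+ 2 * M)%:E * \esum_(k1 in [set: int]) Q2 k k1) ->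
  (forall k k1, Q2 k k1 <= (8 * G k k1)%:E) ->
  \esum_(k in [set: int]) X k <= (c0 ^+ 2 * M * (24 * (S1 * S2)))%:E.
Proof.
move=> XQ QG.
have G0 k k1 : 0 <= (G k k1)%:E by rewrite lee_fin !addr_ge0// mulr_ge0 ?sqr_ge0.
have cM : (0 <= c0 ^+ 2 * M)%R by rewrite mulr_ge0 ?sqr_ge0// ltW.
have -> : (c0 ^+ 2 * M * (24 * (S1 * S2)) =
    (c0 ^+ 2 * M) * (8 * (3 * (S1 * S2))))%R by ring.
apply: (@le_trans _ _ ((c0 ^+ 2 * M)%:E * (8%:E *
    \esum_(k in [set: int]) \esum_(k1 in [set: int]) (G k k1)%:E))).
  have SG0 k : 0 <= \esum_(k1 in [set: int]) (G k k1)%:E by exact: esum_ge0.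
  rewrite -!ge0_esumZl ?lee_fin//; last by move=> k; rewrite mule_ge0.
  apply: le_esum => k _; apply: (le_trans (XQ k)); apply: lee_wpmul2l; first by rewrite lee_fin.
  by rewrite -ge0_esumZl//; apply: le_esum => k1 _; rewrite -EFinM; exact: QG.
rewrite [leRHS]EFinM; apply: lee_wpmul2l; first by rewrite lee_fin.
by rewrite [leRHS]EFinM; exact: lee_wpmul2l.
Qed.

Let C12 k k1 t := convolution (f1 k1) (v2 (k - k1)%R) t.
Let C21 k k1 t := convolution (v1 k1) (f2 (k - k1)%R) t.
Let C11 k k1 t := convolution (v1 k1) (v2 (k - k1)%R) t.

Let C12_0 k k1 t : 0 <= C12 k k1 t. Proof. exact: conv_ge0. Qed.
Let C21_0 k k1 t : 0 <= C21 k k1 t. Proof. exact: conv_ge0. Qed.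
Let C11_0 k k1 t : 0 <= C11 k k1 t. Proof. exact: conv_ge0. Qed.
Let mC12 k k1 : measurable_fun setT (C12 k k1). Proof. exact: measurable_conv. Qed.
Let mC21 k k1 : measurable_fun setT (C21 k k1). Proof. exact: measurable_conv. Qed.
Let mC11 k k1 : measurable_fun setT (C11 k k1). Proof. exact: measurable_conv. Qed.

Let I12 k k1 : \int[leb]_t (C12 k k1 t) ^+ 2 <= (a1 k1 * b2 (k - k1) ^+ 2)%:E.
Proof.
apply: (le_trans (young_L2_L1 (mf1 k1) (mv2 _) (f10 k1) (v20 _) (v2b _))).
by rewrite f1a -EFinM mulrC.
Qed.

Let I21 k k1 : \int[leb]_t (C21 k k1 t) ^+ 2 <= (b1 k1 ^+ 2 * a2 (k - k1))%:E.
Proof.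
have -> : \int[leb]_t (C21 k k1 t) ^+ 2 =
    \int[leb]_t (convolution (f2 (k - k1)%R) (v1 k1) t) ^+ 2.
  by apply: eq_integral => t _; rewrite /C21 convolutionC.
apply: (le_trans (young_L2_L1 (mf2 _) (mv1 k1) (f20 _) (v10 k1) (v1b _))).
by rewrite f2a -EFinM.
Qed.

Let msqr (f : R -> \bar R) : measurable_fun setT f ->
  measurable_fun setT (fun t => f t ^+ 2).
Proof. by move=> mf; under eq_fun do rewrite expe2; apply: emeasurable_funM. Qed.

Let msqrR (f : R -> R) : measurable_fun setT f ->
  measurable_fun setT (fun t => (f t ^+ 2)%:E).
Proof. by move=> mf; apply/measurable_EFinP; exact: measurable_funX. Qed.

Let sqr0 (x : \bar R) : 0 <= x -> 0 <= x ^+ 2. Proof. exact: expe_ge0. Qed.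

(** Cauchy-Schwarz in the lattice variable for a fixed time frequency, then Young's
    inequality for each convolution, with the [L^1] norm on the unweighted factor. *)
Lemma mixed_L2_bound (W : int -> R -> R) :
  (forall k, measurable_fun setT (W k)) -> (forall k t, 0 <= W k t)%R ->
  (forall k t, (W k t)%:E <= c0%:E * \esum_(k1 in [set: int]) ((m k k1)%:E *
    (2%:E * convolution (f1 k1) (v2 (k - k1)%R) t +
     convolution (v1 k1) (f2 (k - k1)%R) t))) ->
  sqmass W <= (c0 ^+ 2 * M * (24 * (S1 * S2)))%:E.
Proof.
move=> mW W0 WQ.
pose Q k k1 t := 2%:E * C12 k k1 t + C21 k k1 t.
have Q0 k k1 t : 0 <= Q k k1 t by rewrite adde_ge0// mule_ge0.
have mQ k k1 : measurable_fun setT (Q k k1).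
  by apply: emeasurable_funD => //; apply: emeasurable_funM.
apply: (@sum_bound _ (fun k k1 => \int[leb]_t (Q k k1 t) ^+ 2)) => [k|k k1].
- rewrite -ge0_integral_esum//; last 2 first.
  + by move=> k1; exact: msqr.
  + by move=> k1 t _; exact: sqr0.
  rewrite -ge0_integralZl_EFin//; last 3 first.
  + by move=> t _; apply: esum_ge0 => k1 _; exact: sqr0.
  + by apply: measurable_esum => // [k1|k1 t _]; [exact: msqr|exact: sqr0].
  + by rewrite mulr_ge0 ?sqr_ge0// ltW.
  apply: ge0_le_integral => //.
  + by move=> t _; rewrite lee_fin sqr_ge0.
  + exact: msqrR.
  + apply: emeasurable_funM => //.
    by apply: measurable_esum => // [k1|k1 t _]; [exact: msqr|exact: sqr0].
  + move=> t _; rewrite EFin_expe.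
    apply: (@le_trans _ _ ((c0%:E * \esum_(k1 in [set: int]) ((m k k1)%:E * Q k k1 t)) ^+ 2)).
      by apply: lee_sqre; [rewrite lee_fin|exact: WQ].
    rewrite cMe sqreM; apply: lee_wpmul2l; first by rewrite sqr0// lee_fin.
    exact: esum_cauchy_schwarz.
- apply: (@le_trans _ _ (\int[leb]_t (8%:E * (C12 k k1 t) ^+ 2 + 2%:E * (C21 k k1 t) ^+ 2))).
    apply: ge0_le_integral => //.
    + by move=> t _; exact: sqr0.
    + exact: msqr.
    + by apply: emeasurable_funD; apply: emeasurable_funM => //; exact: msqr.
    + move=> t _; apply: (le_trans (sqreD_le _ _)); [by rewrite mule_ge0|by []|].
      rewrite sqreM ge0_muleDr ?sqr0// ?mule_ge0 ?sqr0//.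
      by rewrite muleA -EFin_expe -EFinM (_ : 2 * 2 ^+ 2 = 8 :> R)%R//; lra.
  rewrite ge0_integralD//; last 4 first.
  + by move=> t _; rewrite mule_ge0 ?sqr0.
  + by apply: emeasurable_funM => //; exact: msqr.
  + by move=> t _; rewrite mule_ge0 ?sqr0.
  + by apply: emeasurable_funM => //; exact: msqr.
  rewrite !ge0_integralZl_EFin//; try exact: msqr; try by move=> t _; exact: sqr0.
  apply: (@le_trans _ _ (8%:E * (a1 k1 * b2 (k - k1) ^+ 2)%:E +
      2%:E * (b1 k1 ^+ 2 * a2 (k - k1))%:E)).
    by apply: leeD; apply: lee_wpmul2l.
  rewrite -!EFinM -EFinD lee_fin /G.
  have := mulr_ge0 (sqr_ge0 (b1 k1)) (a20 (k - k1)).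
  have := mulr_ge0 (sqr_ge0 (b1 k1)) (sqr_ge0 (b2 (k - k1)%R)); lra.
Qed.

(** Integration in time frequency comes first here: Cauchy-Schwarz against the
    square-integrable weight [w] reduces to the same [L^2] norms of convolutions, and
    where no weight is left the integral of a convolution factorises. *)
Lemma mixed_L1_bound (W w : int -> R -> R) :
  (forall k, measurable_fun setT (W k)) -> (forall k t, 0 <= W k t)%R ->
  (forall k, measurable_fun setT (w k)) -> (forall k t, 0 <= w k t)%R ->
  (forall k, \int[leb]_t (w k t ^+ 2)%:E <= 2%:E) ->
  (forall k t, (W k t)%:E <= c0%:E * \esum_(k1 in [set: int]) ((m k k1)%:E *
    ((w k t)%:E * convolution (f1 k1) (v2 (k - k1)%R) t +
     (w k t)%:E * convolution (v1 k1) (f2 (k - k1)%R) t +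
     convolution (v1 k1) (v2 (k - k1)%R) t))) ->
  \esum_(k in [set: int]) (\int[leb]_t (W k t)%:E) ^+ 2 <=
  (c0 ^+ 2 * M * (24 * (S1 * S2)))%:E.
Proof.
move=> mW W0 mw w0 w2 WQ.
pose Q k k1 t := (w k t)%:E * C12 k k1 t + (w k t)%:E * C21 k k1 t + C11 k k1 t.
have wC0 k t (x : \bar R) : 0 <= x -> 0 <= (w k t)%:E * x.
  by move=> x0; rewrite mule_ge0// lee_fin.
have mwC k (f : R -> \bar R) : measurable_fun setT f ->
    measurable_fun setT (fun t => (w k t)%:E * f t).
  by move=> mf; apply: emeasurable_funM => //; exact/measurable_EFinP.
have Q0 k k1 t : 0 <= Q k k1 t by apply: adde_ge0; [apply: adde_ge0; exact: wC0|exact: C11_0].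
have mQ k k1 : measurable_fun setT (Q k k1).
  by apply: emeasurable_funD => //; apply: emeasurable_funD; exact: mwC.
have mQ' k k1 : measurable_fun setT (fun t => (m k k1)%:E * Q k k1 t).
  exact: emeasurable_funM.
have mQ0 k k1 t : 0 <= (m k k1)%:E * Q k k1 t by rewrite mule_ge0// lee_fin.
apply: (@sum_bound _ (fun k k1 => (\int[leb]_t Q k k1 t) ^+ 2)) => [k|k k1].
- apply: (@le_trans _ _ ((c0%:E *
      \esum_(k1 in [set: int]) ((m k k1)%:E * \int[leb]_t Q k k1 t)) ^+ 2)).
    apply: lee_sqre; first by apply: integral_ge0 => t _; rewrite lee_fin.
    rewrite (eq_esum (b := fun k1 => \int[leb]_t ((m k k1)%:E * Q k k1 t))); last first.
      by move=> k1 _; rewrite ge0_integralZl_EFin//; exact: mQ.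
    have mS : measurable_fun setT (fun t => \esum_(k1 in [set: int]) ((m k k1)%:E * Q k k1 t)).
      by apply: measurable_esum => // k1; exact: mQ'.
    rewrite -ge0_integral_esum//; last by move=> k1; exact: mQ'.
    rewrite -ge0_integralZl_EFin//; last by move=> t _; exact: esum_ge0.
    apply: ge0_le_integral => //.
    + by move=> t _; rewrite lee_fin.
    + by apply/measurable_EFinP; exact: mW.
    + by apply: emeasurable_funM => //; exact: mS.
    + by move=> t _; exact: WQ.
  rewrite cMe sqreM; apply: lee_wpmul2l; first by rewrite sqr0// lee_fin.
  by apply: esum_cauchy_schwarz => // k1; exact: integral_ge0.
- have IQ : \int[leb]_t Q k k1 t = \int[leb]_t C11 k k1 t +
     (\int[leb]_t ((w k t)%:E * C12 k k1 t) + \int[leb]_t ((w k t)%:E * C21 k k1 t)).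
    have s0 t : 0 <= (w k t)%:E * C12 k k1 t + (w k t)%:E * C21 k k1 t.
      by apply: adde_ge0; exact: wC0.
    rewrite /Q ge0_integralD//; [|by apply: emeasurable_funD; exact: mwC|exact: mC11].
    rewrite ge0_integralD//; [by rewrite addeC|by move=> t _; exact: wC0|exact: mwC|
      by move=> t _; exact: wC0|exact: mwC].
  have i12 : (\int[leb]_t ((w k t)%:E * C12 k k1 t)) ^+ 2 <=
      2%:E * (a1 k1 * b2 (k - k1) ^+ 2)%:E.
    apply: (@le_trans _ _ (2%:E * \int[leb]_t (C12 k k1 t) ^+ 2)); last exact: lee_wpmul2l.
    by apply: integral_cauchy_schwarz; [exact: mw|exact: mC12|exact: w0|exact: C12_0| |exact: w2].
  have i21 : (\int[leb]_t ((w k t)%:E * C21 k k1 t)) ^+ 2 <=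
      2%:E * (b1 k1 ^+ 2 * a2 (k - k1))%:E.
    apply: (@le_trans _ _ (2%:E * \int[leb]_t (C21 k k1 t) ^+ 2)); last exact: lee_wpmul2l.
    by apply: integral_cauchy_schwarz; [exact: mw|exact: mC21|exact: w0|exact: C21_0| |exact: w2].
  have i11 : \int[leb]_t C11 k k1 t = (b1 k1 * b2 (k - k1))%:E.
    by rewrite integral_conv// v1b v2b EFinM.
  have J12 : 0 <= \int[leb]_t ((w k t)%:E * C12 k k1 t).
    by apply: integral_ge0 => t _; exact: wC0.
  have J21 : 0 <= \int[leb]_t ((w k t)%:E * C21 k k1 t).
    by apply: integral_ge0 => t _; exact: wC0.
  have J11 : 0 <= \int[leb]_t C11 k k1 t by exact: integral_ge0.
  rewrite IQ; apply: (le_trans (sqreD_le J11 (adde_ge0 J12 J21))).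
  apply: (@le_trans _ _ (2%:E * (((b1 k1 * b2 (k - k1)) ^+ 2)%:E +
     2%:E * (2%:E * (a1 k1 * b2 (k - k1) ^+ 2)%:E + 2%:E * (b1 k1 ^+ 2 * a2 (k - k1))%:E)))).
    apply: lee_wpmul2l => //; rewrite i11 EFin_expe; apply: leeD => //.
    apply: (le_trans (sqreD_le J12 J21)); apply: lee_wpmul2l => //; exact: leeD.
  have E (x y z : R) : 2%:E * (x%:E + 2%:E * (2%:E * y%:E + 2%:E * z%:E)) =
    (2 * (x + 2 * (2 * y + 2 * z)))%:E by [].
  rewrite E lee_fin /G exprMn.
  have := mulr_ge0 (sqr_ge0 (b1 k1)) (sqr_ge0 (b2 (k - k1)%R)); lra.
Qed.

End MixedConvolution.

End Bilinear.

Section Estimate.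
Context {R : realType}.
Local Notation leb := (@lebesgue_measure R).
Local Notation nc := (@Normc.normc R).
Implicit Types (lambda alpha s b : R) (V U : int -> R -> R[i]).

Lemma weighted_ge0 lambda alpha s b V k t : 0 <= weighted lambda alpha s b V k t.
Proof. by rewrite !mulr_ge0 ?powR_ge0 ?normc_ge0. Qed.

Lemma measurable_weighted lambda alpha s b V k :
  measurable_fun setT (fun t => nc (V k t)) ->
  measurable_fun setT (weighted lambda alpha s b V k).
Proof.
move=> mV; apply: measurable_funM => //; apply: measurable_funM => //.
apply: (measurableT_comp (f := fun x : R => bracket x `^ b)).
  exact: measurable_bracket_powR.
exact: measurable_funB.
Qed.

Lemma lee_of_sqre (X : \bar R) (r : R) : (0 <= X)%E -> 0 <= r ->
  (X ^+ 2 <= (r ^+ 2)%:E)%E -> (X <= r%:E)%E.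
Proof.
case: X => [x| |]// x0 r0.
by rewrite -EFin_expe !lee_fin ler_sqr.
Qed.

Lemma bracket_pow_le1 (x b : R) : 0 <= b -> bracket x `^ (- b) <= 1.
Proof.
by move=> b0; rewrite -(powRr0 (bracket x)) ler_powR ?bracket_ge1// oppr_le0.
Qed.

Lemma bracket_pow_ge1 (x b : R) : 0 <= b -> 1 <= bracket x `^ b.
Proof. by move=> b0; rewrite -(powRr0 (bracket x)) ler_powR ?bracket_ge1. Qed.

Lemma integral_bracket_shift_le (c : R) :
  (\int[leb]_t ((bracket (t - c) `^ (- 1)) ^+ 2)%:E <= 2%:E)%E.
Proof.
have := @integral_bracket_le R 2; rewrite ltr1n => /(_ isT).
rewrite (_ : 2 * (2 - 1)^-1 = 2)%R; last by field.
apply: le_trans; rewrite le_eqVlt; apply/orP; left; apply/eqP.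
rewrite -[RHS](@ge0_integral_addr _ (- c)) ?preimage_setT//.
- apply: eq_integral => t _; rewrite -powR_mulrn ?powR_ge0// -powRrM mulN1r.
  by [].
- by apply/measurable_EFinP; exact: measurable_bracket_powR.
- by move=> x _; rewrite lee_fin powR_ge0.
Qed.

Section Data.
Variables (lambda alpha s : R) (V : int -> R -> R[i]).
Hypotheses (lambda0 : 0 < lambda) (mV : forall k, cmeas setT (V k)).
Hypothesis Vy : (Ynorm lambda alpha s V < +oo)%E.
Let y := fine (Ynorm lambda alpha s V).
Let v := weighted lambda alpha s 0 V.
Let f := weighted lambda alpha s 2^-1 V.

Let S := (2 * pi * lambda) * y ^+ 2.

Let Yfin : Ynorm lambda alpha s V = y%:E.
Proof. by rewrite fineK// ge0_fin_numE// adde_ge0 ?L2Lnorm_ge0. Qed.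

Let mass_le (X N : \bar R) : (0 <= N)%E -> (N <= y%:E)%E ->
  (N ^+ 2 = ((2 * pi * lambda)^-1)%:E * X)%E -> (X <= S%:E)%E.
Proof.
move=> N0 Ny NX; have L0 : 0 < 2 * pi * lambda by rewrite !mulr_gt0 ?pi_gt0.
have -> : X = ((2 * pi * lambda)%:E * N ^+ 2)%E.
  by rewrite NX muleA -EFinM mulfV ?gt_eqF// mul1e.
rewrite /S [leRHS]EFinM EFin_expe; apply: lee_wpmul2l; first by rewrite lee_fin ltW.
exact: lee_sqre.
Qed.

(** Real-valued masses, as the convolution estimates require: a finite norm makes
    the masses at each single frequency finite. *)
Lemma Ynorm_masses : exists a b : int -> R,
  [/\ forall k, (\int[leb]_t (f k t ^+ 2)%:E = (a k)%:E)%E,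
      forall k, (\int[leb]_t (v k t)%:E = (b k)%:E)%E,
      (\esum_(k in [set: int]) (a k)%:E <= S%:E)%E &
      (\esum_(k in [set: int]) (b k ^+ 2)%:E <= S%:E)%E].
Proof.
have mv k : measurable_fun setT (v k) by apply: measurable_weighted; exact: cmeas_normc.
have N2 : (L2Lnorm lambda 2 f <= y%:E)%E by rewrite -Yfin leeDl ?L2Lnorm_ge0.
have N1 : (L2Lnorm lambda 1 v <= y%:E)%E by rewrite -Yfin leeDr ?L2Lnorm_ge0.
have aS := mass_le (L2Lnorm_ge0 _ _ _) N2 (L2Lnorm2_sqr f lambda0).
have bS := mass_le (L2Lnorm_ge0 _ _ _) N1 (L2Lnorm_sqr 1 v lambda0).
have N1E k : ('N[leb]_1%:E[EFin \o v k] = \int[leb]_t (v k t)%:E)%E.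
  rewrite Lnorm1; apply: eq_integral => t _ /=.
  by rewrite ger0_norm// weighted_ge0.
have a0 k : (0 <= \int[leb]_t (f k t ^+ 2)%:E)%E.
  by apply: integral_ge0 => t _; rewrite lee_fin sqr_ge0.
have b0 k : (0 <= \int[leb]_t (v k t)%:E)%E.
  by apply: integral_ge0 => t _; rewrite lee_fin weighted_ge0.
have afin k : (\int[leb]_t (f k t ^+ 2)%:E)%E \is a fin_num.
  rewrite ge0_fin_numE//; apply: le_lt_trans (ltry S); apply: le_trans aS.
  exact: (le_esum_term (a := fun k => \int[leb]_t (f k t ^+ 2)%:E)%E).
have bfin k : (\int[leb]_t (v k t)%:E)%E \is a fin_num.
  have : ((\int[leb]_t (v k t)%:E) ^+ 2 < +oo)%E.
    apply: le_lt_trans (ltry S); apply: le_trans bS; rewrite -N1E.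
    apply: (le_esum_term (a := fun k => ('N[leb]_1%:E[EFin \o v k]) ^+ 2)%E) => j.
    by rewrite expe_ge0// N1E.
  rewrite ge0_fin_numE// !ltey; apply: contraNN => /eqP ->.
  by rewrite expe2 mulyy.
exists (fun k => fine (\int[leb]_t (f k t ^+ 2)%:E)%E).
exists (fun k => fine (\int[leb]_t (v k t)%:E)%E); split.
- by move=> k; rewrite fineK.
- by move=> k; rewrite fineK.
- by apply: le_trans aS; apply: le_esum => k _; rewrite fineK.
- apply: le_trans bS; apply: le_esum => k _; rewrite N1E EFin_expe fineK//.
Qed.

(** For [s >= 0] all weights in the norm are at least one. *)
Lemma sqmass_normc_lty : 0 <= s -> (sqmass (fun k t => nc (V k t)) < +oo)%E.
Proof.
move=> s0; have [a [_ [fa _ aS _]]] := Ynorm_masses.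
apply: le_lt_trans (ltry S); apply: le_trans aS; apply: le_esum => k _; rewrite -fa.
have mV' : measurable_fun setT (fun t => nc (V k t)) by exact: cmeas_normc.
have mf : measurable_fun setT (f k) by exact: measurable_weighted.
apply: ge0_le_integral => //.
- by move=> t _; rewrite lee_fin sqr_ge0.
- by apply/measurable_EFinP; exact: measurable_funX.
- by apply/measurable_EFinP; exact: measurable_funX.
move=> t _; rewrite lee_fin ler_sqr ?nnegrE ?normc_ge0 ?weighted_ge0//.
by rewrite ler_peMl ?normc_ge0// -[1]mulr1 ler_pM// bracket_pow_ge1// invr_ge0.
Qed.

End Data.

Lemma normc_imagM (x : R) (z : R[i]) : nc ((0 +i* x) * z) = `|x| * nc z.
Proof. by rewrite Normc.normcM /Normc.normc expr0n add0r sqrtr_sqr. Qed.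

(** By [symbol_le], the output modulation weights of the two parts of the norm leave
    [2 f1 * v2 + v1 * f2], respectively [w (f1 * v2 + v1 * f2) + v1 * v2] with [w] the
    inverse bracket of the output modulation, which is square integrable.
    The constant collects [c0^2], the multiplier bound [lambda M], the factor [24] of
    the convolution bounds and the normalisations [2 pi lambda] of the norms. *)
Lemma bilinear_estimate lambda alpha s (M : R) V1 V2 U :
  0 < lambda -> 0 < M ->
  (forall k, \esum_(k1 in [set: int])
     (lambda^-1 * mult alpha s (freq lambda k) (freq lambda k1) ^+ 2)%:E <= M%:E)%E ->
  (forall k, cmeas setT (V1 k)) -> (forall k, cmeas setT (V2 k)) ->
  (forall k, measurable_fun setT (fun t => nc (U k t))) ->
  (forall k tau, (nc (U k tau))%:E <=
     (`|freq lambda k| * (2 * pi * (2 * pi * lambda))^-1)%:E *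
     \esum_(k1 in [set: int])
       convolution (fun t => nc (V1 k1 t)) (fun t => nc (V2 (k - k1)%R t)) tau)%E ->
  (Ynorm lambda alpha s V1 < +oo)%E -> (Ynorm lambda alpha s V2 < +oo)%E ->
  (Znorm lambda s U <= (2 * Num.sqrt (24 * M / (8 * pi ^+ 3)))%:E *
    (Ynorm lambda alpha s V1 * Ynorm lambda alpha s V2))%E.
Proof.
move=> l0 M0 mM mV1 mV2 mU UV Y1 Y2.
have p0 := @pi_gt0 R.
set c0 : R := (2 * pi * (2 * pi * lambda))^-1.
have c0_ge0 : 0 <= c0 by rewrite invr_ge0 !mulr_ge0// ltW.
have [a1 [b1 [f1a v1b aS1 bS1]]] := Ynorm_masses l0 mV1 Y1.
have [a2 [b2 [f2a v2b aS2 bS2]]] := Ynorm_masses l0 mV2 Y2.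
have mn V (mV : forall k, cmeas setT (V k)) k : measurable_fun setT (fun t => nc (V k t)).
  exact: cmeas_normc.
have mw V b (mV : forall k, cmeas setT (V k)) k :
    measurable_fun setT (weighted lambda alpha s b V k).
  by apply: measurable_weighted; exact: mn.
have w0 V b k t : 0 <= weighted lambda alpha s b V k t by exact: weighted_ge0.
pose m k k1 := mult alpha s (freq lambda k) (freq lambda k1).
have m0 k k1 : 0 <= m k k1 by exact: mult_ge0.
have lM0 : 0 < lambda * M by rewrite mulr_gt0.
have mlM k : (\esum_(k1 in [set: int]) (m k k1 ^+ 2)%:E <= (lambda * M)%:E)%E.
  rewrite EFinM; apply: le_trans (lee_wpmul2l _ (mM k)); last by rewrite lee_fin ltW.
  rewrite -ge0_esumZl ?lee_fin ?(ltW l0)//; last first.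
    by move=> k1; rewrite lee_fin mulr_ge0 ?sqr_ge0// invr_ge0 ltW.
  by apply: le_esum => k1 _; rewrite -EFinM mulrA mulfV ?gt_eqF// mul1r.
set y1 := fine (Ynorm lambda alpha s V1) in aS1 bS1 *.
set y2 := fine (Ynorm lambda alpha s V2) in aS2 bS2 *.
have Y1E : Ynorm lambda alpha s V1 = y1%:E.
  by rewrite fineK// ge0_fin_numE// adde_ge0 ?L2Lnorm_ge0.
have Y2E : Ynorm lambda alpha s V2 = y2%:E.
  by rewrite fineK// ge0_fin_numE// adde_ge0 ?L2Lnorm_ge0.
have y10 : 0 <= y1 by rewrite -lee_fin -Y1E adde_ge0 ?L2Lnorm_ge0.
have y20 : 0 <= y2 by rewrite -lee_fin -Y2E adde_ge0 ?L2Lnorm_ge0.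
(* both parts of the norm at once: [g] is the weight in the output modulation, and
   [c1], [c2], [c3] are what [g] leaves of the three convolutions *)
have UW (g : R -> R) (c1 c2 c3 : R) k tau : 0 <= g (tau - 1 * freq lambda k ^+ 3) ->
    0 <= c1 -> 0 <= c2 -> 0 <= c3 ->
    (forall v1 v2 q r, 0 <= v1 -> 0 <= v2 -> 1 <= q -> 1 <= r ->
      g (tau - 1 * freq lambda k ^+ 3) *
        (bracket (tau - 1 * freq lambda k ^+ 3) `^ 2^-1 * (v1 * v2) +
        (q * v1) * v2 + v1 * (r * v2)) <=
      c1 * ((q * v1) * v2) + c2 * (v1 * (r * v2)) + c3 * (v1 * v2)) ->
    ((bracket (freq lambda k) `^ s * g (tau - 1 * freq lambda k ^+ 3) * nc (U k tau))%:E <=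
     c0%:E * \esum_(k1 in [set: int]) ((m k k1)%:E *
      (c1%:E * convolution (weighted lambda alpha s 2^-1 V1 k1)
                 (weighted lambda alpha s 0 V2 (k - k1)%R) tau +
       c2%:E * convolution (weighted lambda alpha s 0 V1 k1)
                 (weighted lambda alpha s 2^-1 V2 (k - k1)%R) tau +
       c3%:E * convolution (weighted lambda alpha s 0 V1 k1)
                 (weighted lambda alpha s 0 V2 (k - k1)%R) tau)))%E.
  move=> g0 c10 c20 c30 H; set gg := g _ in g0 H *.
  have bg0 : 0 <= bracket (freq lambda k) `^ s * gg by rewrite mulr_ge0 ?powR_ge0.
  rewrite EFinM; apply: (le_trans (lee_wpmul2l _ (UV k tau))); first by rewrite lee_fin.
  have n0 V j t : 0 <= nc (V j t) by exact: normc_ge0.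
  rewrite muleA -EFinM -/c0.
  rewrite (_ : _ * gg * (_ * c0) =
    c0 * (bracket (freq lambda k) `^ s * gg * `|freq lambda k|)); last by ring.
  rewrite EFinM -muleA.
  apply: lee_wpmul2l; first by rewrite lee_fin.
  have x0 : 0 <= bracket (freq lambda k) `^ s * gg * `|freq lambda k| by rewrite mulr_ge0.
  rewrite -ge0_esumZl ?lee_fin//; last by move=> k1; exact: conv_ge0.
  apply: le_esum => k1 _.
  have cv0 (f h : R -> R) : (forall t, 0 <= f t) -> (forall t, 0 <= h t) ->
    (0 <= convolution f h tau)%E by move=> ? ?; exact: conv_ge0.
  have E : forall c12 c21 c11 : \bar R, (0 <= c12)%E -> (0 <= c21)%E -> (0 <= c11)%E ->
     ((m k k1)%:E * (c1%:E * c12 + c2%:E * c21 + c3%:E * c11) =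
     (m k k1 * c1)%:E * c12 + (m k k1 * c2)%:E * c21 + (m k k1 * c3)%:E * c11)%E.
    move=> c12 c21 c11 h12 h21 h11.
    rewrite !ge0_muleDr ?adde_ge0 ?mule_ge0 ?lee_fin//.
    by rewrite !EFinM !muleA.
  rewrite E ?cv0//; apply: conv_le_comb => //; try exact: mn; try exact: mw;
    try by move=> t; exact: n0.
  1-3: by apply: mulr_ge0.
  move=> t.
  have sym := @symbol_le R alpha s (freq lambda k) (freq lambda k1) tau t
    (nc (V1 k1 t)) (nc (V2 (k - k1) (tau - t))) (n0 _ _ _) (n0 _ _ _).
  rewrite freqB in sym.
  have {}H := H (bracket (freq lambda k1) `^ s * nc (V1 k1 t))
    (bracket (freq lambda (k - k1)) `^ s * nc (V2 (k - k1) (tau - t)))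
    (bracket (t - alpha * freq lambda k1 ^+ 3) `^ 2^-1)
    (bracket (tau - t - alpha * freq lambda (k - k1) ^+ 3) `^ 2^-1).
  have b1p (x : R) : 1 <= bracket x `^ 2^-1 by rewrite bracket_pow_ge1// invr_ge0.
  have {}H := H (mulr_ge0 (powR_ge0 _ _) (n0 _ _ _)) (mulr_ge0 (powR_ge0 _ _) (n0 _ _ _))
    (b1p _) (b1p _).
  have := ler_wpM2l (m0 k k1) H; have := ler_wpM2l g0 sym.
  rewrite -/(m k k1) /weighted !powRr0 !mulr1 => h1 h2.
  apply: (@le_trans _ _ (gg * (`|freq lambda k| * bracket (freq lambda k) `^ s *
    (nc (V1 k1 t) * nc (V2 (k - k1) (tau - t)))))).
    by rewrite le_eqVlt; apply/orP; left; apply/eqP; ring.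
  apply: (le_trans h1); rewrite mulrCA; apply: (le_trans h2).
  by rewrite le_eqVlt; apply/orP; left; apply/eqP; ring.
have S0 (y : R) : 0 <= y -> 0 <= 2 * pi * lambda * y ^+ 2.
  by move=> ?; rewrite !mulr_ge0// ltW.
set B := c0 ^+ 2 * (lambda * M) * (24 * ((2 * pi * lambda * y1 ^+ 2) * (2 * pi * lambda * y2 ^+ 2))).
set K := Num.sqrt (24 * M / (8 * pi ^+ 3)).
have K0 : 0 <= K by exact: sqrtr_ge0.
have KB : (2 * pi * lambda)^-1 * B = (K * (y1 * y2)) ^+ 2.
  rewrite exprMn sqr_sqrtr; last by rewrite divr_ge0// !mulr_ge0// ?exprn_ge0// ltW.
  rewrite /B /c0; have pn : (pi : R) != 0 by rewrite gt_eqF.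
  have ln : lambda != 0 by rewrite gt_eqF.
  by move: (@pi R) pn => q qn; field; rewrite ln qn.
have finish (X N : \bar R) : (0 <= N)%E -> (N ^+ 2 = ((2 * pi * lambda)^-1)%:E * X)%E ->
    (X <= B%:E)%E -> (N <= (K * (y1 * y2))%:E)%E.
  move=> N0 NX XB; apply: lee_of_sqre => //; first by rewrite !mulr_ge0.
  rewrite NX -KB EFinM; apply: lee_wpmul2l => //.
  by rewrite lee_fin invr_ge0 !mulr_ge0// ltW.
rewrite Y1E Y2E -!EFinM.
rewrite (_ : 2 * K * (y1 * y2) = K * (y1 * y2) + K * (y1 * y2)); last by ring.
rewrite EFinD; apply: leeD.
- apply: (finish (sqmass (weighted lambda 1 s (- 2^-1) U))); first exact: L2Lnorm_ge0.
    exact: L2Lnorm2_sqr.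
  apply: (@mixed_L2_bound R (weighted lambda alpha s 2^-1 V1) (weighted lambda alpha s 2^-1 V2)
    (weighted lambda alpha s 0 V1) (weighted lambda alpha s 0 V2) a1 a2 b1 b2 m) => //;
    try by move=> k; exact: mw.
  + by move=> k; exact: measurable_weighted.
  + by move=> k t; exact: weighted_ge0.
  move=> k tau.
  apply: le_trans (UW (fun x => bracket x `^ (- 2^-1)) 2 1 0 k tau _ _ _ _ _) _ => //.
  + exact: powR_ge0.
  + move=> v1 v2 q r v10 v20 q1 r1; set p := bracket _.
    have pp : p `^ (- 2^-1) * p `^ 2^-1 = 1.
      by rewrite powRN mulVf// gt_eqF// powR_gt0 ?bracket_gt0.
    have p1 : p `^ (- 2^-1) <= 1 by rewrite bracket_pow_le1// invr_ge0.
    have p00 : 0 <= p `^ (- 2^-1) by exact: powR_ge0.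
    rewrite !mulrDr mulrA pp.
    have A0 : 0 <= q * v1 * v2 by rewrite !mulr_ge0// (le_trans _ q1).
    have B0 : 0 <= v1 * (r * v2) by rewrite !mulr_ge0// (le_trans _ r1).
    have := ler_piMl A0 p1; have := ler_piMl B0 p1.
    have : v1 * v2 <= q * v1 * v2 by rewrite -mulrA ler_peMl ?mulr_ge0.
    lra.
  + apply: lee_wpmul2l; first by rewrite lee_fin.
    apply: le_esum => k1 _; apply: lee_wpmul2l; first by rewrite lee_fin.
    by rewrite mul0e adde0 mul1e.
- apply: (finish (\esum_(k in [set: int]) (\int[leb]_t (weighted lambda 1 s (- 1) U k t)%:E) ^+ 2)%E).
  + exact: L2Lnorm_ge0.
  + rewrite L2Lnorm_sqr//; congr (_ * _)%E; apply: eq_esum => k _.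
    rewrite Lnorm1; congr (_ ^+ 2)%E; apply: eq_integral => t _ /=.
    by rewrite ger0_norm// weighted_ge0.
  apply: (@mixed_L1_bound R (weighted lambda alpha s 2^-1 V1) (weighted lambda alpha s 2^-1 V2)
    (weighted lambda alpha s 0 V1) (weighted lambda alpha s 0 V2) a1 a2 b1 b2 m _ _ _ _
    _ _ _ _ _ _ _ _ _ _ _ _ _ _ _ _ _ _ _ _ _
    (fun k t => bracket (t - 1 * freq lambda k ^+ 3) `^ (- 1))) => //;
    try by move=> k; exact: mw.
  + by move=> k; exact: measurable_weighted.
  + by move=> k t; exact: weighted_ge0.
  + move=> k; apply: (measurableT_comp (f := fun x : R => bracket x `^ (- 1))).
      exact: measurable_bracket_powR.
    exact: measurable_funB.
  + by move=> k t; exact: powR_ge0.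
  + by move=> k; exact: integral_bracket_shift_le.
  + move=> k tau; set w := bracket _ `^ (-1).
    have w00 : 0 <= w by exact: powR_ge0.
    apply: le_trans (UW (fun x => bracket x `^ (- 1)) w w 1 k tau _ _ _ _ _) _ => //.
    * move=> v1 v2 q r v10 v20 q1 r1; rewrite -/w; set p := bracket _.
      have wp : w * p `^ 2^-1 = p `^ (- 2^-1).
        rewrite /w -/p -powRD; last by rewrite (gt_eqF (bracket_gt0 _)) implybT.
        by congr (_ `^ _); lra.
      have p1 : p `^ (- 2^-1) <= 1 by rewrite bracket_pow_le1// invr_ge0.
      rewrite !mulrDr [w * (_ `^ _ * _)]mulrA wp.
      have := ler_piMl (mulr_ge0 v10 v20) p1; lra.
    * apply: lee_wpmul2l; first by rewrite lee_fin.
      apply: le_esum => k1 _; apply: lee_wpmul2l; first by rewrite lee_fin.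
      by rewrite mul1e.
Qed.


End Estimate.

Theorem proposition3p7 (R : realType) (alpha s eps : R)
  (alpha_gt0 : 0 < alpha) (alpha_lt1 : alpha < 1) (eps_gt0 : 0 < eps)
  (hs : ge_min1_plus s
          ((2^-1)%:E + (2^-1)%:E * nu_index (c1 alpha))%E) :
  exists2 C : R, 0 < C &
    forall (lambda : R) (v1 v2 : R * R -> R[i]) (V1 V2 : int -> R -> R[i]),
      1 <= lambda ->
      is_fourier_L2 lambda v1 V1 -> is_fourier_L2 lambda v2 V2 ->
      (Ynorm lambda alpha s V1 < +oo)%E -> (Ynorm lambda alpha s V2 < +oo)%E ->
      (Znorm lambda s (fourier_dx lambda (fun p => (v1 p * v2 p)%R)) <=
         (C * C1 alpha eps lambda)%:E *
           (Ynorm lambda alpha s V1 * Ynorm lambda alpha s V2))%E.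
Proof.
have [s12 _ _ _] := near_bounds alpha_gt0 alpha_lt1 eps_gt0 hs.
have s0 : 0 <= s by lra.
have [C C0 hC] := multiplier_bound alpha_gt0 alpha_lt1 eps_gt0 hs.
have p3 : 0 < 8 * (pi : R) ^+ 3 by rewrite mulr_gt0// exprn_gt0// pi_gt0.
(* the factor [C1 ^+ 2] of the multiplier bound comes out of the square root *)
exists (2 * Num.sqrt (24 * C / (8 * pi ^+ 3))).
  by rewrite mulr_gt0// sqrtr_gt0 divr_gt0// mulr_gt0.
move=> lambda v1 v2 V1 V2 l1 V1F V2F Y1 Y2.
have l0 : 0 < lambda by lra.
have C1_gt0 : 0 < C1 alpha eps lambda.
  by rewrite /C1; case: ifP => _; rewrite powR_gt0.
have M0 : 0 < C * C1 alpha eps lambda ^+ 2 by rewrite mulr_gt0// exprn_gt0.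
have mV1 k := is_fourier_L2_cmeas k V1F; have mV2 k := is_fourier_L2_cmeas k V2F.
have [sq1 _ _ _] := V1F; have [sq2 _ _ _] := V2F.
have vi := cintegrable_mul sq1 sq2.
have KE : 2 * Num.sqrt (24 * (C * C1 alpha eps lambda ^+ 2) / (8 * pi ^+ 3)) =
    2 * Num.sqrt (24 * C / (8 * pi ^+ 3)) * C1 alpha eps lambda.
  rewrite (_ : _ / _ = 24 * C / (8 * pi ^+ 3) * C1 alpha eps lambda ^+ 2); last by ring.
  rewrite sqrtrM; last by rewrite divr_ge0// ?(ltW p3)// mulr_ge0// ltW.
  by rewrite sqrtr_sqr ger0_norm ?(ltW C1_gt0)// mulrA.
rewrite -KE; apply: (bilinear_estimate l0 M0 (fun k => hC lambda k l1) mV1 mV2) => //.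
- move=> k; rewrite /fourier_dx; under eq_fun do rewrite normc_imagM.
  apply: measurable_funM => //; apply: cmeas_normc; apply: cmeas_FT => //.
  exact: measurable_strip.
- move=> k tau; rewrite /fourier_dx normc_imagM EFinM [in leRHS]EFinM -muleA.
  apply: lee_wpmul2l; first by rewrite lee_fin.
  by apply: fourier_mul_le => //; [exact: (sqmass_normc_lty l0 mV1 Y1)|
    exact: (sqmass_normc_lty l0 mV2 Y2)].
Qed.
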